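(* Let $r_{\alpha,C}$ be a uniform bound on $|f|$ over $f\in\tilde W(\alpha,C)$. Suppose $n\ge2$, $0<\varepsilon<1$, $n\varepsilon\ge1$, and $0<\delta<1/2$. If $T=r_{\alpha,C}+2\sigma\sqrt{2\log n}$ and $$K=\max\left\{1,\left\lfloor c_1\min\left(n^{\frac1{2\alpha+1}},(n\varepsilon)^{\frac1{\alpha+1}}\right)\right\rfloor\right\}$$ for some sufficiently small absolute constant $c_1\in(0,1]$, then the estimator $\tilde f_{K,T}$ defined in the context is $(\varepsilon,\delta)$-differentially private and $$\sup_{f\in\tilde W(\alpha,C)}\mathbb E\left[\int_0^1(\tilde f_{K,T}(x)-f(x))^2\,dx\right]\ \le\ C'\left(n^{-\frac{2\alpha}{2\alpha+1}}+(n\varepsilon)^{-\frac{2\alpha}{\alpha+1}}\log n\,\log(1/\delta)\right),$$ where $C'$ may depend only on the fixed parameters $\alpha,C,\sigma_-,\sigma_+$, but not on $n,\varepsilon,\delta$.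
   Context: Nonparametric regression: $(Y_i,X_i)$, $i\in[n]$, are i.i.d. with $Y_i=f(X_i)+\xi_i$, $X_i\sim U[0,1]$, and $\xi_i\sim N(0,\sigma^2)$ independent of $X_i$; $\sigma$ is a fixed constant with $0<\sigma_-\le\sigma\le\sigma_+<\infty$. $\alpha\ge1$ is a fixed integer and $C>0$ a fixed radius. The periodic Sobolev class is $$\tilde W(\alpha,C)=\Big\{f:[0,1]\to\mathbb R:\ \int_0^1\big(f(x)^2+(f^{(\alpha)}(x))^2\big)dx\le C^2,\ f^{(j)}(0)=f^{(j)}(1),\ 0\le j\le\alpha-1\Big\};$$ equivalently, $f=\sum_j\theta_j\varphi_j$ with $\varphi_1=1$, $\varphi_{2k}(t)=\sqrt2\cos(2\pi kt)$, $\varphi_{2k+1}(t)=\sqrt2\sin(2\pi kt)$ and $\sum_j\tau_j^2\theta_j^2\le C^2$, where $\tau_1=1$, $\tau_{2k}=\tau_{2k+1}=\sqrt{1+(2\pi k)^{2\alpha}}$. The uniform bound $r_{\alpha,C}<\infty$ is a fixed number determined by $\alpha$ and $C$. Estimator: let $\boldsymbol\varphi(x)=(\varphi_1(x),\dots,\varphi_K(x))$ and $$\tilde\theta_{K,T}=\frac1n\sum_{i=1}^nY_i\mathbf 1(|Y_i|\le T)\,\boldsymbol\varphi(X_i)+w,\qquad w\sim N(0,\tau^2I_K),\qquad \tau^2=\frac{16T^2K\log(1.25/\delta)}{n^2\varepsilon^2},$$ with $w$ independent of the data, and $\tilde f_{K,T}(x)=\sum_{j=1}^K(\tilde\theta_{K,T})_j\varphi_j(x)$.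 Differential privacy: a randomized algorithm $M$ is $(\varepsilon,\delta)$-differentially private if for every two data sets $D,D'$ of size $n$ differing by replacement of one record $(Y_i,X_i)$ and every measurable $S$, $\mathbb P(M(D)\in S)\le e^\varepsilon\mathbb P(M(D')\in S)+\delta$ (probability over $M$ only). *)

(* Defs.v *)
From HB Require Import structures.
From mathcomp Require Import all_boot all_order all_algebra.
From mathcomp Require Import all_classical all_reals all_analysis.
Set Implicit Arguments.
Unset Strict Implicit.
Unset Printing Implicit Defensive.
Import Order.TTheory GRing.Theory Num.Theory.
Import numFieldNormedType.Exports.
Local Open Scope classical_set_scope.
Local Open Scope ring_scope.

Section sobolev.
Context {R : realType}.

Local Notation mu := (@lebesgue_measure R).

(* [derivs alpha f D]: the function [f] on [0, 1] has derivatives [D j],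
   [j <= alpha], in the Sobolev sense: for [j < alpha], [D j] is absolutely
   continuous on [0, 1] with derivative [D j.+1], i.e. an indefinite integral of
   [D j.+1]. The last derivative [D alpha] is defined up to a null set; its
   integrability comes from the bound on its L2 norm in [sobolev_class]. *)
Definition derivs (alpha : nat) (f : R -> R) (D : nat -> R -> R) : Prop :=
  [/\ forall x, x \in `[0, 1] -> D 0%N x = f x,
      measurable_fun (`[0, 1]%classic : set R) (D alpha)
    & forall j, (j < alpha)%N -> forall x, x \in `[0, 1] ->
        D j x = D j 0 + \int[mu]_(t in `[0, x]%classic) D j.+1 t].

(* A function on [0, 1] is a function on R whose values outside [0, 1] are
   unconstrained. *)
Definition sobolev_class (alpha : nat) (C : R) : set (R -> R) :=
  [set f | exists D : nat -> R -> R,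
    [/\ derivs alpha f D,
        (\int[mu]_(x in `[0%R, 1%R]%classic)
           ((f x) ^+ 2 + (D alpha x) ^+ 2)%:E <= (C ^+ 2)%:E)%E
      & forall j, (j < alpha)%N -> D j 0 = D j 1]].

End sobolev.

Section estimator.
Context {R : realType}.

(* The trigonometric basis, indexed from 1: [j./2] is k for j = 2k and for
   j = 2k+1. *)
Definition trig (j : nat) (t : R) : R :=
  if (j <= 1)%N then 1
  else if odd j then Num.sqrt 2 * sin (2 * pi * (j./2)%:R * t)
  else Num.sqrt 2 * cos (2 * pi * (j./2)%:R * t).

(* A data set is a family of records (Y_i, X_i); ['I_K] is numbered from 0, so
   that [j : 'I_K] stands for the basis function of index [j.+1]. *)
Definition theta_tilde (n K : nat) (T : R) (data : 'I_n -> R * R)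
    (w : 'I_K -> R) (j : 'I_K) : R :=
  n%:R^-1 * (\sum_(i < n)
     (data i).1 * (`|(data i).1| <= T)%R%:R * trig j.+1 (data i).2) + w j.

Definition f_tilde (n K : nat) (T : R) (data : 'I_n -> R * R)
    (w : 'I_K -> R) (x : R) : R :=
  \sum_(j < K) theta_tilde T data w j * trig j.+1 x.

(* The standard deviation tau of each coordinate of the privacy noise. *)
Definition noise_sd (n K : nat) (T eps delta : R) : R :=
  Num.sqrt (16 * T ^+ 2 * K%:R * ln (5 / 4 / delta) / (n%:R ^+ 2 * eps ^+ 2)).

Definition truncation_level (n : nat) (r sigma : R) : R :=
  r + 2 * sigma * Num.sqrt (2 * ln n%:R).

Definition cutoff (n alpha : nat) (c1 eps : R) : nat :=
  maxn 1 (Num.truncn (c1 * Num.min (n%:R `^ (1 / (2 * alpha%:R + 1)))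
                                   ((n%:R * eps) `^ (1 / (alpha%:R + 1))))).

Definition rate (n alpha : nat) (eps delta : R) : R :=
  n%:R `^ (- (2 * alpha%:R / (2 * alpha%:R + 1))) +
  (n%:R * eps) `^ (- (2 * alpha%:R / (alpha%:R + 1))) * ln n%:R * ln (1 / delta).

End estimator.

Section probability_notions.
Context {R : realType} {d : measure_display} {Omega : measurableType d}.
Variable P : probability Omega R.

Definition mutually_independent (I : finType) (Z : I -> {RV P >-> R}) : Prop :=
  forall (J : {set I}) (B : I -> set R),
    (forall i, measurable (B i)) ->
    P (\bigcap_(i in [set` J]) (Z i @^-1` B i)) =
    (\prod_(i in J) P (Z i @^-1` B i))%E.

(* The design, the errors and the privacy noise. Since X_i is independent of
   xi_i, the pairs (X_i, xi_i) are i.i.d., w has covariance tau^2 I and w is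
   independent of the data, all the coordinates together are mutually
   independent (and conversely). [normal_prob m s] is the normal law with mean
   [m] and standard deviation [s]. *)
Definition regression_model (n K : nat) (sigma tau : R)
    (X xi : 'I_n -> {RV P >-> R}) (w : 'I_K -> {RV P >-> R}) : Prop :=
  [/\ forall i (A : set R), measurable A ->
        distribution P (X i) A = uniform_prob (@ltr01 R) A,
      forall i (A : set R), measurable A ->
        distribution P (xi i) A = normal_prob 0 sigma A,
      forall j (A : set R), measurable A ->
        distribution P (w j) A = normal_prob 0 tau A
    & mutually_independent
        (fun s : 'I_n + 'I_n + 'I_K =>
           match s with
           | inl (inl i) => X i
           | inl (inr i) => xi i
           | inr j => w j
           end)].

(* [records] is the set of admissible records, [M data] the random output of the
   algorithm on the data set [data]. *)
Definition differentially_private (n : nat) (Rec : Type) (records : set Rec)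
    (d' : measure_display) (Out : measurableType d')
    (M : ('I_n -> Rec) -> Omega -> Out) (eps delta : R) : Prop :=
  (forall D, (forall i, records (D i)) -> measurable_fun setT (M D)) /\
  forall D D' : 'I_n -> Rec,
    (forall i, records (D i)) -> (forall i, records (D' i)) ->
    (exists i, forall j, j != i -> D j = D' j) ->
    forall S : set Out, measurable S ->
      (P (M D @^-1` S) <= (expR eps)%:E * P (M D' @^-1` S) + delta%:E)%E.

End probability_notions.

(* Functions on [0, 1] with the sigma-algebra generated by the evaluations at
   the points of [0, 1]. *)
Definition evaluation_sets (R : realType) : set (set (R -> R)) :=
  [set S | exists x : R, exists B : set R,
     [/\ x \in `[0, 1], measurable B & S = [set g | B (g x)]]].

Definition function_space (R : realType) : measurableType _ :=
  g_sigma_algebraType (@evaluation_sets R).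

(* Main.v *)
Require Import Defs.
From HB Require Import structures.
From mathcomp Require Import all_boot all_order all_algebra.
From mathcomp Require Import all_classical all_reals all_analysis.
From mathcomp Require Import measurable_realfun zify ring lra.
Set Implicit Arguments.
Unset Strict Implicit.
Unset Printing Implicit Defensive.
Import Order.TTheory GRing.Theory Num.Theory.
Import numFieldNormedType.Exports.
Local Open Scope classical_set_scope.
Local Open Scope ring_scope.

(** The estimator is the noisy orthogonal projection on the first [K] functions of
   the trigonometric basis, with truncated responses.

   Privacy. Replacing one record moves the vector of empirical coefficients by a
   vector [v] whose squared norm is at most [8 T^2 K / n^2], as a basis function has
   square at most 2 ([sensitivity]). For a Gaussian vector [w] with covariance
   [tau^2 I], the law of [w + v] has density
   [exp (<w, v> / tau^2 - |v|^2 / (2 tau^2))] with respect to that of [w]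
   ([gaussian_translate]). This density is at most [exp eps] except on a half space,
   whose probability under the law of [w + v] is at most
   [exp (- s^2 |v|^2 / (2 tau^2)) / 2] for a suitable level [s] ([gaussian_tail]),
   and the choice of [tau] makes it at most [delta] ([gaussian_mechanism]). The
   released function is a measurable image of the noisy coefficients, so it
   inherits the property ([estimator_private]).

   Risk. The basis is orthonormal, hence the integrated square error is the sum of
   the [K] squared errors of the coefficients and of the squared norm of
   [f_K - f], where [f_K] is the projection of [f] ([inner_risk]).

   - Bias ([sobolev_proj]): each integration by parts divides the coefficients by
     the frequency, so the coefficients of index above [K] carry at most
     [C^2 / K^(2 alpha)], by Bessel's inequality for the derivative of order
     [alpha]. That nothing is left in the limit requires the partial sums of [f]
     to converge to [f]. They do so uniformly, because the residual at [x] is the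
     inner product of [f'] with the residual of the sawtooth function with jump
     at [x], whose norm is a tail of the series of inverse squares
     ([sup_partial_sum]); that this tail vanishes is the Basel identity
     ([sum_inv_sqr]).

   - Variance ([coefficient_risk]): when every error is at most
     [L = 2 sigma sqrt (2 log n)] in absolute value, no response exceeds [T], and a
     coefficient is an average of [n] uncorrelated terms plus the privacy noise,
     with mean square error of order [1 / n + tau^2]. Otherwise the error is at
     most of order [T^2], and this happens with probability at most [2 n^(-3)] by
     the normal tail bound.

   With [K] at most [n^(1 / (2 alpha + 1))] and [(n eps)^(1 / (alpha + 1))], the
   sums [K / n] and [K tau^2] are at most of the order of the terms of the rate, and
   [K^(- 2 alpha)] is at most a multiple of their sum ([total_rate_le]). *)

(** * Square-integrable functions on the unit interval *)

Section L2.
Context {R : realType}.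
Local Notation mu := (@lebesgue_measure R).
Local Notation I01 := (`[0%R, 1%R]%classic : set R).
Implicit Types u v : R -> R.

Lemma mu_I01 : mu I01 = 1%E.
Proof. by rewrite lebesgue_measure_itv/= lte_fin ltr01 sube0. Qed.

Definition L2 u := measurable_fun I01 u /\
  mu.-integrable I01 (EFin \o (fun x => u x ^+ 2)).

Definition ip u v : R := \int[mu]_(x in I01) (u x * v x).

Lemma bounded_integrable01 u (M : R) : measurable_fun I01 u ->
  (forall x, x \in `[0, 1] -> `|u x| <= M) -> mu.-integrable I01 (EFin \o u).
Proof.
move=> mu_ uM; apply: (le_integrable _ (g := EFin \o cst M)) => //.
- exact/measurable_EFinP.
- move=> x Ix; rewrite /= lee_fin; apply: le_trans (ler_norm _); exact: uM.
- apply/integrableP; split; first by apply/measurable_EFinP; exact: measurable_cst.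
  by rewrite (eq_integral (cst (`|M|%:E)%E))// integral_cst//= mu_I01 mule1 ltry.
Qed.

Lemma L2_bounded u (M : R) : measurable_fun I01 u ->
  (forall x, x \in `[0, 1] -> `|u x| <= M) -> L2 u.
Proof.
move=> mu_ uM; split=> //; apply: (@bounded_integrable01 _ (M ^+ 2)).
  exact: measurable_funX.
by move=> x Ix; rewrite normrX lerXn2r ?nnegrE ?uM// (le_trans _ (uM x Ix)).
Qed.

Lemma L2M u v : L2 u -> L2 v -> mu.-integrable I01 (EFin \o (fun x => u x * v x)).
Proof.
move=> [mu_ iu] [mv iv].
apply: (@le_integrable _ _ _ mu I01 _ _ (EFin \o (fun x : R => u x ^+ 2 + v x ^+ 2))) => //.
- by apply/measurable_EFinP; exact: measurable_funM.
- move=> x _; rewrite /= lee_fin [leRHS]ger0_norm ?addr_ge0 ?sqr_ge0//.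
  have := sqr_ge0 (`|u x| - `|v x|); rewrite normrM -(real_normK (num_real (u x))) -(real_normK (num_real (v x))).
  have := normr_ge0 (u x); have := normr_ge0 (v x); nra.
- by apply: eq_integrable (integrableD _ iu iv) => // x _ /=; rewrite EFinD.
Qed.

Lemma L2_integrable u : L2 u -> mu.-integrable I01 (EFin \o u).
Proof.
move=> Lu; have L1 : L2 (fun=> 1).
  by apply: (@L2_bounded _ 1) => // x _; rewrite normr1.
by apply: eq_integrable (L2M Lu L1) => // x _ /=; rewrite mulr1.
Qed.

Lemma L2D u v : L2 u -> L2 v -> L2 (fun x => u x + v x).
Proof.
move=> Lu Lv; split.
  by apply: measurable_funD; [case: Lu|case: Lv].
have := integrableD _ (integrableD _ (proj2 Lu) (proj2 Lv)) (integrableZl _ 2 (L2M Lu Lv)).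
move=> /(_ (measurable_itv _) (measurable_itv _) (measurable_itv _)).
apply: eq_integrable => // x _ /=; rewrite -EFinM -!EFinD; congr EFin; ring.
Qed.

Lemma L2Z (a : R) u : L2 u -> L2 (fun x => a * u x).
Proof.
move=> Lu; split.
  by apply: measurable_funM => //; case: Lu.
have := integrableZl _ (a ^+ 2) (proj2 Lu).
move=> /(_ (measurable_itv _)).
apply: eq_integrable => // x _ /=; rewrite -EFinM; congr EFin; ring.
Qed.

Lemma L2B u v : L2 u -> L2 v -> L2 (fun x => u x - v x).
Proof.
move=> Lu Lv; have -> : (fun x => u x - v x) = (fun x => u x + -1 * v x).
  by apply/funext => x; rewrite mulN1r.
by apply: L2D => //; exact: L2Z.
Qed.

Lemma L2_sum n (f : 'I_n -> R -> R) : (forall i, L2 (f i)) ->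
  L2 (fun x => \sum_(i < n) f i x).
Proof.
elim: n f => [|n IH] f Lf.
  under eq_fun do rewrite big_ord0.
  by apply: (@L2_bounded _ 0) => // x _; rewrite normr0.
under eq_fun do rewrite big_ord_recr/=.
by apply: L2D => //; apply: IH.
Qed.

Lemma ipC u v : ip u v = ip v u.
Proof. by apply: eq_Rintegral => x _; rewrite mulrC. Qed.

Lemma ipDl u v w : L2 u -> L2 v -> L2 w ->
  ip (fun x => u x + v x) w = ip u w + ip v w.
Proof.
move=> Lu Lv Lw; rewrite /ip; under eq_Rintegral do rewrite mulrDl.
by rewrite RintegralD//; exact: L2M.
Qed.

Lemma ipZl (a : R) u w : L2 u -> L2 w -> ip (fun x => a * u x) w = a * ip u w.
Proof.
move=> Lu Lw; rewrite /ip; under eq_Rintegral do rewrite -mulrA.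
by rewrite RintegralZl//; exact: L2M.
Qed.

Lemma ipBl u v w : L2 u -> L2 v -> L2 w ->
  ip (fun x => u x - v x) w = ip u w - ip v w.
Proof.
move=> Lu Lv Lw; rewrite /ip; under eq_Rintegral do rewrite mulrBl.
by rewrite RintegralB//; exact: L2M.
Qed.

Lemma ip_suml n (f : 'I_n -> R -> R) w : (forall i, L2 (f i)) -> L2 w ->
  ip (fun x => \sum_(i < n) f i x) w = \sum_(i < n) ip (f i) w.
Proof.
elim: n f => [|n IH] f Lf Lw.
  rewrite big_ord0 /ip; under eq_Rintegral do rewrite big_ord0 mul0r.
  by rewrite Rintegral_cst// mul0r.
rewrite big_ord_recr/= -IH//.
under [X in ip X]eq_fun do rewrite big_ord_recr/=.
by rewrite ipDl//; exact: L2_sum.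
Qed.

Lemma ip_ge0 u : 0 <= ip u u.
Proof. by apply: Rintegral_ge0 => x _; rewrite -expr2 sqr_ge0. Qed.

Lemma eq_ip u u' v v' : (forall x, x \in `[0, 1] -> u x = u' x) ->
  (forall x, x \in `[0, 1] -> v x = v' x) -> ip u v = ip u' v'.
Proof. by move=> uu vv; apply: eq_Rintegral => x; rewrite inE => xI; rewrite uu// vv. Qed.

Lemma eq_L2 u v : (forall x, x \in `[0, 1] -> u x = v x) -> L2 u -> L2 v.
Proof.
move=> uv [m i]; split.
  by apply: eq_measurable_fun m => x; rewrite inE; exact: uv.
by apply: eq_integrable i => // x; rewrite inE => xI; rewrite /= uv.
Qed.

Lemma ip_CS u v : L2 u -> L2 v -> ip u v ^+ 2 <= ip u u * ip v v.
Proof.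
move=> Lu Lv.
have H s : 0 <= ip u u + 2 * s * ip u v + s ^+ 2 * ip v v.
  have := ip_ge0 (fun x => u x + s * v x).
  have Ls := L2Z s Lv.
  have Lus : L2 (fun x => u x + s * v x) by exact: L2D.
  rewrite ipDl// ipZl// (ipC u) (ipC v) !ipDl// !ipZl// (ipC v u).
  lra.
have v0 := ip_ge0 v.
move: v0; rewrite le_eqVlt => /predU1P[v0|v0].
  rewrite -v0 mulr0; have [->|n0] := eqVneq (ip u v) 0; first by rewrite expr0n.
  have := H (- (ip u u + 1) / (2 * ip u v)); rewrite -v0 mulr0 addr0.
  have -> : 2 * (- (ip u u + 1) / (2 * ip u v)) * ip u v = - (ip u u + 1) by field.
  lra.
have := H (- ip u v / ip v v).
have -> : ip u u + 2 * (- ip u v / ip v v) * ip u v + (- ip u v / ip v v) ^+ 2 * ip v v = 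
  (ip u u * ip v v - ip u v ^+ 2) / ip v v by field; exact: lt0r_neq0.
by rewrite pmulr_lge0 ?invr_gt0// subr_ge0.
Qed.

End L2.

(** * Primitives *)

Section FTC.
Context {R : realType}.
Local Notation mu := (@lebesgue_measure R).

Lemma is_derive_continuous (F f : R -> R) :
  (forall x : R, is_derive x 1 F (f x)) -> continuous F.
Proof.
by move=> dF x; apply/differentiable_continuous/derivable1_diffP; exact: ex_derive.
Qed.

Lemma Rintegral_derive (F f : R -> R) (a b : R) : a <= b ->
  (forall x : R, is_derive x 1 F (f x)) -> continuous f ->
  \int[mu]_(x in `[a, b]) f x = F b - F a.
Proof.
move=> + dF cf; rewrite le_eqVlt => /predU1P[<-|ab].
  by rewrite set_itv1 Rintegral_set1 subrr.
have cF := is_derive_continuous dF.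
rewrite /Rintegral (@continuous_FTC2 _ f F)//=.
- exact: continuous_subspaceT.
- split; first by move=> x _; exact: ex_derive.
    by apply: cvg_at_right_filter; exact: cF.
  by apply: cvg_at_left_filter; exact: cF.
- by move=> x _; rewrite derive1E; exact: derive_val.
Qed.

Lemma within_continuous_L2 (f : R -> R) :
  {within `[0%R, 1%R]%classic, continuous f} -> L2 f.
Proof.
move=> cf; split.
  by apply: subspace_continuous_measurable_fun => //; exact: measurable_itv.
rewrite (_ : (fun x => f x ^+ 2) = fun x => f x * f x); last exact/funext.
apply: continuous_compact_integrable; first exact: segment_compact.
by move=> x; apply: continuousM; exact: cf.
Qed.

Lemma continuous_L2 (f : R -> R) : continuous f -> L2 f.
Proof. by move=> cf; apply: within_continuous_L2; exact: continuous_subspaceT. Qed.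

(** Absolute continuity with derivative [h], in integral form: [h] is only
   determined up to a null set, as a weak derivative is. *)
Definition primitive (g h : R -> R) : Prop :=
  forall x, x \in `[0, 1] -> g x = g 0 + \int[mu]_(t in `[0, x]) h t.

Lemma primitive_L2 (g h : R -> R) : L2 h -> primitive g h -> L2 g.
Proof.
move=> Lh gh; apply: (@eq_L2 _ (fun x => g 0 + \int[mu]_(t in `[0, x]) h t)).
  by move=> x /gh ->.
apply: L2D; first by apply: continuous_L2; exact: cst_continuous.
apply: within_continuous_L2.
exact: (parameterized_integral_continuous ler01 (L2_integrable Lh)).
Qed.

Lemma derive_primitive (F f : R -> R) : (forall x : R, is_derive x 1 F (f x)) ->
  continuous f -> primitive F f.
Proof.
move=> dF cf x; rewrite in_itv/= => /andP[x0 _].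
by rewrite (Rintegral_derive x0 dF cf) addrC subrK.
Qed.

End FTC.

(** * Integration by parts *)

Section IBP.
Context {R : realType}.
Local Notation mu := (@lebesgue_measure R).
Local Notation I01 := (`[0%R, 1%R]%classic : set R).

Lemma integrable_prod (p q : R -> R) :
  mu.-integrable setT (EFin \o p) -> mu.-integrable setT (EFin \o q) ->
  (mu \x mu)%E.-integrable setT (fun z : R * R => (p z.1 * q z.2)%:E).
Proof.
move=> ip_ iq.
have mp : measurable_fun setT p by apply/measurable_EFinP; exact: measurable_int ip_.
have mq : measurable_fun setT q by apply/measurable_EFinP; exact: measurable_int iq.
apply/integrable12ltyP.
  apply/measurable_EFinP; apply: measurable_funM.
    by apply: (measurableT_comp mp); exact: measurable_fst.
  by apply: (measurableT_comp mq); exact: measurable_snd.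
have np : measurable_fun setT (fun x : R => `|p x|%:E) by do 2 apply: measurableT_comp => //.
have nq : measurable_fun setT (fun x : R => `|q x|%:E) by do 2 apply: measurableT_comp => //.
rewrite (@eq_integral _ _ _ mu setT (fun x : R => `|p x|%:E * \int[mu]_y `|q y|%:E)%E); last first.
  by move=> x _; rewrite -ge0_integralZl//; apply: eq_integral => y _; rewrite /= normrM EFinM.
rewrite ge0_integralZr//; last by apply: integral_ge0 => x _; rewrite lee_fin.
move/integrableP: ip_ => [_ ip_]; move/integrableP: iq => [_ iq].
by rewrite lte_mul_pinfty// ?ge0_fin_numE// ?integral_ge0.
Qed.

(** Fubini for the indicator of the triangle [t <= x] of the unit square. *)
Lemma Rintegral_triangle (p q : R -> R) :
  mu.-integrable I01 (EFin \o p) -> mu.-integrable I01 (EFin \o q) ->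
  \int[mu]_(x in I01) (p x * \int[mu]_(t in `[0, x]) q t) =
  \int[mu]_(t in I01) (q t * \int[mu]_(x in `[t, 1]) p x).
Proof.
move=> ip_ iq; set P := p \_ I01; set Q := q \_ I01.
have iP : mu.-integrable setT (EFin \o P).
  by rewrite -restrict_EFin; apply/integrable_restrict => //; rewrite setTI.
have iQ : mu.-integrable setT (EFin \o Q).
  by rewrite -restrict_EFin; apply/integrable_restrict => //; rewrite setTI.
pose f (z : R * R) := (P z.1 * Q z.2 * (z.2 <= z.1)%R%:R)%:E.
have mf : (mu \x mu)%E.-integrable setT f.
  apply: (le_integrable _ _ _ (integrable_prod iP iQ)) => //.
    apply/measurable_EFinP; apply: measurable_funM.
      by apply/measurable_EFinP; exact: measurable_int (integrable_prod iP iQ).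
    have -> : (fun x : R * R => (x.2 <= x.1)%R%:R) = (fun b : bool => b%:R : R) \o (fun x : R * R => x.2 <= x.1) by [].
    apply: measurableT_comp => //.
    by apply: measurable_fun_ler; [exact: measurable_snd|exact: measurable_fst].
  move=> [x t] _ /=; rewrite lee_fin normrM.
  by case: (t <= x); rewrite ?normr1 ?mulr1 ?normr0 ?mulr0.
have := Fubini mf; rewrite /fubini_F /fubini_G /f /=.
have E1 x : (\int[mu]_y (P x * Q y * (y <= x)%R%:R)%:E =
   (P x * \int[mu]_(t in `[0%R, x]) q t)%:E)%E.
  rewrite /P patchE; case: ifPn => [|_]; last first.
    by rewrite mul0r integral0_eq// => y _; rewrite !mul0r.
  rewrite inE/= in_itv/= => /andP[x0 x1].
  have iqx : mu.-integrable `[0, x] (EFin \o q).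
    by apply: integrableS iq => //; exact: subset_itvl.
  rewrite EFinM /Rintegral fineK; last exact: integrable_fin_num.
  rewrite -integralZl// [RHS]integral_mkcond; apply: eq_integral => y _.
  rewrite /Q !patchE !mem_setE !in_itv/=.
  have [y0|y0]/= := leP 0 y; last by rewrite mulr0 mul0r.
  have [yx|yx]/= := leP y x; last by rewrite mulr0.
  by rewrite (le_trans yx)// mulr1 EFinM.
have E2 y : (\int[mu]_x (P x * Q y * (y <= x)%R%:R)%:E =
   (Q y * \int[mu]_(t in `[y, 1%R]) p t)%:E)%E.
  rewrite /Q patchE; case: ifPn => [|_]; last first.
    by rewrite mul0r integral0_eq// => x _; rewrite mulr0 mul0r.
  rewrite inE/= in_itv/= => /andP[x0 x1].
  have iqx : mu.-integrable `[y, 1] (EFin \o p).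
    by apply: integrableS ip_ => //; exact: subset_itvr.
  rewrite EFinM /Rintegral fineK; last exact: integrable_fin_num.
  rewrite -integralZl// [RHS]integral_mkcond; apply: eq_integral => x _.
  rewrite /P !patchE !mem_setE !in_itv/=.
  have [yx|yx]/= := leP y x; last by rewrite mulr0.
  rewrite (le_trans x0 yx)/=.
  by case: ifPn => _; rewrite ?mul0r// mulr1 mulrC EFinM.
under eq_integral do rewrite E1.
under [X in _ = X -> _]eq_integral do rewrite E2.
move=> H.
have patch_mul (a b : R -> R) y : (EFin \o (fun x => a x * b x)) \_ I01 y = ((a \_ I01) y * b y)%:E.
  by rewrite !patchE; case: ifPn => //; rewrite mul0r.
rewrite [LHS]/Rintegral [RHS]/Rintegral integral_mkcond [in RHS]integral_mkcond.
by congr fine; apply: (etrans _ (etrans H _)); apply: eq_integral => y _; rewrite patch_mul.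
Qed.

(** The primitive [g] need not be differentiable at any given point. Writing it as
   an integral of [h] turns the formula into an exchange of integrals over a
   triangle. *)
Lemma ip_primitive_derive (g h psi dpsi : R -> R) : L2 h -> primitive g h ->
  (forall x : R, is_derive x 1 psi (dpsi x)) -> continuous dpsi ->
  ip g dpsi = g 1 * psi 1 - g 0 * psi 0 - ip h psi.
Proof.
move=> Lh gh dpsiP cdpsi.
have Lpsi := continuous_L2 (is_derive_continuous dpsiP).
have Ldpsi := continuous_L2 cdpsi.
have g1 : \int[mu]_(t in I01) h t = g 1 - g 0.
  by rewrite [g 1]gh ?in_itv/= ?lexx ?ler01// [RHS]addrC addKr.
pose G x := \int[mu]_(t in `[0, x]) h t.
have LG : L2 G.
  by apply: (primitive_L2 Lh) => x _; rewrite {2}/G set_itv1 Rintegral_set1 add0r.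
rewrite (@eq_ip _ g (fun x => g 0 + G x) _ dpsi)//.
rewrite ipDl//; last by apply: continuous_L2; exact: cst_continuous.
have -> : ip (fun=> g 0) dpsi = g 0 * (psi 1 - psi 0).
  by rewrite /ip RintegralZl//; [rewrite (Rintegral_derive ler01 dpsiP)|exact: L2_integrable].
rewrite ipC /ip Rintegral_triangle; [|exact: L2_integrable..].
rewrite (@eq_Rintegral _ _ _ mu I01 (fun x => psi 1 * h x - h x * psi x)); last first.
  move=> x; rewrite inE/= in_itv/= => /andP[x0 x1]; rewrite (Rintegral_derive x1 dpsiP)//; ring.
rewrite RintegralB//; [|exact: (L2_integrable (L2Z (psi 1) Lh))|exact: L2M].
by rewrite RintegralZl//; [rewrite g1; ring|exact: L2_integrable].
Qed.
End IBP.

(** * The trigonometric basis *)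

Section trig_basis.
Context {R : realType}.
Local Notation mu := (@lebesgue_measure R).
Local Notation I01 := (`[0%R, 1%R]%classic : set R).

Definition freq (k : nat) : R := 2 * pi * k%:R.
Definition cs (k : nat) (t : R) : R := Num.sqrt 2 * cos (freq k * t).
Definition sn (k : nat) (t : R) : R := Num.sqrt 2 * sin (freq k * t).

Lemma trig1 : trig 1 = (fun=> 1 : R).
Proof. by []. Qed.

Lemma trig_even k : (0 < k)%N -> trig k.*2 = cs k.
Proof.
by case: k => // k _; apply/funext => t; rewrite /trig doubleS/= odd_double/= doubleK.
Qed.

Lemma trig_odd k : (0 < k)%N -> trig k.*2.+1 = sn k.
Proof.
by case: k => // k _; apply/funext => t; rewrite /trig doubleS/= odd_double/= uphalf_double.
Qed.

Lemma trig_cases j : (0 < j)%N ->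
  [\/ j = 1%N, exists2 k, (0 < k)%N & j = k.*2 | exists2 k, (0 < k)%N & j = k.*2.+1].
Proof.
move=> j0; have := odd_double_half j; have [oj|oj]/= := boolP (odd j).
  rewrite add1n; case: (posnP j./2) => [->|k0] <-; first by constructor 1.
  by constructor 3; exists j./2.
rewrite add0n => <-; constructor 2; exists j./2 => //.
by case: j j0 oj => [|[|]].
Qed.

Lemma freq_gt0 k : (0 < k)%N -> 0 < freq k.
Proof. by move=> k0; rewrite !mulr_gt0 ?pi_gt0 ?ltr0n. Qed.

Lemma freq_neq0 k : (0 < k)%N -> freq k != 0.
Proof. by move=> /freq_gt0 /lt0r_neq0. Qed.

Lemma is_derive_cs k (t : R) : is_derive t 1 (cs k) (- freq k * sn k t).
Proof.
rewrite /cs; apply: is_derive_eq; rewrite /sn /GRing.scale/=; ring.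
Qed.

Lemma is_derive_sn k (t : R) : is_derive t 1 (sn k) (freq k * cs k t).
Proof.
rewrite /sn; apply: is_derive_eq; rewrite /cs /GRing.scale/=; ring.
Qed.

Lemma is_derive_sn_div k (t : R) : (0 < k)%N ->
  is_derive t 1 (fun t => (freq k)^-1 * sn k t) (cs k t).
Proof.
move=> /freq_neq0 fk; have := @is_deriveZ _ _ _ _ (freq k)^-1 _ _ _ (is_derive_sn k t).
by rewrite /GRing.scale/= mulKf.
Qed.

Lemma is_derive_cs_div k (t : R) : (0 < k)%N ->
  is_derive t 1 (fun t => - (freq k)^-1 * cs k t) (sn k t).
Proof.
move=> /freq_neq0 fk; have := @is_deriveZ _ _ _ _ (- (freq k)^-1) _ _ _ (is_derive_cs k t).
by rewrite /GRing.scale/= mulrA mulrNN mulVf// mul1r.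
Qed.

Lemma continuous_cs k : continuous (cs k).
Proof. exact: is_derive_continuous (is_derive_cs k). Qed.

Lemma continuous_sn k : continuous (sn k).
Proof. exact: is_derive_continuous (is_derive_sn k). Qed.

Lemma continuous_trig j : continuous (@trig R j).
Proof.
case: (posnP j) => [->|j0].
  rewrite (_ : trig 0 = cst 1)//; exact: cst_continuous.
case: (trig_cases j0) => [->|[k k0 ->]|[k k0 ->]].
- rewrite trig1; exact: cst_continuous.
- rewrite trig_even//; exact: continuous_cs.
- rewrite trig_odd//; exact: continuous_sn.
Qed.

Lemma L2_trig j : L2 (@trig R j).
Proof. by apply: continuous_L2; exact: continuous_trig. Qed.

Lemma sincos_freq k : (sin (freq k) = 0) * (cos (freq k) = 1).
Proof.
elim: k => [|k [IHs IHc]]; first by rewrite /freq mulr0 sin0 cos0.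
have -> : freq k.+1 = freq k + pi *+ 2.
  rewrite /freq -natr1 mulr2n; ring.
by rewrite sinD cosD IHs IHc sin2pi cos2pi !mul0r mul1r addr0 mulr1 subr0.
Qed.

Lemma sn0 k : sn k 0 = 0. Proof. by rewrite /sn mulr0 sin0 mulr0. Qed.
Lemma sn1 k : sn k 1 = 0. Proof. by rewrite /sn mulr1 sincos_freq mulr0. Qed.
Lemma cs0 k : cs k 0 = Num.sqrt 2. Proof. by rewrite /cs mulr0 cos0 mulr1. Qed.
Lemma cs1 k : cs k 1 = Num.sqrt 2. Proof. by rewrite /cs mulr1 sincos_freq mulr1. Qed.

Lemma cs2Dsn2 k t : cs k t ^+ 2 + sn k t ^+ 2 = 2.
Proof. by rewrite /cs /sn !exprMn sqr_sqrtr// -mulrDr cos2Dsin2 mulr1. Qed.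

Lemma trig_sqr_le2 j (t : R) : trig j t ^+ 2 <= 2.
Proof.
case: (posnP j) => [->|j0]; first by rewrite /trig/= expr1n; lra.
case: (trig_cases j0) => [->|[k k0 ->]|[k k0 ->]].
- by rewrite trig1 expr1n; lra.
- by rewrite trig_even// -(cs2Dsn2 k t) lerDl sqr_ge0.
- by rewrite trig_odd// -(cs2Dsn2 k t) lerDr sqr_ge0.
Qed.

Section coef_primitive.
Variables g h : R -> R.
Hypotheses (Lh : L2 h) (gh : primitive g h) (g01 : g 0 = g 1).

Lemma ip_primitive_cs k : (0 < k)%N -> ip g (cs k) = - (ip h (sn k) / freq k).
Proof.
move=> k0; have fk := freq_neq0 k0.
have Lsn := continuous_L2 (@continuous_sn k).
rewrite (ip_primitive_derive Lh gh (fun t => is_derive_sn_div t k0) (@continuous_cs k)).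
by rewrite sn0 sn1 !mulr0 subrr sub0r ipC ipZl// ipC; congr (- _); exact: mulrC.
Qed.

Lemma ip_primitive_sn k : (0 < k)%N -> ip g (sn k) = ip h (cs k) / freq k.
Proof.
move=> k0; have fk := freq_neq0 k0.
have Lcs := continuous_L2 (@continuous_cs k).
rewrite (ip_primitive_derive Lh gh (fun t => is_derive_cs_div t k0) (@continuous_sn k)).
by rewrite cs0 cs1 g01 subrr sub0r ipC ipZl// ipC; lra.
Qed.

End coef_primitive.

Let Lcs k := continuous_L2 (@continuous_cs k).
Let Lsn k := continuous_L2 (@continuous_sn k).
Let L1 : @L2 R (fun=> 1) := L2_trig 1.
Let cont_dcs k : continuous (fun t => - freq k * sn k t).
Proof. by move=> t; apply: cvgM; [exact: cvg_cst|exact: continuous_sn]. Qed.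
Let cont_dsn k : continuous (fun t => freq k * cs k t).
Proof. by move=> t; apply: cvgM; [exact: cvg_cst|exact: continuous_cs]. Qed.
Let prim_cs k : primitive (cs k) (fun t => - freq k * sn k t).
Proof. by apply: derive_primitive; [exact: is_derive_cs|exact: cont_dcs]. Qed.
Let prim_sn k : primitive (sn k) (fun t => freq k * cs k t).
Proof. by apply: derive_primitive; [exact: is_derive_sn|exact: cont_dsn]. Qed.

Let cc k l : (0 < l)%N -> ip (cs k) (cs l) = freq k / freq l * ip (sn k) (sn l).
Proof.
move=> l0; rewrite (ip_primitive_cs _ (prim_cs k))//; last exact: continuous_L2.
by rewrite ipZl//; lra.
Qed.
Let ss k l : (0 < l)%N -> ip (sn k) (sn l) = freq k / freq l * ip (cs k) (cs l).
Proof.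
move=> l0; rewrite (ip_primitive_sn _ (prim_sn k))//; last 2 first.
  exact: continuous_L2.
  by rewrite sn0 sn1.
by rewrite ipZl//; lra.
Qed.
Let csn k l : (0 < l)%N -> ip (cs k) (sn l) = - (freq k / freq l) * ip (sn k) (cs l).
Proof.
move=> l0; rewrite (ip_primitive_sn _ (prim_cs k))//; last 2 first.
  exact: continuous_L2.
  by rewrite cs0 cs1.
by rewrite ipZl//; lra.
Qed.

Let freq_inj k l : (0 < k)%N -> (0 < l)%N -> (freq k / freq l) ^+ 2 = 1 -> k = l.
Proof.
move=> k0 l0 /eqP; rewrite sqrf_eq1 => /orP[] /eqP E.
  have : freq k = freq l by rewrite -[LHS](divfK (freq_neq0 l0)) E mul1r.
  move=> /mulfI H; apply/eqP; rewrite -(eqr_nat R); apply/eqP/H.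
  by rewrite mulf_neq0// lt0r_neq0// pi_gt0.
have : 0 < freq k / freq l by rewrite divr_gt0// freq_gt0.
by rewrite E ltrNr oppr0 ltr10.
Qed.

(** No product of cosines is integrated. Two integrations by parts multiply the
   inner product by the square of the quotient of the frequencies, so it vanishes
   when they differ. When they agree, one integration by parts shows that sine and
   cosine have the same norm, and their squares add up to 2. *)
Lemma ip_cs_cs k l : (0 < k)%N -> (0 < l)%N -> ip (cs k) (cs l) = (k == l)%:R.
Proof.
move=> k0 l0; have [<-|kl] := eqVneq k l.
  have E : ip (cs k) (cs k) = ip (sn k) (sn k) by rewrite cc// divff ?mul1r// freq_neq0.
  have : ip (cs k) (cs k) + ip (sn k) (sn k) = 2.
    rewrite /ip -RintegralD//; [|exact: L2M..].
    under eq_Rintegral do rewrite -!expr2 cs2Dsn2.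
    by rewrite Rintegral_cst//= mu_I01/= mulr1.
  rewrite -E /=; lra.
have := cc k l0; rewrite ss// mulrA -expr2 => /eqP.
rewrite -subr_eq0 -{1}[ip _ _]mul1r -mulrBl mulf_eq0 subr_eq0 => /orP[/eqP/esym/freq_inj E|/eqP->//].
by rewrite E// eqxx in kl.
Qed.

Lemma ip_sn_sn k l : (0 < k)%N -> (0 < l)%N -> ip (sn k) (sn l) = (k == l)%:R.
Proof.
move=> k0 l0; rewrite ss// ip_cs_cs//; have [->|_] := eqVneq k l; last by rewrite mulr0.
by rewrite divff ?mulr1// freq_neq0.
Qed.

Lemma ip_cs_sn k l : (0 < k)%N -> (0 < l)%N -> ip (cs k) (sn l) = 0.
Proof.
move=> k0 l0.
have E : ip (sn k) (cs l) = - (freq k / freq l) * ip (cs k) (sn l).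
  rewrite (ip_primitive_cs _ (prim_sn k))//; last exact: continuous_L2.
  by rewrite ipZl//; lra.
have [kl|kl] := eqVneq k l.
  by move: E; rewrite (ipC (sn k)) kl divff ?freq_neq0//; lra.
have := csn k l0; rewrite E mulrA mulrNN -expr2 => /eqP.
rewrite -subr_eq0 -{1}[ip _ _]mul1r -mulrBl mulf_eq0 subr_eq0 => /orP[/eqP/esym/freq_inj F|/eqP->//].
by rewrite F// eqxx in kl.
Qed.

Lemma ip_1_cs l : (0 < l)%N -> ip (fun=> 1) (cs l) = 0.
Proof.
move=> l0; have L0 : @L2 R (fun=> 0) by apply: continuous_L2; exact: cst_continuous.
rewrite (ip_primitive_cs L0)//; last first.
  by move=> x _; rewrite Rintegral_cst// mul0r addr0.
by rewrite /ip; under eq_Rintegral do rewrite mul0r; rewrite Rintegral_cst// !mul0r oppr0.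
Qed.

Lemma ip_1_sn l : (0 < l)%N -> ip (fun=> 1) (sn l) = 0.
Proof.
move=> l0; have L0 : @L2 R (fun=> 0) by apply: continuous_L2; exact: cst_continuous.
rewrite (ip_primitive_sn L0)//; last first.
  by move=> x _; rewrite Rintegral_cst// mul0r addr0.
by rewrite /ip; under eq_Rintegral do rewrite mul0r; rewrite Rintegral_cst// !mul0r.
Qed.

Lemma ip_1_1 : @ip R (fun=> 1) (fun=> 1) = 1.
Proof.
by rewrite /ip; under eq_Rintegral do rewrite mulr1; rewrite Rintegral_cst//= mu_I01/= mulr1.
Qed.

Lemma ip_trig i j : (0 < i)%N -> (0 < j)%N ->
  ip (@trig R i) (trig j) = (i == j)%:R.
Proof.
move=> i0 j0.
case: (trig_cases i0) => [->|[k k0 ->]|[k k0 ->]];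
case: (trig_cases j0) => [->|[l l0 ->]|[l l0 ->]];
  rewrite ?trig1 ?trig_even ?trig_odd//.
- by rewrite ip_1_1.
- by rewrite ip_1_cs//; case: l l0.
- by rewrite ip_1_sn//; case: l l0.
- by rewrite ipC ip_1_cs//; case: k k0.
- by rewrite ip_cs_cs// (inj_eq double_inj).
- rewrite ip_cs_sn//; case: eqP => // /(congr1 odd); by rewrite /= !odd_double.
- by rewrite ipC ip_1_sn//; case: k k0.
- rewrite ipC ip_cs_sn//; case: eqP => // /(congr1 odd); by rewrite /= !odd_double.
- by rewrite ip_sn_sn// eqSS (inj_eq double_inj).
Qed.

End trig_basis.

(** * Projection on trigonometric sums *)

Section projection.
Context {R : realType}.
Local Notation mu := (@lebesgue_measure R).
Local Notation I01 := (`[0%R, 1%R]%classic : set R).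
Implicit Types u v : R -> R.

Lemma ip_sqrD u v : L2 u -> L2 v ->
  ip (fun x => u x + v x) (fun x => u x + v x) = ip u u + 2 * ip v u + ip v v.
Proof.
move=> Lu Lv; have Luv := L2D Lu Lv.
by rewrite ipDl// (ipC u) (ipC v (fun x => u x + _)) !ipDl// (ipC u v); ring.
Qed.

Definition coef u j : R := ip u (trig j).

Definition trig_sum (K : nat) (a : 'I_K -> R) (x : R) : R :=
  \sum_(j < K) a j * trig j.+1 x.

Definition trig_proj (K : nat) u : R -> R := trig_sum (fun j : 'I_K => coef u j.+1).

Lemma L2_trig_sum K (a : 'I_K -> R) : L2 (trig_sum a).
Proof. by apply: L2_sum => j; apply: L2Z; exact: L2_trig. Qed.

Lemma ip_trig_sum K (a : 'I_K -> R) v : L2 v ->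
  ip (trig_sum a) v = \sum_(j < K) a j * coef v j.+1.
Proof.
move=> Lv; rewrite ip_suml//; last by move=> j; apply: L2Z; exact: L2_trig.
by apply: eq_bigr => j _; rewrite ipZl//; [rewrite (ipC (trig _))|exact: L2_trig].
Qed.

Lemma coef_trig_sum K (a : 'I_K -> R) (j : 'I_K) : coef (trig_sum a) j.+1 = a j.
Proof.
rewrite /coef ip_trig_sum; last exact: L2_trig.
rewrite (bigD1 j)//= {1}/coef ip_trig// eqxx mulr1 big1 ?addr0// => i ij.
by rewrite /coef ip_trig// eqSS eq_sym -(inj_eq val_inj) in ij *; rewrite (negbTE ij) mulr0.
Qed.

(** Pythagoras: the errors on the coefficients lie in the span of the basis
   functions, to which the residual of [u] is orthogonal. This splits the risk into
   variance and bias. *)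
Lemma ip_trig_sumB K (a : 'I_K -> R) u : L2 u ->
  ip (fun x => trig_sum a x - u x) (fun x => trig_sum a x - u x) =
  \sum_(j < K) (a j - coef u j.+1) ^+ 2 + (ip u u - \sum_(j < K) coef u j.+1 ^+ 2).
Proof.
move=> Lu; have La := L2_trig_sum a.
rewrite ipBl//; last exact: L2B.
rewrite (ipC (trig_sum a)) (ipC u) !ipBl// (ipC u (trig_sum a)) !ip_trig_sum//.
under eq_bigr do rewrite coef_trig_sum.
set s1 := \sum_(_ < _) _; set s2 := \sum_(_ < _) _; set s3 := \sum_(_ < _) _; set s4 := \sum_(_ < _) _.
have -> : s3 = s1 - 2 * s2 + s4.
  rewrite /s1 /s2 /s3 /s4 mulr_sumr -sumrB -big_split/=; apply: eq_bigr => j _; ring.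
ring.
Qed.

Lemma ip_proj_resid K u : L2 u ->
  ip (fun x => trig_proj K u x - u x) (fun x => trig_proj K u x - u x) =
  ip u u - \sum_(j < K) coef u j.+1 ^+ 2.
Proof.
by move=> Lu; rewrite ip_trig_sumB// big1 ?add0r// => j _; rewrite subrr expr0n.
Qed.

Lemma Bessel K u : L2 u -> \sum_(j < K) coef u j.+1 ^+ 2 <= ip u u.
Proof. by move=> Lu; rewrite -subr_ge0 -ip_proj_resid// ip_ge0. Qed.

Lemma sum_trig_pairs (N : nat) (F : nat -> R) :
  \sum_(j < N.*2.+1) F j.+1 = F 1%N + \sum_(k < N) (F k.+1.*2 + F k.+1.*2.+1).
Proof.
elim: N => [|N IH]; first by rewrite big_ord_recl !big_ord0.
rewrite doubleS big_ord_recr big_ord_recr/= IH [in RHS]big_ord_recr/= doubleS; ring.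
Qed.

End projection.

(** * Uniform convergence of the partial sums *)

Section kernel.
Context {R : realType}.
Local Notation mu := (@lebesgue_measure R).
Local Notation I01 := (`[0%R, 1%R]%classic : set R).
Implicit Types (g h : R -> R) (x t : R).

(** The sawtooth function, that is, the first Bernoulli polynomial made periodic
   and translated to jump at [x]: the Green function of the derivative on periodic
   functions of mean zero. *)
Definition saw x t : R := t - x - 2^-1 + (t <= x)%R%:R.

Lemma L2_step x : L2 (fun t => (t <= x)%R%:R : R).
Proof.
apply: (@L2_bounded _ _ 1); last by move=> t _; case: (t <= x); rewrite ?normr1 ?normr0.
apply: measurable_funTS.
rewrite (_ : (fun _ => _) = (fun b : bool => b%:R : R) \o (fun t => t <= x))//.
by apply: measurableT_comp => //; exact: measurable_fun_ler.
Qed.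

Lemma ip_step x h : x \in `[0, 1] ->
  ip (fun t => (t <= x)%R%:R) h = \int[mu]_(t in `[0, x]) h t.
Proof.
rewrite in_itv/= => /andP[x0 x1]; rewrite /ip Rintegral_mkcond [RHS]Rintegral_mkcond.
apply: eq_Rintegral => t _; rewrite !patchE !mem_setE !in_itv/=.
have [tx|tx]/= := leP t x; last by rewrite andbF; case: ifP => // _; rewrite mul0r.
by rewrite (le_trans tx x1) mul1r.
Qed.

Let lin x t : R := t - (x + 2^-1).

Let is_derive_lin x t : is_derive t 1 (lin x) 1.
Proof. by rewrite /lin; apply: is_derive_eq; rewrite subr0. Qed.

Let cont_lin x : continuous (lin x).
Proof. exact: is_derive_continuous (is_derive_lin x). Qed.

Lemma sawE x : saw x = fun t => lin x t + (t <= x)%R%:R.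
Proof. by apply/funext => t; rewrite /saw /lin; ring. Qed.

Lemma L2_saw x : L2 (saw x).
Proof. by rewrite sawE; apply: L2D; [exact: continuous_L2|exact: L2_step]. Qed.

(** The derivative of [saw x] is 1 minus a unit mass at [x], and [saw x] takes the
   same value at 0 and 1. *)
Lemma ip_saw g h x : L2 h -> primitive g h -> g 0 = g 1 -> x \in `[0, 1] ->
  ip (saw x) h = g x - coef g 1.
Proof.
move=> Lh gh g01 xI.
rewrite sawE ipDl//; [|exact: continuous_L2|exact: L2_step].
rewrite ip_step// [g x]gh// /coef trig1 (ip_primitive_derive Lh gh (is_derive_lin x)); last exact: cst_continuous.
by rewrite ipC -g01 /lin; lra.
Qed.

Lemma ip_saw_saw x : x \in `[0, 1] -> ip (saw x) (saw x) = 12^-1.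
Proof.
move=> xI; have Ll := continuous_L2 (@cont_lin x).
have Ls := L2_step x.
have xI' := xI; move: xI'; rewrite in_itv/= => /andP[x0 x1].
have -> : ip (saw x) (saw x) = ip (lin x) (lin x) +
    2 * ip (fun t => (t <= x)%R%:R) (lin x) + ip (fun t => (t <= x)%R%:R) (fun t => (t <= x)%R%:R).
  by rewrite sawE (ip_sqrD Ll Ls).
rewrite !ip_step//.
have -> : \int[mu]_(t in `[0, x]) (t <= x)%R%:R = x.
  rewrite (@eq_Rintegral _ _ _ mu _ (fun=> 1)); last by move=> t; rewrite inE/= in_itv/= => /andP[_ ->].
  by rewrite Rintegral_cst//= lebesgue_measure_itv/= lte_fin; case: ltP => [_|]; rewrite ?mul1r ?subr0//=; lra.
have d2 t : is_derive t 1 (fun t => 2^-1 * lin x t ^+ 2) (lin x t).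
  by apply: is_derive_eq; rewrite /GRing.scale/= /lin; field.
have d3 t : is_derive t 1 (fun t => 3^-1 * lin x t ^+ 3) (lin x t * lin x t).
  by apply: is_derive_eq; rewrite /GRing.scale/= /lin; field.
rewrite (Rintegral_derive x0 d2)//.
rewrite /ip (Rintegral_derive ler01 d3)//; last first.
  by move=> t; apply: cvgM; exact: cont_lin.
by rewrite /lin; field.
Qed.

Lemma coef_saw1 x : x \in `[0, 1] -> coef (saw x) 1 = 0.
Proof.
move=> xI; have xI' := xI; move: xI'; rewrite in_itv/= => /andP[x0 x1].
rewrite /coef trig1 sawE ipDl//; [|exact: continuous_L2|exact: L2_step|exact: L2_trig 1].
rewrite ip_step// Rintegral_cst//= lebesgue_measure_itv/= lte_fin.
have d2 t : is_derive t 1 (fun t => 2^-1 * lin x t ^+ 2) (lin x t * 1).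
  by apply: is_derive_eq; rewrite /GRing.scale/= /lin; field.
rewrite /ip (Rintegral_derive ler01 d2)//; last first.
  by move=> t; apply: cvgM; [exact: cont_lin|exact: cvg_cst].
by rewrite /lin; case: ltP => [_|]/=; [field|move=> x0'; have -> : x = 0 by lra]; field.
Qed.

(** The cosine is a derivative of a multiple of the sine of the same frequency, whose
   value at [x] the kernel reproduces. *)
Lemma coef_saw_cs x k : x \in `[0, 1] -> (0 < k)%N ->
  coef (saw x) k.*2 = sn k x / freq k.
Proof.
move=> xI k0; rewrite /coef trig_even//.
have D t := is_derive_sn_div t k0.
have Lsn := continuous_L2 (@continuous_sn R k).
rewrite (@ip_saw (fun t => (freq k)^-1 * sn k t))//.
- by rewrite /coef trig1 ipZl//; [rewrite ipC ip_1_sn// mulr0 subr0 mulrC|exact: L2_trig 1].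
- by apply: continuous_L2; exact: continuous_cs.
- by apply: derive_primitive => //; exact: continuous_cs.
- by rewrite sn0 sn1.
Qed.

Lemma coef_saw_sn x k : x \in `[0, 1] -> (0 < k)%N ->
  coef (saw x) k.*2.+1 = - (cs k x / freq k).
Proof.
move=> xI k0; rewrite /coef trig_odd//.
have D t := is_derive_cs_div t k0.
have Lcs := continuous_L2 (@continuous_cs R k).
rewrite (@ip_saw (fun t => - (freq k)^-1 * cs k t))//.
- by rewrite /coef trig1 ipZl//; [rewrite ipC ip_1_cs// mulr0 subr0 mulNr mulrC|exact: L2_trig 1].
- by apply: continuous_L2; exact: continuous_sn.
- by apply: derive_primitive => //; exact: continuous_sn.
- by rewrite cs0 cs1.
Qed.

Section partial_sums.
Variables g h : R -> R.
Hypotheses (Lh : L2 h) (gh : primitive g h) (g01 : g 0 = g 1).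

Lemma coef_primitive_even k : (0 < k)%N -> coef g k.*2 = - (coef h k.*2.+1 / freq k).
Proof. by move=> k0; rewrite /coef trig_even// trig_odd// (ip_primitive_cs Lh gh). Qed.

Lemma coef_primitive_odd k : (0 < k)%N -> coef g k.*2.+1 = coef h k.*2 / freq k.
Proof. by move=> k0; rewrite /coef trig_even// trig_odd// (ip_primitive_sn Lh gh g01). Qed.

(** The residual at [x] of the partial sum of [g] is the inner product of [h] with
   the residual of the partial sum of the kernel. By Cauchy-Schwarz it is enough to
   compute the norm of the latter, which is the same for all [x] as the squares of
   the sine and the cosine of a frequency add up to 2. *)
Lemma sup_partial_sum N x : x \in `[0, 1] ->
  (trig_proj N.*2.+1 g x - g x) ^+ 2 <=
  (12^-1 - \sum_(k < N) 2 / freq k.+1 ^+ 2) * ip h h.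
Proof.
move=> xI; have Ls := L2_saw x.
have resid : ip (fun t => trig_proj N.*2.+1 (saw x) t - saw x t) h = trig_proj N.*2.+1 g x - g x.
  rewrite ipBl//; last exact: L2_trig_sum.
  rewrite (ip_saw Lh gh g01 xI) /trig_proj ip_trig_sum// /trig_sum.
  rewrite (sum_trig_pairs N (fun j => coef (saw x) j * coef h j)).
  rewrite (sum_trig_pairs N (fun j => coef g j * trig j x)) coef_saw1// mul0r trig1 mulr1 add0r.
  rewrite (_ : \sum_(k < N) _ = \sum_(k < N)
    (coef g k.+1.*2 * trig k.+1.*2 x + coef g k.+1.*2.+1 * trig k.+1.*2.+1 x)); first by lra.
  apply: eq_bigr => k _.
  rewrite coef_saw_cs// coef_saw_sn// coef_primitive_even// coef_primitive_odd// trig_even// trig_odd//; ring.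
rewrite -resid; apply: le_trans (ip_CS _ Lh) _; first by apply: L2B => //; exact: L2_trig_sum.
apply: ler_wpM2r; first exact: ip_ge0.
rewrite ip_proj_resid// ip_saw_saw// lerD2l lerN2.
rewrite (sum_trig_pairs N (fun j => coef (saw x) j ^+ 2)) coef_saw1// expr0n/= add0r.
apply: ler_sum => k _; rewrite coef_saw_cs// coef_saw_sn// -(cs2Dsn2 k.+1 x).
have := @freq_neq0 R k.+1 (ltn0Sn _) => fk.
rewrite le_eqVlt; apply/orP; left; apply/eqP; field; exact: fk.
Qed.

End partial_sums.
End kernel.

(** * The Basel sum *)

(** Matsuoka's proof. Integration by parts relates the integrals of [cos x ^ 2n] and
   of [x ^ 2 * cos x ^ 2n] over a quarter of a period. By these relations the
   quotient of the second by the first decreases, as [n] grows by one, by half of an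
   inverse square, and [x * cos x <= sin x] bounds what is left after [n] steps. *)

Section basel.
Context {R : realType}.
Local Notation mu := (@lebesgue_measure R).

Let cosint (n : nat) : R := \int[mu]_(x in `[0, pi / 2]) cos x ^+ n.*2.
Let cosint2 (n : nat) : R := \int[mu]_(x in `[0, pi / 2]) (x ^+ 2 * cos x ^+ n.*2).

Let pi2_ge0 : 0 <= pi / 2 :> R.
Proof. by rewrite divr_ge0// pi_ge0. Qed.

Let cont_cosX n : continuous (fun x : R => cos x ^+ n).
Proof.
by move=> x; apply: (@continuous_comp _ _ _ cos (fun y : R => y ^+ n)); [exact: continuous_cos|exact: exprn_continuous].
Qed.

Let cont_x2cosX n : continuous (fun x : R => x ^+ 2 * cos x ^+ n).
Proof. by move=> x; apply: cvgM; [exact: exprn_continuous|exact: cont_cosX]. Qed.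

Let int_cont (f : R -> R) : continuous f -> mu.-integrable `[0, pi / 2] (EFin \o f).
Proof.
move=> cf; apply: continuous_compact_integrable; first exact: segment_compact.
exact: continuous_subspaceT.
Qed.

Let is_derive_cosX n (x : R) :
  is_derive x 1 (fun x => cos x ^+ n) (n%:R * cos x ^+ n.-1 * - sin x).
Proof.
rewrite (_ : (fun x => cos x ^+ n) = cos ^+ n); last by rewrite exprfctE.
exact: is_deriveX.
Qed.

Lemma cosint_rec n : n.+1.*2%:R * cosint n.+1 = n.*2.+1%:R * cosint n.
Proof.
have D (x : R) : is_derive x 1 (sin * (fun x => cos x ^+ n.*2.+1))
    (n.+1.*2%:R * cos x ^+ n.+1.*2 - n.*2.+1%:R * cos x ^+ n.*2).
  apply: (is_derive_eq (is_deriveM (is_derive_sin x) (is_derive_cosX n.*2.+1 x))).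
  rewrite /GRing.scale/= doubleS -!natr1 !exprS.
  have := cos2Dsin2 x; set c := cos x; set s := sin x; set P := c ^+ n.*2 => E.
  have {}E : s * s = 1 - c * c by rewrite -E; ring.
  ring: E.
have C : continuous (fun x : R => n.+1.*2%:R * cos x ^+ n.+1.*2 - n.*2.+1%:R * cos x ^+ n.*2).
  by move=> x; apply: cvgB; apply: cvgM; [exact: cvg_cst|exact: cont_cosX|exact: cvg_cst|exact: cont_cosX].
have := Rintegral_derive pi2_ge0 D C.
rewrite /= fctE cos_pihalf sin0 mul0r expr0n/= mulr0 subrr.
have ic k : mu.-integrable `[0, pi / 2] (EFin \o (fun x => cos x ^+ k)) by exact/int_cont/cont_cosX.
rewrite RintegralB//; last 2 first.
- by apply: int_cont => x; apply: cvgM; [exact: cvg_cst|exact: cont_cosX].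
- by apply: int_cont => x; apply: cvgM; [exact: cvg_cst|exact: cont_cosX].
by rewrite !RintegralZl// => /eqP; rewrite subr_eq0 => /eqP.
Qed.

Lemma cosint2_rec n : cosint n.+1 + 2 * n.+1%:R ^+ 2 * cosint2 n.+1 =
  n.+1%:R * n.*2.+1%:R * cosint2 n.
Proof.
have D (x : R) : is_derive x 1 (id * (fun x => cos x ^+ n.+1.*2) +
      (n.+1%:R \*: (id ^+ 2)) * (sin * (fun x => cos x ^+ n.*2.+1)))
    (cos x ^+ n.+1.*2 + 2 * n.+1%:R ^+ 2 * (x ^+ 2 * cos x ^+ n.+1.*2) - n.+1%:R * n.*2.+1%:R * (x ^+ 2 * cos x ^+ n.*2)).
  apply: (is_derive_eq (is_deriveD (is_deriveM (is_derive_id x 1) (is_derive_cosX n.+1.*2 x))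
     (is_deriveM (is_deriveZ n.+1%:R (is_deriveX 2 (is_derive_id x 1))) (is_deriveM (is_derive_sin x) (is_derive_cosX n.*2.+1 x))))).
  rewrite /GRing.scale/= !fctE !exprS -addn2 natrD.
  have := cos2Dsin2 x; set c := cos x; set s := sin x; set P := c ^+ n.*2 => E.
  have {}E : s * s = 1 - c * c by rewrite -E; ring.
  have e1 : n.+1.*2%:R = 2 * n.+1%:R :> R by rewrite -mul2n natrM.
  have e2 : n.*2.+1%:R = 2 * n.+1%:R - 1 :> R by rewrite -e1 doubleS -!natr1; ring.
  rewrite e1 e2 !(expr0, add0r, mulr1) /GRing.scale/=; set a := n.+1%:R; ring: E.
have C : continuous (fun x : R => cos x ^+ n.+1.*2 + 2 * n.+1%:R ^+ 2 * (x ^+ 2 * cos x ^+ n.+1.*2) - n.+1%:R * n.*2.+1%:R * (x ^+ 2 * cos x ^+ n.*2)).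
  move=> x; apply: cvgB; [apply: cvgD|]; [exact: cont_cosX| |];
    by apply: cvgM; [exact: cvg_cst|exact: cont_x2cosX].
have := Rintegral_derive pi2_ge0 D C.
have cz k : continuous (fun x : R => k * (x ^+ 2 * cos x ^+ n.*2)).
  by move=> x; apply: cvgM; [exact: cvg_cst|exact: cont_x2cosX].
have cz' k : continuous (fun x : R => k * (x ^+ 2 * cos x ^+ n.+1.*2)).
  by move=> x; apply: cvgM; [exact: cvg_cst|exact: cont_x2cosX].
rewrite /= !fctE cos_pihalf sin0 doubleS !expr0n/= /GRing.scale/= !(mulr0, mul0r, addr0) subrr.
rewrite RintegralB//; [|apply: int_cont|exact: int_cont]; last first.
  by move=> x; apply: cvgD; [exact: cont_cosX|exact: cz'].
rewrite RintegralD//; [|exact/int_cont/cont_cosX|exact: int_cont].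
rewrite !RintegralZl//; [|exact/int_cont/cont_x2cosX..].
by rewrite -doubleS => /eqP; rewrite subr_eq0 => /eqP.
Qed.

Lemma cosint_gt0 n : 0 < cosint n.
Proof.
elim: n => [|n IH].
  rewrite /cosint; under eq_Rintegral do rewrite expr0.
  rewrite Rintegral_cst//= lebesgue_measure_itv/= lte_fin divr_gt0 ?pi_gt0//=.
  by rewrite mul1r subr0 divr_gt0 ?pi_gt0.
have : 0 < n.+1.*2%:R * cosint n.+1 by rewrite cosint_rec mulr_gt0// ltr0n.
by rewrite pmulr_rgt0// ltr0n double_gt0.
Qed.

Lemma mul_cos_le_sin (x : R) : 0 <= x <= pi / 2 -> 0 <= x * cos x <= sin x.
Proof.
move=> /andP[x0 x1]; have pi0 := @pi_gt0 R.
have c0 : 0 <= cos x by rewrite cos_ge0_pihalf// x1 andbT; lra.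
rewrite mulr_ge0//= -subr_ge0.
have D (t : R) : is_derive t 1 (sin - id * cos) (t * sin t).
  apply: (is_derive_eq (is_deriveB (is_derive_sin t) (is_deriveM (is_derive_id t 1) (is_derive_cos t)))).
  by rewrite /GRing.scale/=; ring.
have := Rintegral_derive x0 D; rewrite /= !fctE sin0 mul0r subrr subr0 => <-; last first.
  by move=> t; apply: cvgM; [exact: cvg_id|exact: continuous_sin].
apply: Rintegral_ge0 => t /=; rewrite in_itv/= => /andP[t0 tx].
by rewrite mulr_ge0// sin_ge0_pi// t0; lra.
Qed.

(** Since [x * cos x <= sin x], the integrand of [cosint2 n.+1] is at most
   [sin x ^ 2 * cos x ^ 2n], which is the difference of two even powers of
   the cosine. *)
Lemma cosint2_le n : n.*2.+1%:R * cosint2 n.+1 <= cosint n.+1.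
Proof.
have H : cosint2 n.+1 <= cosint n - cosint n.+1.
  rewrite /cosint -RintegralB//; [|exact/int_cont/cont_cosX..].
  apply: le_Rintegral => //.
  - exact/int_cont/cont_x2cosX.
  - by apply: int_cont => x; apply: cvgB; exact: cont_cosX.
  move=> x /=; rewrite in_itv/= => /mul_cos_le_sin /andP[xc0 xcs].
  have P0 : 0 <= cos x ^+ n.*2 by rewrite -mul2n exprM exprn_ge0// sqr_ge0.
  have : (x * cos x) ^+ 2 <= sin x ^+ 2 by rewrite lerXn2r// nnegrE// (le_trans xc0).
  rewrite sin2cos2 doubleS !exprS; move: P0; set P := cos x ^+ _; nra.
have := cosint_rec n; rewrite doubleS -!natr1.
have : 0 <= n.*2%:R :> R by [].
by have := cosint_gt0 n.+1; move: H; set a := cosint _; set b := cosint _; set c := cosint2 _; nra.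
Qed.

Lemma sum_inv_sqr n : \sum_(k < n) (k.+1%:R ^+ 2)^-1 = pi ^+ 2 / 6 - 2 * cosint2 n / cosint n :> R.
Proof.
elim: n => [|n IH].
  have -> : cosint 0 = \int[mu]_(x in `[0, pi / 2]) 1.
    by apply: eq_Rintegral => x _; rewrite expr0.
  have -> : cosint2 0 = \int[mu]_(x in `[0, pi / 2]) (x ^+ 2).
    by apply: eq_Rintegral => x _; rewrite expr0 mulr1.
  rewrite big_ord0 Rintegral_cst//= lebesgue_measure_itv/= lte_fin divr_gt0 ?pi_gt0//=.
  have D (t : R) : is_derive t 1 (fun t => 3^-1 * t ^+ 3) (t ^+ 2).
    by apply: is_derive_eq; rewrite /GRing.scale/=; field.
  rewrite (Rintegral_derive pi2_ge0 D); last exact: exprn_continuous.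
  rewrite mul1r subr0 expr0n/= mulr0 subr0.
  by have /lt0r_neq0 := @pi_gt0 R; move: pi => p p0; field.
rewrite big_ord_recr/= IH.
have := cosint_rec n; have := cosint2_rec n.
have := cosint_gt0 n; have := cosint_gt0 n.+1.
set a := cosint _; set b := cosint _; set c := cosint2 _; set d := cosint2 _ => a0 b0.
have -> : n.*2.+1%:R = 2 * n.+1%:R - 1 :> R by rewrite -mul2n -!natr1 natrM; ring.
have -> : n.+1.*2%:R = 2 * n.+1%:R :> R by rewrite -mul2n natrM.
have n0 : 0 < n.+1%:R :> R by rewrite ltr0n.
move: n0; set m := n.+1%:R => m0 E2 E1; clearbody m.
have m0' := lt0r_neq0 m0; have a0' := lt0r_neq0 a0; have b0' := lt0r_neq0 b0.
have k0 : 2 * m - 1 != 0.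
  by apply: contra_eq_neq E1 => ->; rewrite mul0r mulf_neq0// mulf_neq0.
have eb : b = 2 * m * a / (2 * m - 1) by rewrite E1; field.
have ed : d = (a + 2 * m ^+ 2 * c) / (m * (2 * m - 1)) by rewrite E2; field; rewrite k0 m0'.
by rewrite eb ed; field; rewrite ?k0 ?m0' ?a0'.
Qed.

Lemma sum_inv_sqr_ge n : pi ^+ 2 / 6 - 2 / n.*2.+1%:R <= \sum_(k < n.+1) (k.+1%:R ^+ 2)^-1 :> R.
Proof.
rewrite sum_inv_sqr lerD2l lerN2 -mulrA ler_pM2l// ler_pdivrMr ?cosint_gt0//.
by rewrite mulrC ler_pdivlMr ?ltr0n// mulrC cosint2_le.
Qed.

End basel.

(** * The bias *)

Section monotone.
Local Open Scope ereal_scope.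
Context d (T : measurableType d) (R : realType) (mu : {measure set T -> \bar R}).

(** The integral of a nonnegative function is a supremum over the simple
   functions below it, hence monotone even without measurability. This serves for
   functions of Sobolev class, which are arbitrary outside the unit interval, and
   for the risk, whose integrand involves such a function at random points. *)
Lemma le_integral_nonmeasurable (D : set T) (f1 f2 : T -> \bar R) :
  (forall x, D x -> 0 <= f1 x) -> (forall x, D x -> f1 x <= f2 x) ->
  \int[mu]_(x in D) f1 x <= \int[mu]_(x in D) f2 x.
Proof.
move=> f10 f12.
have f20 x : D x -> 0 <= f2 x by move=> Dx; exact: le_trans (f10 x Dx) (f12 x Dx).
rewrite integral_mkcond [leRHS]integral_mkcond.
rewrite !ge0_integralTE; [|by move=> x; apply: erestrict_ge0..].
apply: ereal_sup_le => _ /= [h hf <-]; exists h => // x.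
by apply: le_trans (hf x) _; exact: lee_restrict.
Qed.

End monotone.

Section bias.
Context {R : realType}.
Local Notation mu := (@lebesgue_measure R).
Local Notation I01 := (`[0%R, 1%R]%classic : set R).

(** The starting point of the regularity of [f]: the integral bound alone gives the
   square integrability of the top derivative, at a stage where nothing is known
   of the measurability of [f]. *)
Lemma sobolev_sqr_le alpha (C : R) (f : R -> R) (D : nat -> R -> R) : derivs alpha f D ->
  (\int[mu]_(x in I01) ((f x) ^+ 2 + (D alpha x) ^+ 2)%:E <= (C ^+ 2)%:E)%E ->
  L2 (D alpha) /\ ip (D alpha) (D alpha) <= C ^+ 2.
Proof.
move=> [_ mD _] HC.
have HD : (\int[mu]_(x in I01) (D alpha x ^+ 2)%:E <= (C ^+ 2)%:E)%E.
  apply: le_trans HC; apply: le_integral_nonmeasurable => x _.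
    by rewrite lee_fin sqr_ge0.
  by rewrite lee_fin lerDr sqr_ge0.
have iD : mu.-integrable I01 (EFin \o (fun x => D alpha x ^+ 2)).
  apply/integrableP; split; first by apply/measurable_EFinP; exact: measurable_funX.
  rewrite (@eq_integral _ _ _ mu I01 (fun x => (D alpha x ^+ 2)%:E)); last first.
    by move=> x _ /=; rewrite ger0_norm// sqr_ge0.
  by apply: le_lt_trans HD _; exact: ltry.
split; first by split.
rewrite /ip -lee_fin /Rintegral fineK; last exact: (integrable_fin_num _ iD).
by [].
Qed.

Lemma derivs_L2 alpha (f : R -> R) (D : nat -> R -> R) : derivs alpha f D -> L2 (D alpha) ->
  forall j, (j <= alpha)%N -> L2 (D j).
Proof.
move=> [_ _ Dp] LD j ja; rewrite -(subKn ja); move: (leq_subr j alpha).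
elim: (alpha - j)%N => [|i IH] ia; first by rewrite subn0.
have ia' : (alpha - i.+1 < alpha)%N by rewrite ltn_subrL (leq_ltn_trans (leq0n i) ia).
apply: (@primitive_L2 _ _ (D (alpha - i.+1).+1)); last exact: Dp.
by rewrite subnSK//; exact/IH/ltnW.
Qed.

(** Differentiation exchanges the sine and cosine coefficients of a frequency, up to
   sign; the sum of their squares is merely multiplied. *)
Definition energy (u : R -> R) k := coef u k.*2 ^+ 2 + coef u k.*2.+1 ^+ 2.

Lemma energy_primitive g h k : L2 h -> primitive g h -> g 0 = g 1 -> (0 < k)%N ->
  energy g k = energy h k / freq k ^+ 2.
Proof.
move=> Lh gh g01 k0; rewrite /energy (coef_primitive_even Lh gh)// (coef_primitive_odd Lh gh)//.
by have := @freq_neq0 R k k0 => fk; field.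
Qed.

Lemma energy_derivs alpha (f : R -> R) (D : nat -> R -> R) k : derivs alpha f D -> L2 (D alpha) ->
  (forall j, (j < alpha)%N -> D j 0 = D j 1) -> (0 < k)%N ->
  energy (D 0%N) k = energy (D alpha) k / freq k ^+ (2 * alpha).
Proof.
move=> dD LD D01 k0.
suff H j : (j <= alpha)%N -> energy (D 0%N) k = energy (D j) k / freq k ^+ (2 * j) by exact: H.
elim: j => [|j IH] ja; first by rewrite muln0 expr0 divr1.
have [_ _ Dp] := dD.
rewrite IH; last exact: ltnW.
rewrite (@energy_primitive _ (D j.+1))//; last 3 first.
- exact: (derivs_L2 dD).
- exact: Dp.
- exact: D01.
by rewrite mulnS exprD -mulrA -invfM.
Qed.

(** The constant [12^-1] is the sum of the whole series, by the Basel identity, so the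
   left-hand side is a tail of a series of inverse squares. *)
Lemma kernel_resid_le N : 12^-1 - \sum_(k < N.+1) 2 / freq k.+1 ^+ 2 <= N.+1%:R^-1 :> R.
Proof.
have := @sum_inv_sqr_ge R N.
have -> : \sum_(k < N.+1) 2 / freq k.+1 ^+ 2 = (2 * pi ^+ 2)^-1 * \sum_(k < N.+1) (k.+1%:R ^+ 2)^-1 :> R.
  rewrite mulr_sumr; apply: eq_bigr => k _; rewrite /freq.
  have /lt0r_neq0 := @pi_gt0 R; have : k.+1%:R != 0 :> R by rewrite pnatr_eq0.
  by move: pi (k.+1%:R) => p a a0 p0; field; rewrite a0 p0.
set S := \sum_(_ < _) _ => HS.
have p2 : 2 <= pi :> R by exact: pi_ge2.
have n0 : 0 < N.+1%:R :> R by rewrite ltr0n.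
have hm : N.+1%:R <= N.*2.+1%:R :> R by rewrite ler_nat ltnS -addnn leq_addr.
have H1 : (2 * pi ^+ 2)^-1 * (pi ^+ 2 / 6 - 2 / N.*2.+1%:R) <= (2 * pi ^+ 2)^-1 * S.
  by rewrite ler_pM2l// invr_gt0 mulr_gt0// exprn_gt0//; lra.
have -> : 12^-1 = (2 * pi ^+ 2)^-1 * (pi ^+ 2 / 6) :> R.
  by have : pi != 0 :> R by [rewrite lt0r_neq0//; lra]; move: pi => p p0; field.
apply: (@le_trans _ _ ((2 * pi ^+ 2)^-1 * (2 / N.*2.+1%:R))).
  move: H1; rewrite mulrBr.
  set x := _ * (_ / 6); set y := _ * (2 / _); set z := _ * S; lra.
have m0 : 0 < N.*2.+1%:R :> R by exact: lt_le_trans hm.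
rewrite (_ : _ * _ = (pi ^+ 2 * N.*2.+1%:R)^-1); last first.
  have : pi != 0 :> R by rewrite lt0r_neq0//; lra.
  by move: (lt0r_neq0 m0); move: pi (N.*2.+1%:R) => p m m1 p0; field; rewrite m1 p0.
rewrite lef_pV2 ?posrE ?mulr_gt0 ?exprn_gt0//; try lra.
by apply: (le_trans hm); rewrite ler_peMl ?ltW//; nra.
Qed.

(** The frequencies above [K] are split at a larger cutoff. Up to it, the energy of
   [f] is that of the top derivative divided by a power of a frequency that is at
   least [K], and Bessel's inequality applies to the top derivative. Beyond it, the
   uniform convergence of the partial sums makes the remainder as small as wanted;
   this stands for the completeness of the basis. *)
Theorem sobolev_proj alpha (C : R) (f : R -> R) K : sobolev_class alpha C f -> (0 < alpha)%N -> (0 < K)%N ->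
  ip (fun x => trig_proj K f x - f x) (fun x => trig_proj K f x - f x) <= C ^+ 2 / K%:R ^+ (2 * alpha).
Proof.
move=> [D [dD HC D01]] a0 K0.
have [LD DC] := sobolev_sqr_le dD HC.
have [fD _ Dp] := dD.
have Lj := derivs_L2 dD LD.
pose g := D 0%N.
have Lg : L2 g by exact: Lj.
have -> : ip (fun x => trig_proj K f x - f x) (fun x => trig_proj K f x - f x) =
    ip (fun x => trig_proj K g x - g x) (fun x => trig_proj K g x - g x).
  have cE j : coef f j = coef g j by apply: eq_ip => // x /fD <-.
  have pE : trig_proj K f = trig_proj K g by apply/funext => x; apply: eq_bigr => j _; rewrite cE.
  by rewrite pE; apply: eq_ip => x /fD <-.
have Kp : 0 < K%:R ^+ (2 * alpha) :> R by rewrite exprn_gt0// ltr0n.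
have tail N : (K <= N.+1.*2.+1)%N ->
  \sum_(j < N.+1.*2.+1) coef g j.+1 ^+ 2 - \sum_(j < K) coef g j.+1 ^+ 2 <=
  C ^+ 2 / K%:R ^+ (2 * alpha).
  move=> KN; rewrite (big_ord_widen _ (fun j => coef g j.+1 ^+ 2) KN) [X in _ - X]big_mkcond -sumrB.
  pose G i : R := if (K < i)%N then coef g i ^+ 2 else 0.
  rewrite (eq_bigr (fun j : 'I_N.+1.*2.+1 => G j.+1)); last first.
    by move=> j _; rewrite /G ltnS; case: ltnP; rewrite ?subrr ?subr0.
  rewrite sum_trig_pairs {1}/G ltnNge K0 add0r.
  apply: (@le_trans _ _ (\sum_(k < N.+1) energy (D alpha) k.+1 / K%:R ^+ (2 * alpha))).
    apply: ler_sum => k _.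
    have e0 u i : 0 <= energy u i by rewrite addr_ge0// sqr_ge0.
    have := ltnP K k.+1.*2.+1; case=> Kk; last first.
      rewrite /G; have [-> ->] : (K < k.+1.*2)%N = false /\ (K < k.+1.*2.+1)%N = false by split; apply/negP; lia.
      by rewrite addr0 divr_ge0// ltW.
    apply: (@le_trans _ _ (energy g k.+1)).
      by rewrite /G Kk /energy lerD2r; case: ifP => // _; exact: sqr_ge0.
    rewrite (energy_derivs dD)//; apply: ler_wpM2l => //.
    (* The frequency [2 * pi * k.+1] exceeds [2 * k.+1], itself at least [K] by [Kk]. *)
    have K2 : K%:R <= freq k.+1 :> R.
      have := @pi_ge2 R; rewrite /freq; move: Kk; rewrite ltnS -(@ler_nat R) -mul2n natrM => Kk.
      have : 0 < k.+1%:R :> R by rewrite ltr0n.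
      nra.
    by rewrite lef_pV2 ?posrE ?lerXn2r ?nnegrE ?exprn_gt0 ?ltr0n// ?freq_gt0// ltW// freq_gt0.
  rewrite -mulr_suml; apply: ler_wpM2r; first by rewrite invr_ge0 ltW.
  apply: le_trans DC; apply: le_trans (Bessel N.+1.*2.+1 LD).
  by rewrite (sum_trig_pairs _ (fun j => coef (D alpha) j ^+ 2)) lerDr sqr_ge0.
pose A := ip (D 1%N) (D 1%N).
have A0 : 0 <= A by exact: ip_ge0.
have head N : ip g g - \sum_(j < N.+1.*2.+1) coef g j.+1 ^+ 2 <= A / N.+1%:R.
  rewrite -ip_proj_resid//.
  have sup x : x \in `[0, 1] -> (trig_proj N.+1.*2.+1 g x - g x) * (trig_proj N.+1.*2.+1 g x - g x) <= A / N.+1%:R.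
    move=> xI; rewrite -expr2; apply: le_trans (sup_partial_sum (Lj 1%N a0) (Dp 0%N a0) (D01 0%N a0) _ xI) _.
    by rewrite mulrC ler_wpM2l// kernel_resid_le.
  have Lr : L2 (fun x => trig_proj N.+1.*2.+1 g x - g x) by apply: L2B => //; exact: L2_trig_sum.
  apply: (@le_trans _ _ (\int[mu]_(x in I01) (A / N.+1%:R))).
    apply: le_Rintegral => //.
    - exact: L2M.
    - by apply: L2_integrable; apply: continuous_L2; exact: cst_continuous.
  by rewrite Rintegral_cst//= mu_I01/= mulr1.
(* The cutoff [N] is chosen to make [A / N.+1] smaller than the excess [B - b]. *)
rewrite leNgt; apply/negP => H.
set B := ip _ _ in H; set b := _ / _ in H.
pose N := (Num.truncn (A / (B - b)) + K)%N.
have Bb : 0 < B - b by rewrite subr_gt0.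
have AN : A / (B - b) < N.+1%:R.
  apply: lt_le_trans (truncnS_gt _) _.
  by rewrite ler_nat ltnS leq_addr.
have KN : (K <= N.+1.*2.+1)%N by rewrite /N -addnn; lia.
have {}tail := tail N KN; have {}head := head N.
have BE : B = ip g g - \sum_(j < K) coef g j.+1 ^+ 2 by exact: ip_proj_resid.
have : B - b <= A / N.+1%:R.
  rewrite -/b in tail; move: tail head; rewrite BE.
  by move: (A / _) (\sum_(_ < N.+1.*2.+1) _) (\sum_(_ < K) _) => q s1 s2; lra.
rewrite leNgt => /negP; apply.
by rewrite ltr_pdivrMr ?ltr0n// mulrC -ltr_pdivrMr.
Qed.
End bias.

(** * Laws of random variables *)

Section image_measure.
Local Open Scope ereal_scope.
Context {R : realType} {d1 d2 : measure_display}.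
Context {T : measurableType d1} {S : measurableType d2}.

Lemma integral_indic_preimage (m : {measure set T -> \bar R}) (p : T -> S) (B : set S) :
  measurable_fun setT p -> measurable B ->
  \int[m]_x (\1_B (p x) : R)%:E = m (p @^-1` B).
Proof.
move=> mp mB; rewrite (eq_integral (fun x => (\1_(p @^-1` B) x)%:E)); last first.
  by move=> x _; rewrite !indicE; congr (_%:R%:E); apply/idP/idP => /set_mem ?; exact/mem_set.
by rewrite integral_indic ?setIT// -[X in measurable X]setTI; exact: mp.
Qed.

End image_measure.

Section weighted_law.
Local Open Scope ereal_scope.
Context {R : realType} {dS : measure_display} {S : measurableType dS}.

Import HBNNSimple.

Let weighted_nnsfun {d : measure_display} {T : measurableType d}
    (m : {measure set T -> \bar R}) (p : T -> S) (H : T -> R)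
    (mp : measurable_fun setT p) (mH : measurable_fun setT H)
    (H0 : forall x, (0 <= H x)%R) (f : {nnsfun S >-> R}) :
  \int[m]_x ((f (p x))%:E * (H x)%:E) =
  \sum_(r \in range f) r%:E * \int[m]_x ((\1_(f @^-1` [set r]) (p x))%:E * (H x)%:E).
Proof.
have mi B : measurable B -> measurable_fun setT (fun x => (\1_B (p x))%:E * (H x)%:E).
  move=> mB; apply: emeasurable_funM; apply/measurable_EFinP => //.
  by apply: (measurableT_comp _ mp); exact: measurable_indic.
have r0 r x : 0 <= r%:E * ((\1_(f @^-1` [set r]) (p x))%:E * (H x)%:E).
  by rewrite muleA mule_ge0 ?lee_fin//; exact: nnfun_muleindic_ge0.
transitivity (\int[m]_x \sum_(r \in range f) r%:E * ((\1_(f @^-1` [set r]) (p x))%:E * (H x)%:E)).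
  apply: eq_integral => x _; rewrite fimfunE -fsumEFin// ge0_mule_fsuml; last first.
    by move=> r; rewrite EFinM nnfun_muleindic_ge0.
  by apply: eq_fsbigr => r _; rewrite EFinM muleA.
rewrite ge0_integral_fsum//; last by move=> r; apply: measurable_funeM; exact: mi.
apply: eq_fsbigr => r; rewrite inE => -[s _ <-].
by rewrite ge0_integralZl//; [exact: mi|move=> x _; rewrite mule_ge0// lee_fin|rewrite lee_fin].
Qed.

Let weighted_approx {d : measure_display} {T : measurableType d}
    (m : {measure set T -> \bar R}) (p : T -> S) (H : T -> R)
    (mp : measurable_fun setT p) (mH : measurable_fun setT H)
    (H0 : forall x, (0 <= H x)%R) (f : S -> \bar R) (mf : measurable_fun setT f)
    (f0 : forall x, 0 <= f x) :
  \int[m]_x (f (p x) * (H x)%:E) =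
  lim ((\int[m]_x ((nnsfun_approx measurableT mf n (p x))%:E * (H x)%:E)) @[n --> \oo]).
Proof.
rewrite -monotone_convergence//=.
- apply: eq_integral => x _; apply/esym/cvg_lim => //=.
  by apply: cvgeZr => //; exact: cvg_nnsfun_approx.
- move=> n; apply: emeasurable_funM; apply/measurable_EFinP => //.
  exact: measurableT_comp.
- by move=> n x _; rewrite mule_ge0// lee_fin.
- by move=> x _ k n kn; rewrite lee_wpmul2r ?lee_fin//; exact/lefP/nd_nnsfun_approx.
Qed.

(** Both sides are additive in [f] and continuous along increasing sequences, so it
   is enough to compare them on indicators. The weights allow [G] to be a density
   and [H] to collect the other factors of a product. *)
Lemma eq_weighted_integral {d1 d2 : measure_display}
    {T1 : measurableType d1} {T2 : measurableType d2}
    (m1 : {measure set T1 -> \bar R}) (m2 : {measure set T2 -> \bar R})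
    (p : T1 -> S) (q : T2 -> S) (H : T1 -> R) (G : T2 -> R) :
  measurable_fun setT p -> measurable_fun setT H -> (forall x, (0 <= H x)%R) ->
  measurable_fun setT q -> measurable_fun setT G -> (forall x, (0 <= G x)%R) ->
  (forall B, measurable B ->
    \int[m1]_x ((\1_B (p x))%:E * (H x)%:E) = \int[m2]_y ((\1_B (q y))%:E * (G y)%:E)) ->
  forall f : S -> \bar R, measurable_fun setT f -> (forall x, 0 <= f x) ->
    \int[m1]_x (f (p x) * (H x)%:E) = \int[m2]_y (f (q y) * (G y)%:E).
Proof.
move=> mp mH H0 mq mG G0 HG f mf f0.
rewrite (weighted_approx m1 mp mH H0 mf f0) (weighted_approx m2 mq mG G0 mf f0).
congr (lim (_ @ \oo)); apply/funext => n.
rewrite !weighted_nnsfun//; apply: eq_fsbigr => r _; congr (_ * _); apply: HG.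
exact: measurable_funPTI.
Qed.

Lemma ge0_integral_pdf {d : measure_display} {Omega : measurableType d}
    (P : probability Omega R) (X : Omega -> S) (m : {measure set S -> \bar R})
    (pdf : S -> R) (f : S -> \bar R) :
  measurable_fun setT X -> measurable_fun setT pdf -> (forall x, (0 <= pdf x)%R) ->
  (forall B, measurable B -> P (X @^-1` B) = \int[m]_(x in B) (pdf x)%:E) ->
  measurable_fun setT f -> (forall x, 0 <= f x) ->
  \int[P]_o f (X o) = \int[m]_x (f x * (pdf x)%:E).
Proof.
move=> mX mpdf pdf0 XE mf f0.
transitivity (\int[P]_o (f (X o) * (1%R)%:E)).
  by apply: eq_integral => o _; rewrite mule1.
apply: (@eq_weighted_integral _ _ _ _ P m X id (fun=> 1%R) pdf) => // B mB.
under eq_integral do rewrite mule1.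
rewrite integral_indic_preimage//; apply: etrans (XE B mB) _.
rewrite integral_mkcond; apply: eq_integral => x _.
by rewrite patchE indicE; case: ifP => xB; rewrite ?mul1e ?mul0e.
Qed.

End weighted_law.

(** * Products of independent variables *)

Section product_expectation.
Context {R : realType} {d : measure_display} {Omega : measurableType d}.
Variable P : probability Omega R.
Variables (I : finType) (Z : I -> {RV P >-> R}).
Hypothesis Z_ind : mutually_independent Z.

Let measurable_factor (g : I -> R -> R) i :
  (forall i, measurable_fun setT (g i)) -> measurable_fun setT (fun o => g i (Z i o)).
Proof. by move=> mg; apply: (measurableT_comp (mg i)). Qed.

Lemma measurable_prod_RV (g : I -> R -> R) (r : seq I) (Q : pred I) :
  (forall i, measurable_fun setT (g i)) ->
  measurable_fun setT (fun o => \prod_(i <- r | Q i) g i (Z i o)).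
Proof.
move=> mg; elim: r => [|i r IH].
  rewrite (_ : (fun _ => _) = fun=> 1); first exact: measurable_cst.
  by apply/funext => o; rewrite big_nil.
have -> : (fun o => \prod_(j <- i :: r | Q j) g j (Z j o)) =
    (fun o => if Q i then g i (Z i o) * \prod_(j <- r | Q j) g j (Z j o)
              else \prod_(j <- r | Q j) g j (Z j o)).
  by apply/funext => o; rewrite big_cons.
by case: (Q i) => //; apply: measurable_funM => //; exact: measurable_factor.
Qed.

Let prod_indic (B : I -> set R) : (forall i, measurable (B i)) ->
  (\int[P]_o (\prod_i (\1_(B i) (Z i o) : R))%:E =
   (\prod_i \int[P]_o (\1_(B i) (Z i o))%R)%R%:E)%E.
Proof.
move=> mB.
have E1 i : (\int[P]_o (\1_(B i) (Z i o))%:E = P (Z i @^-1` B i))%E.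
  exact: integral_indic_preimage.
have E2 : (\int[P]_o (\prod_i (\1_(B i) (Z i o) : R))%:E =
    P (\bigcap_(i in [set` [set: I]%SET]) (Z i @^-1` B i)))%E.
  rewrite (eq_integral (fun o => (\1_(\bigcap_(i in [set` [set: I]%SET]) (Z i @^-1` B i)) o)%:E)); last first.
    move=> o _; congr EFin; rewrite indicE; case: (boolP (o \in _)) => [|].
      rewrite inE => oB; rewrite big1// => i _.
      by rewrite indicE mem_set//; apply: oB; rewrite /= inE.
    rewrite notin_setE => oB.
    have [i nB] : exists i, ~ B i (Z i o).
      apply: contrapT => /forallNP H; apply: oB => i _; apply: contrapT; exact: H.
    by rewrite (bigD1 i)//= indicE memNset// mul0r.
  rewrite integral_indic ?setIT//.
  apply: fin_bigcap_measurable; first exact: finite_finset.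
  by move=> i _; exact: measurable_funPTI.
rewrite E2 Z_ind// -prodEFin; apply: eq_big => [i|i _]; first by rewrite inE.
rewrite /Rintegral E1 fineK// fin_num_measure//; exact: measurable_funPTI.
Qed.

(** Independence is the case where all factors are indicators. The factors are made
   arbitrary one at a time: when the others are kept fixed, both sides are integrals
   of one factor against image measures, which agree on measurable sets by the
   previous step. *)
Lemma expectation_prod_ge0 (g : I -> R -> R) :
  (forall i, measurable_fun setT (g i)) -> (forall i x, 0 <= g i x) ->
  (forall i, P.-integrable setT (fun o => (g i (Z i o))%:E)) ->
  (\int[P]_o (\prod_i g i (Z i o))%:E = (\prod_i \int[P]_o (g i (Z i o))%R)%R%:E)%E.
Proof.
(* The factors with index outside [A] are indicators. *)
suff H n : forall (A : {set I}) (g : I -> R -> R), #|A| = n ->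
  (forall i, i \notin A -> exists2 B, measurable B & g i = \1_B) ->
  (forall i, measurable_fun setT (g i)) -> (forall i x, 0 <= g i x) ->
  (forall i, P.-integrable setT (fun o => (g i (Z i o))%:E)) ->
  (\int[P]_o (\prod_i g i (Z i o))%:E = (\prod_i \int[P]_o (g i (Z i o))%R)%R%:E)%E.
  by apply: (H _ [set: I]%SET g erefl) => i; rewrite inE.
elim: n => [|n IH] A {}g cA gA mg g0 ig.
  have /choice[B HB] : forall i, exists B, measurable B /\ g i = \1_B.
    move=> i; have [|B mB gB] := gA i; last by exists B.
    by move/eqP: cA; rewrite cards_eq0 => /eqP ->; rewrite inE.
  have -> : g = fun i => \1_(B i) by apply/funext => i; case: (HB i).
  by rewrite prod_indic// => i; case: (HB i).
have [s sA] : exists s, s \in A by apply/finset.set0Pn; rewrite -cards_eq0 cA.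
pose c := \prod_(i | i != s) \int[P]_o (g i (Z i o))%R.
have c0 : 0 <= c by apply: prodr_ge0 => i _; apply: Rintegral_ge0.
transitivity (\int[P]_o ((g s (Z s o))%:E * (\prod_(i | i != s) g i (Z i o))%:E))%E.
  by apply: eq_integral => o _; rewrite (bigD1 s)//= EFinM.
rewrite (@eq_weighted_integral _ _ _ _ _ _ _ P P (Z s) (Z s) _ (fun=> c) _ _ _ _ _ _ _ (fun x => (g s x)%:E))//.
- rewrite (integralZr measurableT (ig s) c).
  by rewrite (bigD1 s)//= EFinM {2}/Rintegral fineK// (integrable_fin_num _ (ig s)).
- exact: measurable_prod_RV.
- by move=> x; apply: prodr_ge0.
- move=> B mB.
  pose g' i := if i == s then \1_B else g i.
  have g's o : g' s (Z s o) = \1_B (Z s o) by rewrite /g' eqxx.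
  have g'i i o : i != s -> g' i (Z i o) = g i (Z i o) by move=> /negbTE; rewrite /g' => ->.
  have m1 : measurable_fun setT (fun o => \1_B (Z s o) : R).
    by apply: (measurableT_comp (measurable_indic mB)).
  have iB : P.-integrable setT (fun o => (\1_B (Z s o) : R)%:E).
    apply: (le_integrable _ _ _ (finite_measure_integrable_cst P 1 measurableT)) => //.
      exact/measurable_EFinP.
    by move=> o _; rewrite /= lee_fin normr1 ger0_norm// indicE; case: (_ \in _).
  rewrite (integralZr measurableT iB c).
  transitivity (\int[P]_o (\prod_i g' i (Z i o))%:E)%E.
    apply: eq_integral => o _; rewrite [in RHS](bigD1 s)//= EFinM g's; congr (_ * _%:E)%E.
    by apply: eq_bigr => i /g'i ->.
  rewrite (IH (A :\ s)%SET).
  - rewrite (bigD1 s)//= EFinM; congr (_ * _%:E)%E.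
      rewrite /Rintegral fineK; last by under eq_fun do rewrite g's; exact: integrable_fin_num iB.
      by under eq_integral do rewrite g's.
    by apply: eq_bigr => i si; apply: eq_Rintegral => o _; rewrite g'i.
  - by move: cA; rewrite (cardsD1 s) sA add1n => -[].
  - move=> i; rewrite !inE negb_and negbK /g'; case: eqVneq => [_ _|_ /= iA]; first by exists B.
    exact: gA.
  - by move=> i; rewrite /g'; case: ifP => // _; exact: measurable_indic.
  - by move=> i x; rewrite /g'; case: ifP => // _.
  - move=> i; have [->|si] := eqVneq i s; first by under eq_fun do rewrite g's.
    by under eq_fun do rewrite g'i//.
- by apply/measurable_EFinP; exact: mg.
- by move=> x; rewrite lee_fin.
Qed.

Section integrable_factors.
Variable g : I -> R -> R.
Hypothesis mg : forall i, measurable_fun setT (g i).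
Hypothesis ig : forall i, P.-integrable setT (fun o => (g i (Z i o))%:E).

Lemma integrable_prod_independent :
  P.-integrable setT (fun o => (\prod_i g i (Z i o))%:E).
Proof.
apply/integrableP; split; first by apply/measurable_EFinP; exact: measurable_prod_RV.
rewrite (eq_integral (fun o => (\prod_i `|g i (Z i o)|)%:E)); last first.
  by move=> o _; rewrite /= normr_prod.
rewrite (@expectation_prod_ge0 (fun i x => `|g i x|)) ?ltry//.
- by move=> i; exact: measurableT_comp.
- by move=> i; exact: integrable_norm (ig i).
Qed.

End integrable_factors.

(** Here the factors are allowed to change sign one at a time, by splitting a factor
   into its positive and negative parts. *)
Theorem expectation_prod (g : I -> R -> R) :
  (forall i, measurable_fun setT (g i)) ->
  (forall i, P.-integrable setT (fun o => (g i (Z i o))%:E)) ->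
  \int[P]_o (\prod_i g i (Z i o)) = \prod_i \int[P]_o g i (Z i o).
Proof.
suff H n : forall (A : {set I}) (g : I -> R -> R), #|A| = n ->
  (forall i, i \notin A -> forall x, 0 <= g i x) ->
  (forall i, measurable_fun setT (g i)) ->
  (forall i, P.-integrable setT (fun o => (g i (Z i o))%:E)) ->
  \int[P]_o (\prod_i g i (Z i o)) = \prod_i \int[P]_o g i (Z i o).
  by apply: (H _ [set: I]%SET g erefl) => i; rewrite inE.
elim: n => [|n IH] A {}g cA gA mg ig.
  rewrite [LHS]/Rintegral expectation_prod_ge0// => i x; apply: gA.
  by move/eqP: cA; rewrite cards_eq0 => /eqP ->; rewrite inE.
have [s sA] : exists s, s \in A by apply/finset.set0Pn; rewrite -cards_eq0 cA.
pose rep (h : R -> R) i := if i == s then h else g i.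
have reps h o : rep h s (Z s o) = h (Z s o) by rewrite /rep eqxx.
have repi h i o : i != s -> rep h i (Z i o) = g i (Z i o) by move=> /negbTE; rewrite /rep => ->.
have prodE h o : \prod_i rep h i (Z i o) = h (Z s o) * \prod_(i | i != s) g i (Z i o).
  by rewrite (bigD1 s)//= reps; congr (_ * _); apply: eq_bigr => i /repi ->.
pose gp (x : R) : R := Num.max (g s x) 0; pose gm (x : R) : R := Num.max (- g s x) 0.
have step (h : R -> R) : measurable_fun setT h -> (forall x, 0 <= h x) -> (forall x, h x <= `|g s x|) ->
  [/\ P.-integrable setT (fun o => (h (Z s o))%:E),
   P.-integrable setT (fun o => (\prod_i rep h i (Z i o))%:E)
   & \int[P]_o (\prod_i rep h i (Z i o)) =
     (\int[P]_o h (Z s o)) * \prod_(i | i != s) \int[P]_o g i (Z i o)].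
  move=> mh h0 hg.
  have ih : P.-integrable setT (fun o => (h (Z s o))%:E).
    apply: (le_integrable _ _ _ (ig s)) => //.
      by apply/measurable_EFinP; apply: (measurableT_comp mh).
    by move=> o _; rewrite /= lee_fin ger0_norm.
  have mrep i : measurable_fun setT (rep h i) by rewrite /rep; case: ifP.
  have irep i : P.-integrable setT (fun o => (rep h i (Z i o))%:E).
    have [->|si] := eqVneq i s; first by under eq_fun do rewrite reps.
    by under eq_fun do rewrite repi//.
  split => //; first exact: integrable_prod_independent.
  rewrite (IH (A :\ s)%SET)//.
  - rewrite (bigD1 s)//=; congr (_ * _).
      by apply: eq_Rintegral => o _; rewrite reps.
    by apply: eq_bigr => i si; apply: eq_Rintegral => o _; rewrite repi.
  - by move: cA; rewrite (cardsD1 s) sA add1n => -[].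
  - move=> i; rewrite !inE negb_and negbK /rep; case: eqVneq => // _ /= iA; exact: gA.
have mN : measurable_fun setT (fun x => - g s x) by exact: measurableT_comp.
have mp : measurable_fun setT gp by apply: measurable_maxr.
have mm : measurable_fun setT gm by apply: measurable_maxr.
have [| |ip1 ip2 ip3] := step gp mp.
- by move=> x; rewrite /gp le_max lexx orbT.
- by move=> x; rewrite /gp ge_max ler_norm normr_ge0.
have [| |im1 im2 im3] := step gm mm.
- by move=> x; rewrite /gm le_max lexx orbT.
- by move=> x; rewrite /gm ge_max -normrN ler_norm normr_ge0.
have gE x : g s x = gp x - gm x.
  by rewrite /gp /gm; case: (leP (g s x) 0); case: (leP (- g s x) 0); lra.
rewrite (bigD1 s)//=.
rewrite (@eq_Rintegral _ _ _ P setT (fun o => gp (Z s o) - gm (Z s o)) (fun o => g s (Z s o))); last by move=> o _; exact: gE.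
rewrite RintegralB// mulrBl -ip3 -im3 -RintegralB//.
by apply: eq_Rintegral => o _; rewrite !prodE -mulrBl -gE (bigD1 s).
Qed.
End product_expectation.

(** * Normal variables: translation and reflection *)

Section translation.
Context {R : realType}.
Local Open Scope ereal_scope.
Local Notation mu := (@lebesgue_measure R).

Lemma lebesgue_measureD (a : R) (A : set R) : measurable A ->
  pushforward mu ((fun x => x + a)%R : _ -> measurableTypeR R) A = mu A.
Proof.
move=> mA; have mD : measurable_fun setT ((fun x => x + a)%R : _ -> measurableTypeR R).
  by apply: measurable_funD => //; exact: measurable_id.
apply/esym/lebesgue_measure_unique => //= _ [[b c]] _ <-.
rewrite /pushforward/=.
have -> : (fun x => x + a)%R @^-1` `]b, c]%classic = `](b - a)%R, (c - a)%R]%classic.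
  by apply/seteqP; split => x /=; rewrite !in_itv/= ltrBlDr lerBrDr.
rewrite !lebesgue_measure_itv/= !lte_fin ltrD2r; case: ifP => // _.
by rewrite -!EFinB; congr EFin; lra.
Qed.

Lemma ge0_integral_translate (a : R) (f : R -> \bar R) :
  measurable_fun setT f -> (forall x, 0 <= f x) ->
  \int[mu]_x f (x + a)%R = \int[mu]_x f x.
Proof.
move=> mf f0.
have mD : measurable_fun setT ((fun x => x + a)%R : _ -> measurableTypeR R).
  by apply: measurable_funD => //; exact: measurable_id.
transitivity (\int[pushforward mu ((fun x => x + a)%R : _ -> measurableTypeR R)]_x f x).
  by rewrite ge0_integral_pushforward.
by apply: eq_measure_integral => A mA _; exact: lebesgue_measureD.
Qed.

Lemma ge0_integral_reflect (f : R -> \bar R) :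
  measurable_fun setT f -> (forall x, 0 <= f x) ->
  \int[mu]_x f (- x)%R = \int[mu]_x f x.
Proof.
move=> mf f0.
have mD : measurable_fun setT (-%R : _ -> measurableTypeR R).
  exact: (measurable_funN (@measurable_id _ R setT)).
transitivity (\int[pushforward mu (-%R : _ -> measurableTypeR R)]_x f x).
  by rewrite ge0_integral_pushforward.
by apply: eq_measure_integral => A mA _; exact: lebesgue_measureN.
Qed.

End translation.

Section normal_variable.
Context {R : realType} {d : measure_display} {Omega : measurableType d}.
Local Open Scope ereal_scope.
Local Notation mu := (@lebesgue_measure R).
Variables (P : probability Omega R) (w : {RV P >-> R}) (tau : R).
Hypothesis tau0 : tau != 0%R.
Hypothesis w_normal : forall A : set R, measurable A -> distribution P w A = normal_prob 0 tau A.

Lemma ge0_integral_normal (f : R -> \bar R) :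
  measurable_fun setT f -> (forall x, 0 <= f x) ->
  \int[P]_o f (w o) = \int[mu]_x (f x * (normal_pdf 0 tau x)%:E).
Proof.
move=> mf f0; apply: (@ge0_integral_pdf R _ (measurableTypeR R) _ _ P w mu (normal_pdf 0 tau)) => //.
- exact: (measurable_funP w).
- exact: measurable_normal_pdf.
- by move=> x; exact: normal_pdf_ge0.
Qed.

(** The Cameron-Martin formula in dimension one: the exponential is the quotient of
   the normal densities at [x - a] and at [x]. *)
Lemma normal_translate (a : R) (B : set R) : measurable B ->
  P ((fun o => w o + a)%R @^-1` B) =
  \int[P]_o ((\1_B (w o))%:E * (expR (w o * a / tau ^+ 2 - a ^+ 2 / (2 * tau ^+ 2)))%:E).
Proof.
move=> mB.
have mBa : measurable_fun setT (fun x : R => (\1_B (x + a)%R : R)%:E).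
  apply/measurable_EFinP; apply: (measurableT_comp (measurable_indic mB)).
  exact: measurable_funD.
have me : measurable_fun setT (fun x : R => expR (x * a / tau ^+ 2 - a ^+ 2 / (2 * tau ^+ 2))).
  apply: measurableT_comp => //; apply: measurable_funB => //.
  by apply: measurable_funM => //; apply: measurable_funM.
rewrite -integral_indic_preimage//; last exact: measurable_funD.
rewrite (ge0_integral_normal mBa)//.
rewrite (@ge0_integral_normal (fun x => (\1_B x)%:E * (expR (x * a / tau ^+ 2 - a ^+ 2 / (2 * tau ^+ 2)))%:E)); last 2 first.
- by apply: emeasurable_funM; apply/measurable_EFinP => //; exact: measurable_indic.
- by move=> x; rewrite mule_ge0// lee_fin// expR_ge0.
rewrite -(ge0_integral_translate (- a)); last 2 first.
- by apply: emeasurable_funM => //; apply/measurable_EFinP; exact: measurable_normal_pdf.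
- by move=> x; rewrite mule_ge0// lee_fin normal_pdf_ge0.
apply: eq_integral => x _; rewrite subrK -muleA; congr (_ * _).
rewrite -EFinM; congr EFin; rewrite !normal_pdfE// mulrCA; congr (_ * _)%R.
rewrite -expRD /normal_fun; congr expR.
by field.
Qed.

Lemma normal_symmetric (B : set R) : measurable B ->
  P ((fun o => - w o)%R @^-1` B) = \int[P]_o ((\1_B (w o))%:E * (1%R)%:E).
Proof.
move=> mB.
have mBa : measurable_fun setT (fun x : R => (\1_B (- x)%R : R)%:E).
  apply/measurable_EFinP; apply: (measurableT_comp (measurable_indic mB)).
  exact: (measurable_funN (@measurable_id _ R setT)).
under [RHS]eq_integral do rewrite mule1.
rewrite -integral_indic_preimage//; last exact: (measurable_funN (measurable_funP w)).
rewrite (ge0_integral_normal mBa)//.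
rewrite (@ge0_integral_normal (fun x => (\1_B x)%:E)); last 2 first.
- by apply/measurable_EFinP => //; exact: measurable_indic.
- by move=> x; rewrite lee_fin.
rewrite -ge0_integral_reflect; last 2 first.
- by apply: emeasurable_funM => //; apply/measurable_EFinP; exact: measurable_normal_pdf.
- by move=> x; rewrite mule_ge0// lee_fin normal_pdf_ge0.
apply: eq_integral => x _; rewrite opprK; congr (_ * _).
by congr EFin; rewrite !normal_pdfE// /normal_fun !subr0 sqrrN.
Qed.

End normal_variable.

(** * Laws of random vectors *)

Lemma mutually_independent_comp {R : realType} {d : measure_display}
    {Omega : measurableType d} (P : probability Omega R) (I J : finType)
    (Z : I -> {RV P >-> R}) (h : J -> I) : injective h ->
  mutually_independent Z -> mutually_independent (fun j => Z (h j)).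
Proof.
move=> hI Zi A B mB.
pose B' i := if [pick j | h j == i] is Some j then B j else setT.
have B'h j : B' (h j) = B j.
  by rewrite /B'; case: pickP => [k /eqP /hI -> //|/(_ j)]; rewrite eqxx.
have mB' i : measurable (B' i) by rewrite /B'; case: pickP.
have := Zi (h @: A)%SET B' mB'.
rewrite big_imset/=; last by move=> x y _ _; exact: hI.
under eq_bigr do rewrite B'h.
move=> <-; congr (P _); apply/seteqP; split=> o H i /=.
  by move=> /imsetP[j jA ->]; rewrite /= B'h; exact: H.
by move=> iA; have := H (h i); rewrite /= B'h; apply; apply: imset_f.
Qed.

Section vectors.
Context {R : realType} (I : finType).

(** A generating family of the product sigma-algebra that is stable under
   intersection, so that finite measures are determined by their values on it. *)
Definition rectangles : set (set (I -> R)) :=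
  [set S | exists B : I -> set R, (forall i, measurable (B i)) /\
     S = [set x | forall i, B i (x i)]].

Definition vectors : measurableType _ := g_sigma_algebraType rectangles.

Lemma setI_closed_rectangles : setI_closed rectangles.
Proof.
move=> _ _ [B [mB ->]] [B' [mB' ->]]; exists (fun i => B i `&` B' i); split.
  by move=> i; exact: measurableI.
apply/seteqP; split=> x /=; first by move=> [H H'] i; split.
by move=> H; split=> i; case: (H i).
Qed.

Lemma rectangles_setT : rectangles setT.
Proof. by exists (fun=> setT); split=> //; apply/seteqP; split. Qed.

Lemma measurable_coord (i : I) : measurable_fun setT (fun x : vectors => x i : R).
Proof.
move=> _ B mB; rewrite setTI; apply: sub_sigma_algebra.
exists (fun j => if j == i then B else setT); split; first by move=> j; case: ifP.
apply/seteqP; split=> x /=; first by move=> Bx j; case: eqP => // ->.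
by move=> /(_ i); rewrite eqxx.
Qed.

Lemma measurable_to_vectors (d : measure_display) (T : measurableType d)
    (u : T -> I -> R) : (forall i, measurable_fun setT (fun o => u o i)) ->
  measurable_fun setT (u : T -> vectors).
Proof.
move=> mu; apply: (@measurability _ _ T vectors setT u rectangles) => // _ [_ [B [mB ->]] <-].
rewrite setTI (_ : _ @^-1` _ = \bigcap_(i in [set` [set: I]%SET]) ((fun o => u o i) @^-1` B i)).
  apply: fin_bigcap_measurable; first exact: finite_finset.
  by move=> i _; rewrite -[X in measurable X]setTI; exact: mu.
apply/seteqP; split=> o /=; first by move=> H i _; exact: H.
by move=> H i; apply: H; rewrite /= inE.
Qed.

End vectors.

Section density.
Context {R : realType} {d : measure_display} {T : measurableType d}.
Local Open Scope ereal_scope.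
Variables (m : {measure set T -> \bar R}) (H : T -> R).
Hypotheses (mH : measurable_fun setT H) (H0 : forall x, (0 <= H x)%R).

(** The hypotheses on [H] are arguments, as the measure structure attached to
   [density] depends on them. *)
Definition density (mH : measurable_fun setT H) (H0 : forall x, (0 <= H x)%R)
  (A : set T) : \bar R := \int[m]_(x in A) (H x)%:E.

Let density0 : density mH H0 set0 = 0.
Proof. by rewrite /density integral_set0. Qed.

Let density_ge0 A : 0 <= density mH H0 A.
Proof. by apply: integral_ge0 => x _; rewrite lee_fin. Qed.

Let density_sigma_additive : semi_sigma_additive (density mH H0).
Proof.
move=> /= F mF tF mUF; rewrite /density; apply: cvg_toP.
  apply: ereal_nondecreasing_is_cvgn => k n kn.
  apply: lee_sum_nneg_natr => // i _ _.
  by apply: integral_ge0 => x _; rewrite lee_fin.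
rewrite ge0_integral_bigcup//=.
- by apply: measurable_funTS; apply/measurable_EFinP.
- by move=> x _; rewrite lee_fin.
Qed.

HB.instance Definition _ := isMeasure.Build _ _ _
  (density mH H0) density0 density_ge0 density_sigma_additive.

End density.

Section joint_law.
Context {R : realType} {d : measure_display} {Omega : measurableType d}.
Local Open Scope ereal_scope.
Variable P : probability Omega R.
Variables (I : finType) (Z : I -> {RV P >-> R}).
Hypothesis Z_ind : mutually_independent Z.
Variables (t h : I -> R -> R).
Hypotheses (mt : forall i, measurable_fun setT (t i)) (mh : forall i, measurable_fun setT (h i)).
Hypothesis h0 : forall i x, (0 <= h i x)%R.
Hypothesis tE : forall i B, measurable B ->
  P ((fun o => t i (Z i o)) @^-1` B) = \int[P]_o ((\1_B (Z i o))%:E * (h i (Z i o))%:E).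

Let H o : R := (\prod_i h i (Z i o))%R.

Let mH : measurable_fun setT H.
Proof. exact: measurable_prod_RV. Qed.

Let H0 o : (0 <= H o)%R.
Proof. exact: prodr_ge0. Qed.

(** If the transformation [t i] changes the law of [Z i] by the density [h i], then by
   independence the two sides agree on rectangles, hence everywhere. It is applied
   to translations and to reflections. *)
Lemma joint_law (A : set (vectors I)) : measurable A ->
  P ((fun o i => t i (Z i o)) @^-1` A) =
  \int[P]_o ((\1_A (fun i => Z i o))%:E * (\prod_i h i (Z i o))%:E).
Proof.
pose u o : vectors I := fun i => t i (Z i o).
pose v o : vectors I := fun i => Z i o.
have mu : measurable_fun setT u.
  by apply: measurable_to_vectors => i; apply: (measurableT_comp (mt i)).
have mv : measurable_fun setT v by exact: measurable_to_vectors.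
have dE B : measurable B -> pushforward (density P mH H0) v B =
    \int[P]_o ((\1_B (v o))%:E * (H o)%:E).
  move=> mB; rewrite /pushforward /density integral_mkcond.
  apply: eq_integral => o _; rewrite patchE indicE.
  have -> : (o \in v @^-1` B) = (v o \in B) by apply/idP/idP => /set_mem ?; exact/mem_set.
  by case: (_ \in _); rewrite ?mul1e ?mul0e.
have [M1 M1E] : exists M : {measure set (vectors I) -> \bar R}, forall B, M B = P (u @^-1` B).
  by unshelve eexists (pushforward P u : {measure set (vectors I) -> \bar R}).
have [M2 M2E] : exists M : {measure set (vectors I) -> \bar R}, forall B, M B = density P mH H0 (v @^-1` B).
  by unshelve eexists (pushforward (density P mH H0) v : {measure set (vectors I) -> \bar R}).
move=> mA; rewrite -[RHS](dE A)// -[LHS]M1E /pushforward -M2E.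
move: A mA; apply: (@measure_unique _ R (vectors I) (@rectangles R I) (fun=> setT)) => //.
- exact: setI_closed_rectangles.
- by move=> _; exact: rectangles_setT.
- by apply/seteqP; split=> // x _; exists 0%N.
- move=> S rS; have mS : (measurable : set (set (vectors I))) S by exact: sub_sigma_algebra.
  rewrite M1E M2E -[RHS]/(pushforward (density P mH H0) v S)%R dE//; case: rS => B [mB SE].
  have mtB i : measurable (t i @^-1` B i) by rewrite -[X in measurable X]setTI; exact: mt.
  have ig i : P.-integrable setT (fun o => (\1_(B i) (Z i o) * h i (Z i o))%:E).
    apply/integrableP; split.
      apply/measurable_EFinP; apply: measurable_funM.
        exact: (measurableT_comp (measurable_indic (mB i))).
      exact: (measurableT_comp (mh i)).
    rewrite (eq_integral (fun o => (\1_(B i) (Z i o))%:E * (h i (Z i o))%:E)); last first.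
      by move=> o _; rewrite /= ger0_norm ?mulr_ge0// EFinM.
    rewrite -tE//; apply: le_lt_trans (probability_le1 _ _) _; last exact: ltry.
    exact: (measurable_funPTI (Z i) (mtB i)).
  transitivity (\prod_i P (Z i @^-1` (t i @^-1` B i))).
    have := Z_ind [set: I]%SET mtB.
    rewrite (eq_bigl predT); last by move=> i; rewrite inE.
    move=> <-; congr (P _); rewrite SE; apply/seteqP; split=> o /=.
      by move=> oB i _; exact: oB.
    by move=> oB i; apply: oB; rewrite /= inE.
  rewrite (eq_integral (fun o => (\prod_i (\1_(B i) (Z i o) * h i (Z i o)))%:E)); last first.
    move=> o _; rewrite big_split/= EFinM; congr (_ * _); congr EFin.
    rewrite indicE; case: (boolP (v o \in S)) => [|].
      rewrite inE SE => oB; rewrite big1// => i _.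
      by rewrite indicE mem_set//; exact: oB.
    rewrite notin_setE SE => oB.
    have [i nB] : exists i, ~ B i (Z i o).
      apply: contrapT => /forallNP nB; apply: oB => i; apply: contrapT; exact: nB.
    by rewrite (bigD1 i)//= indicE memNset// mul0r.
  rewrite (@expectation_prod_ge0 _ _ _ P I Z Z_ind (fun i x => \1_(B i) x * h i x)%R)//.
  - rewrite -prodEFin; apply: eq_bigr => i _.
    rewrite -/((fun o => t i (Z i o)) @^-1` B i) tE// /Rintegral fineK; last exact: (integrable_fin_num _ (ig i)).
    by apply: eq_integral => o _; rewrite EFinM.
  - by move=> i; apply: measurable_funM => //; exact: measurable_indic.
  - by move=> i x; rewrite mulr_ge0.
- move=> _; rewrite M1E preimage_setT; apply: le_lt_trans (probability_le1 _ _) _ => //.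
  exact: ltry.
Qed.

End joint_law.

(** * The Gaussian mechanism *)

Lemma expR_half_le2 {R : realType} : expR 2^-1 <= 2 :> R.
Proof.
have := expR_ge1Dx (- 2^-1 : R); rewrite expRN => H.
by rewrite -[leRHS]invrK -[leLHS]invrK lef_pV2 ?posrE ?invr_gt0 ?expR_gt0//; lra.
Qed.

Section gaussian_vector.
Context {R : realType} {d : measure_display} {Omega : measurableType d}.
Local Open Scope ereal_scope.
Variable P : probability Omega R.
Variables (I : finType) (w : I -> {RV P >-> R}) (tau : R).
Hypothesis w_ind : mutually_independent w.
Hypothesis tau0 : (0 < tau)%R.
Hypothesis w_normal : forall i (A : set R), measurable A ->
  distribution P (w i) A = normal_prob 0 tau A.

Let tau_neq0 : tau != 0%R. Proof. exact: lt0r_neq0. Qed.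

Definition dot (x y : I -> R) : R := (\sum_i x i * y i)%R.

Let W o : vectors I := fun i => w i o.

Lemma measurable_dot (v : I -> R) : measurable_fun setT (fun x : vectors I => dot x v).
Proof.
apply: measurable_sum => i; apply: measurable_funM => //; exact: measurable_coord.
Qed.

Lemma measurable_W : measurable_fun setT W.
Proof. by apply: measurable_to_vectors => i. Qed.

Lemma measurable_preimage_W A : measurable A -> measurable (W @^-1` A).
Proof. by move=> mA; rewrite -[X in measurable X]setTI; exact: measurable_W. Qed.

Lemma integral_indicW (A : set (vectors I)) : measurable A ->
  \int[P]_o (\1_A (W o) : R)%:E = P (W @^-1` A).
Proof. by move=> mA; exact: (integral_indic_preimage _ measurable_W). Qed.

(** The one-dimensional densities multiply, and their exponents add up to inner
   products. *)
Lemma gaussian_translate (a : I -> R) (A : set (vectors I)) : measurable A ->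
  P ((fun o i => w i o + a i)%R @^-1` A) =
  \int[P]_o ((\1_A (W o))%:E * (expR (dot (W o) a / tau ^+ 2 - dot a a / (2 * tau ^+ 2)))%:E).
Proof.
move=> mA.
rewrite (@joint_law _ _ _ P I w w_ind (fun i x => x + a i)%R
  (fun i x => expR (x * a i / tau ^+ 2 - a i ^+ 2 / (2 * tau ^+ 2))))//.
- apply: eq_integral => o _; congr (_ * _); congr EFin.
  rewrite -expR_sum; congr expR.
  by rewrite /dot !mulr_suml -sumrB; apply: eq_bigr => i _; rewrite expr2.
- by move=> i; exact: measurable_funD.
- move=> i; apply: measurableT_comp => //; apply: measurable_funB => //.
  by apply: measurable_funM => //; apply: measurable_funM.
- by move=> i B mB; exact: (normal_translate tau_neq0 (w_normal i)).
Qed.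

Lemma gaussian_symmetric (A : set (vectors I)) : measurable A ->
  P ((fun o i => - w i o)%R @^-1` A) = P (W @^-1` A).
Proof.
move=> mA; rewrite (@joint_law _ _ _ P I w w_ind (fun i x => - x)%R (fun i x => 1%R))//.
- rewrite -(integral_indicW mA); apply: eq_integral => o _.
  by rewrite big1// mule1.
- by move=> i; exact: (measurable_funN (@measurable_id _ R setT)).
- by move=> i B mB; exact: (normal_symmetric tau_neq0 (w_normal i)).
Qed.

Section direction.
Variable v : I -> R.
Let V := dot v v.
Let halfspace : set (vectors I) := [set x | (0 < dot x v)%R].

Let mhalf : measurable halfspace.
Proof.
rewrite (_ : halfspace = (fun x : vectors I => dot x v) @^-1` `]0%R, +oo[); last first.
  by apply/seteqP; split => x /=; rewrite in_itv/= andbT.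
by rewrite -[X in measurable X]setTI; apply: measurable_dot.
Qed.

Lemma dotNl x : dot (fun i => - x i)%R v = (- dot x v)%R.
Proof. by rewrite /dot -sumrN; apply: eq_bigr => i _; rewrite mulNr. Qed.

Lemma dotDZl x (s : R) : dot (fun i => x i + s * v i)%R v = (dot x v + s * V)%R.
Proof.
by rewrite /V /dot mulr_sumr -big_split/=; apply: eq_bigr => i _; rewrite mulrDl mulrA.
Qed.

(** The half space and its opposite are disjoint and equally likely. *)
Lemma halfspace_le : P (W @^-1` halfspace) <= (2^-1)%:E.
Proof.
have mH := measurable_preimage_W mhalf.
have mN : measurable ((fun o i => - w i o)%R @^-1` halfspace).
  rewrite -[X in measurable X]setTI.
  suff : measurable_fun setT ((fun o i => - w i o)%R : Omega -> vectors I) by apply.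
  by apply: measurable_to_vectors => i; exact: (measurable_funN (measurable_funP (w i))).
have : P (W @^-1` halfspace) + P ((fun o i => - w i o)%R @^-1` halfspace) <= 1.
  rewrite -measureU//; first by apply: probability_le1; exact: measurableU.
  by apply/seteqP; split=> o //= [+]; rewrite /halfspace/= dotNl; lra.
rewrite gaussian_symmetric// -(fineK (fin_num_measure P _ mH)) -EFinD !lee_fin; lra.
Qed.

Lemma dot_self_ge0 : (0 <= V)%R.
Proof. by apply: sumr_ge0 => i _; rewrite -expr2 sqr_ge0. Qed.

(** Translating the half space back to the origin costs the exponential factor;
   the remaining half space has probability at most one half by symmetry. *)
Lemma gaussian_tail (s : R) : (0 <= s)%R ->
  P [set o | (s * V < dot (W o) v)%R] <= (2^-1 * expR (- (s ^+ 2 * V / (2 * tau ^+ 2))))%:E.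
Proof.
move=> s0.
have -> : [set o | (s * V < dot (W o) v)%R] = (fun o i => w i o + - s * v i)%R @^-1` halfspace.
  by apply/seteqP; split => o /=; rewrite /halfspace/= dotDZl mulNr subr_gt0.
rewrite gaussian_translate//.
set a := fun i => (- s * v i)%R.
have dxa x : dot x a = (- s * dot x v)%R.
  by rewrite /dot mulr_sumr; apply: eq_bigr => i _; rewrite /a; ring.
have daa : dot a a = (s ^+ 2 * V)%R.
  by rewrite dxa /a /dot mulr_sumr /V mulr_sumr; apply: eq_bigr => i _; ring.
rewrite daa.
have mind : measurable_fun setT (fun o => (\1_halfspace (W o) : R)%:E).
  by apply/measurable_EFinP; apply: (measurableT_comp (measurable_indic mhalf) measurable_W).
apply: (@le_trans _ _ (\int[P]_o ((\1_halfspace (W o))%:E * (expR (- (s ^+ 2 * V / (2 * tau ^+ 2))))%:E))).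
  apply: le_integral_nonmeasurable => o _; first by rewrite mule_ge0// lee_fin ?expR_ge0.
  rewrite indicE; case: (boolP (W o \in halfspace)) => [|_]; last by rewrite !mul0e.
  rewrite inE => /= xv; rewrite !mul1e lee_fin ler_expR dxa gerDr.
  by rewrite mulNr mulNr oppr_le0 divr_ge0 ?mulr_ge0 ?sqr_ge0// ltW.
rewrite ge0_integralZr//.
by rewrite integral_indicW// EFinM lee_wpmul2r ?halfspace_le// lee_fin expR_ge0.
Qed.

(** The law of [w + v] is compared with that of [w] on the event [E] that the
   logarithm [l] of the density is at most [eps]; the complement of [E] is a half
   space to which the tail bound applies. The squared level of this half space loses
   a term linear in [eps], that is, a factor [expR (1 / 2)] of the probability;
   the factor [1 / 2] of the tail bound compensates for it, which the constant
   [5 / 4] alone would not. *)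
Lemma gaussian_mechanism (eps delta : R) (A : set (vectors I)) :
  (0 < eps < 1)%R -> (0 < delta < 2^-1)%R ->
  (V * (2 * ln (5 / 4 / delta)) <= eps ^+ 2 * tau ^+ 2)%R -> measurable A ->
  P ((fun o i => w i o + v i)%R @^-1` A) <= (expR eps)%:E * P (W @^-1` A) + delta%:E.
Proof.
move=> /andP[e0 e1] /andP[d0 d1] HV mA.
pose l x := (dot x v / tau ^+ 2 - V / (2 * tau ^+ 2))%R.
have ml : measurable_fun setT (l : vectors I -> R).
  apply: measurable_funB => //; apply: measurable_funM => //; exact: measurable_dot.
pose E : set (vectors I) := [set x | (l x <= eps)%R].
have mE : measurable E.
  rewrite (_ : E = (l : vectors I -> R) @^-1` `]-oo, eps]); last first.
    by apply/seteqP; split => x /=; rewrite in_itv.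
  by rewrite -[X in measurable X]setTI; apply: ml.
have mT : measurable_fun setT ((fun o i => w i o + v i)%R : Omega -> vectors I).
  by apply: measurable_to_vectors => i; exact: measurable_funD.
have mTB (B : set (vectors I)) : measurable B -> measurable ((fun o i => w i o + v i)%R @^-1` B).
  by move=> mB; rewrite -[X in measurable X]setTI; apply: mT.
have likely : P ((fun o i => w i o + v i)%R @^-1` (A `&` E)) <= (expR eps)%:E * P (W @^-1` A).
  rewrite gaussian_translate; last exact: measurableI.
  rewrite -integral_indicW// -ge0_integralZl//; last first.
    by apply/measurable_EFinP; apply: (measurableT_comp (measurable_indic mA) measurable_W).
  apply: le_integral_nonmeasurable => o _; first by rewrite mule_ge0// lee_fin ?expR_ge0.
  rewrite indicE; case: (boolP (W o \in _)) => [|_]; last first.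
    by rewrite mul0e mule_ge0// lee_fin expR_ge0.
  rewrite inE => -[Ao Eo]; rewrite mul1e indicE mem_set// mule1 lee_fin ler_expR.
  exact: Eo.
have unlikely : P ((fun o i => w i o + v i)%R @^-1` (~` E)) <= delta%:E.
  have := dot_self_ge0; rewrite le_eqVlt => /predU1P[V0|V0].
    (* For a null shift the density is constant, equal to 1, and [E] is certain. *)
    have v0 i : v i = 0%R.
      have S : (\sum_i v i * v i = 0)%R by exact: esym V0.
      have nn j : predT j -> (0 <= v j * v j)%R by rewrite -expr2 sqr_ge0.
      by have /eqP := @psumr_eq0P _ _ predT _ nn S i erefl; rewrite mulf_eq0 orbb => /eqP.
    rewrite (_ : _ @^-1` _ = set0) ?measure0 ?lee_fin ?ltW//.
    apply/seteqP; split=> o //=; apply; rewrite /E/= /l -V0 mul0r subr0.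
    by rewrite /dot big1 ?mul0r ?ltW// => i _; rewrite v0 mulr0.
  have t2 : (0 < tau ^+ 2)%R by rewrite exprn_gt0.
  pose s := (eps * tau ^+ 2 / V - 2^-1)%R.
  pose L := ln (5 / 4 / delta).
  have dp : (0 < 5 / 4 / delta)%R by rewrite !divr_gt0.
  (* This makes the level [s] nonnegative, as the tail bound requires. *)
  have L12 : (2^-1 <= L)%R.
    rewrite -ler_expR lnK ?posrE//; apply: le_trans expR_half_le2 _.
    by rewrite ler_pdivlMr//; lra.
  have HV' : (V * (2 * L) <= eps ^+ 2 * tau ^+ 2)%R by [].
  have c2 : (2 * L <= eps ^+ 2 * tau ^+ 2 / V)%R by rewrite ler_pdivlMr// mulrC.
  have s0 : (0 <= s)%R.
    rewrite subr_ge0 ler_pdivlMr//; nra.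
  rewrite (_ : _ @^-1` _ = [set o | (s * V < dot (W o) v)%R]); last first.
    have Ve : (s * V = eps * tau ^+ 2 - V / 2)%R by rewrite /s; field; exact: lt0r_neq0.
    have De o : dot (fun i => w i o + v i)%R v = (dot (W o) v + V)%R.
      by rewrite -[V]mul1r -dotDZl; congr dot; apply/funext => i; rewrite mul1r.
    have lE o : (l (fun i => w i o + v i) = (dot (W o) v + V / 2) / tau ^+ 2)%R.
      by rewrite /l De; field.
    apply/seteqP; split=> o /=; rewrite /E/= lE.
      by move=> /negP; rewrite -ltNge ltr_pdivlMr// Ve; lra.
    by rewrite Ve => H; apply/negP; rewrite -ltNge ltr_pdivlMr//; lra.
  apply: le_trans (gaussian_tail s0) _; rewrite lee_fin.
  have sE : (L - 2^-1 <= s ^+ 2 * V / (2 * tau ^+ 2))%R.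
    have -> : (s ^+ 2 * V / (2 * tau ^+ 2) = (eps ^+ 2 * tau ^+ 2 / V - eps + V / (4 * tau ^+ 2)) / 2)%R.
      by rewrite /s; field; rewrite !lt0r_neq0.
    have : (0 <= V / (4 * tau ^+ 2))%R by rewrite divr_ge0 ?mulr_ge0// ltW.
    lra.
  have dE : expR (- L) = (delta * (4 / 5))%R.
    by rewrite expRN lnK ?posrE//; field; rewrite lt0r_neq0.
  apply: (@le_trans _ _ (2^-1 * expR (- L + 2^-1)))%R.
    by rewrite ler_pM2l// ler_expR; lra.
  by rewrite expRD dE; have := @expR_half_le2 R; nra.
rewrite (_ : (fun o i => w i o + v i)%R @^-1` A = ((fun o i => w i o + v i)%R @^-1` (A `&` E)) `|`
   ((fun o i => w i o + v i)%R @^-1` (A `&` ~` E))); last first.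
  by rewrite -preimage_setU -setIUr setUv setIT.
have mAE : measurable (A `&` E) by exact: measurableI.
have mAC : measurable (A `&` ~` E) by apply: measurableI => //; exact: measurableC.
apply: le_trans (measureU2 _ _ _) _; [exact: mTB|exact: mTB|apply: leeD => //].
apply: le_trans unlikely; apply: le_measure; rewrite ?inE; [exact: mTB| |].
  by apply: mTB; exact: measurableC.
by move=> o [].
Qed.
End direction.
End gaussian_vector.

(** * Privacy of the estimator *)

Section privacy.
Context {R : realType} {d : measure_display} {Omega : measurableType d}.
Variable P : probability Omega R.

Lemma measurable_trig_sum K :
  measurable_fun setT (fun u : vectors 'I_K => trig_sum (u : 'I_K -> R) : function_space R).
Proof.
apply: (@measurability _ _ _ (function_space R) setT _ (@evaluation_sets R)) => //.
move=> _ [_ [x [B [xI mB ->]]] <-]; rewrite setTI.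
have mx : measurable_fun setT (fun u : vectors 'I_K => trig_sum (u : 'I_K -> R) x).
  apply: measurable_sum => j; apply: measurable_funM => //; exact: measurable_coord.
have -> : (fun u : vectors 'I_K => trig_sum (u : 'I_K -> R) : function_space R) @^-1` [set g | B (g x)] =
  (fun u : vectors 'I_K => trig_sum (u : 'I_K -> R) x) @^-1` B by [].
by rewrite -[X in measurable X]setTI; exact: mx.
Qed.

Definition empirical_coef n (T : R) (data : 'I_n -> R * R) (j : nat) : R :=
  n%:R^-1 * (\sum_(i < n) (data i).1 * (`|(data i).1| <= T)%R%:R * trig j.+1 (data i).2).

Lemma f_tildeE n K (T : R) (data : 'I_n -> R * R) (w : 'I_K -> R) :
  f_tilde T data w = trig_sum (fun j : 'I_K => w j + empirical_coef T data j).
Proof. by apply/funext => x; apply: eq_bigr => j _; rewrite /theta_tilde addrC. Qed.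

Lemma truncated_sqr_le (T y : R) : (y * (`|y| <= T)%R%:R) ^+ 2 <= T ^+ 2.
Proof.
case: (leP `|y| T) => yT; last by rewrite mulr0 expr0n/= sqr_ge0.
by rewrite mulr1 -(real_normK (num_real y)) lerXn2r// nnegrE (le_trans _ yT).
Qed.

(** A record contributes a multiple, at most [T / n], of the vector of values of
   the basis functions, each of square at most 2; two such contributions differ by
   at most [2 * sqrt 2 * T / n] in each coordinate. *)
Lemma sensitivity n K (T : R) (D D' : 'I_n -> R * R) : (0 < n)%N ->
  (exists i, forall j, j != i -> D j = D' j) ->
  \sum_(j < K) (empirical_coef T D j - empirical_coef T D' j) ^+ 2 <=
  8 * T ^+ 2 * K%:R / n%:R ^+ 2.
Proof.
move=> n0 [i DD'].
have E (j : 'I_K) : empirical_coef T D j - empirical_coef T D' j =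
    n%:R^-1 * ((D i).1 * (`|(D i).1| <= T)%R%:R * trig j.+1 (D i).2 -
               (D' i).1 * (`|(D' i).1| <= T)%R%:R * trig j.+1 (D' i).2).
  rewrite /empirical_coef -mulrBr -sumrB (bigD1 i)//= big1 ?addr0// => k ki.
  by rewrite DD'// subrr.
have -> : 8 * T ^+ 2 * K%:R / n%:R ^+ 2 = \sum_(j < K) (8 * T ^+ 2 / n%:R ^+ 2).
  by rewrite sumr_const card_ord -[RHS]mulr_natr; field; rewrite pnatr_eq0 -lt0n.
apply: ler_sum => j _; rewrite E exprMn exprVn mulrC ler_wpM2r ?invr_ge0 ?sqr_ge0//.
have := truncated_sqr_le T (D i).1; have := truncated_sqr_le T (D' i).1.
set y := (D i).1 * _; set y' := (D' i).1 * _.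
have := trig_sqr_le2 j.+1 (D i).2; have := trig_sqr_le2 j.+1 (D' i).2.
set p := trig _ _; set q := trig _ _ => p2 q2 y2 y2'.
have H1 : (y * q) ^+ 2 <= T ^+ 2 * 2 by rewrite exprMn ler_pM ?sqr_ge0.
have H2 : (y' * p) ^+ 2 <= T ^+ 2 * 2 by rewrite exprMn ler_pM ?sqr_ge0.
have := sqr_ge0 (y * q + y' * p); move: H1 H2; set a := y * q; set b := y' * p; nra.
Qed.

Lemma ln_inv_delta_gt0 (delta : R) : 0 < delta < 2^-1 -> 0 < ln (5 / 4 / delta).
Proof. by move=> /andP[d0 d1]; rewrite ln_gt0// ltr_pdivlMr//; lra. Qed.

Lemma noise_sd_sqr n K (T eps delta : R) : 0 < delta < 2^-1 ->
  noise_sd n K T eps delta ^+ 2 =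
  16 * T ^+ 2 * K%:R * ln (5 / 4 / delta) / (n%:R ^+ 2 * eps ^+ 2).
Proof.
move=> /ln_inv_delta_gt0 L0; rewrite sqr_sqrtr//.
apply: divr_ge0; last by apply: mulr_ge0; exact: sqr_ge0.
by apply: mulr_ge0 (ltW L0); apply: mulr_ge0 => //; apply: mulr_ge0 => //; exact: sqr_ge0.
Qed.

Lemma noise_sd_gt0 n K (T eps delta : R) : (0 < n)%N -> (0 < K)%N -> 0 < T -> 0 < eps ->
  0 < delta < 2^-1 -> 0 < noise_sd n K T eps delta.
Proof.
move=> n0 K0 T0 e0 /ln_inv_delta_gt0 L0.
by rewrite sqrtr_gt0 divr_gt0 ?mulr_gt0 ?exprn_gt0 ?ltr0n.
Qed.

(** The estimator is a measurable function of the noisy coefficients, and replacing a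
   record amounts to translating the noise by [v]. The factor 16 in the variance of
   the noise is the 8 of the sensitivity times the 2 of the Gaussian mechanism. *)
Theorem estimator_private n K (T eps delta : R) (w : 'I_K -> {RV P >-> R}) :
  (0 < n)%N -> (0 < K)%N -> 0 < T -> 0 < eps < 1 -> 0 < delta < 2^-1 ->
  mutually_independent w ->
  (forall j (A : set R), measurable A ->
     distribution P (w j) A = normal_prob 0 (noise_sd n K T eps delta) A) ->
  differentially_private P (fun z : R * R => z.2 \in `[0, 1])
    (fun (data : 'I_n -> R * R) omega =>
       f_tilde T data (fun j => w j omega) : function_space R) eps delta.
Proof.
move=> n0 K0 T0 e01 d01 w_ind w_normal.
have /andP[e0 e1] := e01.
have tau0 := noise_sd_gt0 n0 K0 T0 e0 d01.
have ME (D : 'I_n -> R * R) o : f_tilde T D (fun j => w j o) =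
  trig_sum (fun j : 'I_K => w j o + empirical_coef T D j) by exact: f_tildeE.
split.
  move=> D _; rewrite (_ : (fun _ => _) = (fun u : vectors 'I_K => trig_sum (u : 'I_K -> R) : function_space R) \o
     (fun o j => w j o + empirical_coef T D j)); last by apply/funext => o; rewrite ME.
  apply: (measurableT_comp (@measurable_trig_sum K)).
  by apply: measurable_to_vectors => j; exact: measurable_funD.
move=> D D' _ _ DD' S mS.
pose shift (x : vectors 'I_K) : vectors 'I_K := fun j => x j + empirical_coef T D' j.
have mshift : measurable_fun setT shift.
  by apply: measurable_to_vectors => j; apply: measurable_funD => //; exact: measurable_coord.
pose A : set (vectors 'I_K) :=
  ((fun u : vectors 'I_K => trig_sum (u : 'I_K -> R) : function_space R) \o shift) @^-1` S.
have mA : measurable A.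
  by rewrite -[X in measurable X]setTI; apply: (measurableT_comp (@measurable_trig_sum K) mshift).
pose v (j : 'I_K) := empirical_coef T D j - empirical_coef T D' j.
have vle : dot v v * (2 * ln (5 / 4 / delta)) <= eps ^+ 2 * noise_sd n K T eps delta ^+ 2.
  rewrite noise_sd_sqr//.
  have := sensitivity K T n0 DD'.
  rewrite (_ : \sum_(j < K) _ = dot v v); last by apply: eq_bigr => j _; rewrite expr2.
  have L0 := ltW (ln_inv_delta_gt0 d01); move=> /(ler_wpM2r L0) H.
  have {}H := ler_wpM2l (ltW (ltr0Sn R 1)) H.
  rewrite mulrCA; apply: le_trans H _.
  rewrite le_eqVlt; apply/orP; left; apply/eqP; field.
  by rewrite lt0r_neq0// pnatr_eq0 -lt0n n0.
have -> : (fun o => f_tilde T D (fun j => w j o) : function_space R) =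
    (fun o => trig_sum (shift (fun j => w j o + v j)) : function_space R).
  apply/funext => o; rewrite ME; congr trig_sum; apply/funext => j.
  by rewrite /shift /v -addrA subrK.
have -> : (fun o => f_tilde T D' (fun j => w j o) : function_space R) =
    (fun o => trig_sum (shift (fun j => w j o)) : function_space R).
  by apply/funext => o; rewrite ME.
exact: (gaussian_mechanism w_ind tau0 w_normal e01 d01 vle mA).
Qed.
End privacy.

(** * Moments and tails of normal variables *)

Section normal_moments.
Context {R : realType} {d : measure_display} {Omega : measurableType d}.
Local Open Scope ereal_scope.
Variables (P : probability Omega R) (w : {RV P >-> R}) (tau : R).
Hypothesis tau0 : (0 < tau)%R.
Hypothesis w_normal : forall A : set R, measurable A -> distribution P w A = normal_prob 0 tau A.

Let tau_neq0 : tau != 0%R. Proof. exact: lt0r_neq0. Qed.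

(** The density in the translation formula has total mass 1. *)
Lemma normal_mgf (a : R) :
  \int[P]_o (expR (w o * a / tau ^+ 2))%:E = (expR (a ^+ 2 / (2 * tau ^+ 2)))%:E.
Proof.
have := normal_translate tau_neq0 w_normal a measurableT.
rewrite preimage_setT probability_setT => H.
have me : measurable_fun setT (fun o => (expR (w o * a / tau ^+ 2))%:E).
  apply/measurable_EFinP; apply: measurableT_comp => //.
  by apply: measurable_funM => //; exact: measurable_funM.
rewrite -[RHS]mule1 H -ge0_integralZl//.
- apply: eq_integral => o _; rewrite indicT mul1e -EFinM -expRD; congr (expR _)%:E; lra.
- apply: emeasurable_funM; apply/measurable_EFinP; first exact: measurableT_comp.
  apply: measurableT_comp => //; apply: measurable_funB => //.
  by apply: measurable_funM => //; exact: measurable_funM.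
Qed.

Lemma sqr_le_expR (x : R) : (x ^+ 2 <= 4 * (expR x + expR (- x)))%R.
Proof.
have H (y : R) : (0 <= y -> y ^+ 2 <= 4 * expR y)%R.
  move=> y0; have -> : y = (y / 2 + y / 2)%R by lra.
  by rewrite expRD; have := expR_ge1Dx (y / 2); nra.
have := expR_ge0 x; have := expR_ge0 (- x).
have [x0|x0] := leP 0%R x; first by have := H x x0; lra.
have /H : (0 <= - x)%R by lra.
by rewrite sqrrN; lra.
Qed.

(** Only the order of magnitude matters, and the square is at most a multiple of two
   exponentials with known means. *)
Lemma normal_second_moment : \int[P]_o (w o ^+ 2)%:E <= (16 * tau ^+ 2)%:E.
Proof.
have me (s : R) : measurable_fun setT (fun o => (expR (w o * s / tau ^+ 2))%:E).
  apply/measurable_EFinP; apply: measurableT_comp => //.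
  by apply: measurable_funM => //; exact: measurable_funM.
have mgf s : (s ^+ 2 = tau ^+ 2)%R -> \int[P]_o (expR (w o * s / tau ^+ 2))%:E = (expR 2^-1)%:E.
  by move=> s2; rewrite normal_mgf s2; congr (expR _)%:E; field.
apply: (@le_trans _ _ (\int[P]_o ((4 * tau ^+ 2)%:E * ((expR (w o * tau / tau ^+ 2))%:E + (expR (w o * - tau / tau ^+ 2))%:E)))).
  apply: le_integral_nonmeasurable => o _; first by rewrite lee_fin sqr_ge0.
  rewrite -EFinD -EFinM lee_fin.
  have -> : (w o * tau / tau ^+ 2 = w o / tau)%R by field.
  have -> : (w o * - tau / tau ^+ 2 = - (w o / tau))%R by field.
  have := sqr_le_expR (w o / tau); rewrite expr_div_n ler_pdivrMr ?exprn_gt0//.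
  by set e := (expR _ + expR _)%R; move: (tau ^+ 2)%R (w o ^+ 2)%R e => t2 w2 e; nra.
rewrite ge0_integralZl//; last 3 first.
- by apply: emeasurable_funD; exact: me.
- by move=> o _; rewrite -EFinD lee_fin addr_ge0 ?expR_ge0.
- by rewrite lee_fin mulr_ge0// sqr_ge0.
rewrite ge0_integralD//; try exact: me.
rewrite !mgf ?sqrrN// -EFinD -EFinM lee_fin.
have t2 : (0 < tau ^+ 2)%R by exact: exprn_gt0.
by have := @expR_half_le2 R; nra.
Qed.

Lemma normal_integrable_sqr : P.-integrable setT (fun o => (w o ^+ 2)%:E).
Proof.
apply/integrableP; split; first by apply/measurable_EFinP; exact: measurable_funX.
rewrite (eq_integral (fun o => (w o ^+ 2)%:E)); last by move=> o _; rewrite /= ger0_norm// sqr_ge0.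
by apply: le_lt_trans normal_second_moment _; exact: ltry.
Qed.

Lemma normal_integrable : P.-integrable setT (fun o => (w o)%:E).
Proof.
have i1 : P.-integrable setT (fun o => (w o ^+ 2 + 1)%:E).
  apply: eq_integrable (integrableD measurableT normal_integrable_sqr (finite_measure_integrable_cst P 1 measurableT)) => //.
apply: (le_integrable _ _ _ i1) => //; first exact/measurable_EFinP.
move=> o _; rewrite /= lee_fin [leRHS]ger0_norm ?addr_ge0 ?sqr_ge0//.
by rewrite -(real_normK (num_real (w o))); have := sqr_ge0 (`|w o| - 1)%R; have := normr_ge0 (w o); nra.
Qed.

Lemma normal_mean0 : (\int[P]_o w o)%R = 0%R.
Proof.
have fin := integrable_fin_num _ normal_integrable.
rewrite /Rintegral integralE.
have mx : measurable_fun setT (fun x : R => x%:E) by exact/measurable_EFinP.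
have -> : \int[P]_o ((fun o => (w o)%:E)^\+ o) = \int[P]_o ((fun o => (w o)%:E)^\- o).
  pose p (x : R) := maxe x%:E 0; pose n (x : R) := maxe (- x%:E) 0.
  have mp : measurable_fun setT p by apply: measurable_maxe.
  have mn : measurable_fun setT n by apply: measurable_maxe => //; exact: measurableT_comp.
  have p0 x : 0 <= p x by rewrite /p le_max lexx orbT.
  have n0 x : 0 <= n x by rewrite /n le_max lexx orbT.
  transitivity (\int[P]_o p (w o)); first by apply: eq_integral => o _; rewrite funeposE.
  transitivity (\int[P]_o n (w o)); last by apply: eq_integral => o _; rewrite funenegE.
  rewrite (ge0_integral_normal w_normal mp p0) (ge0_integral_normal w_normal mn n0).
  rewrite -ge0_integral_reflect; first last.
  - by move=> x; rewrite mule_ge0// lee_fin normal_pdf_ge0.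
  - apply: emeasurable_funM => //.
    by apply/measurable_EFinP; exact: measurable_normal_pdf.
  apply: eq_integral => x _; congr (_ * _).
  by congr EFin; rewrite !normal_pdfE// /normal_fun !subr0 sqrrN.
rewrite subee//.
have := integrable_neg_fin_num _ normal_integrable; exact.
Qed.

(** Translating a half line to the origin costs a density that is at most the
   exponential there. *)
Lemma normal_tail (L : R) : (0 <= L)%R ->
  P [set o | (L < `|w o|)%R] <= (2 * expR (- (L ^+ 2 / (2 * tau ^+ 2))))%:E.
Proof.
move=> L0.
have t2 : (0 < tau ^+ 2)%R by rewrite exprn_gt0.
have half (s : R) (B : set R) : measurable B -> (s ^+ 2 = L ^+ 2)%R ->
    (forall x, B x -> x * s <= 0)%R ->
    P ((fun o => w o + s)%R @^-1` B) <= (expR (- (L ^+ 2 / (2 * tau ^+ 2))))%:E.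
  move=> mB s2 Bs; rewrite (normal_translate tau_neq0 w_normal)//.
  apply: (@le_trans _ _ (\int[P]_o cst (expR (- (L ^+ 2 / (2 * tau ^+ 2))))%:E o)).
    apply: le_integral_nonmeasurable => o _; first by rewrite mule_ge0// lee_fin expR_ge0.
    rewrite indicE; case: (boolP (w o \in B)) => [|_]; last by rewrite mul0e lee_fin expR_ge0.
    rewrite inE => /Bs ws; rewrite mul1e lee_fin ler_expR s2 gerDr.
    by rewrite pmulr_lle0// invr_gt0.
  by rewrite integral_cst//=  [P setT]probability_setT mule1.
have mset (s : R) (B : set R) : measurable B -> measurable ((fun o => w o + s)%R @^-1` B).
  by move=> mB; rewrite -[X in measurable X]setTI; apply: measurable_funD.
have -> : [set o | (L < `|w o|)%R] =
    ((fun o => w o + - L)%R @^-1` `]0%R, +oo[%classic) `|` ((fun o => w o + L)%R @^-1` `]-oo, 0%R[%classic).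
  apply/seteqP; split => o /=; rewrite !in_itv/= ?andbT subr_gt0 lter_normr.
    by move=> /orP[H|H]; [left|right; lra].
  by move=> [H|H]; apply/orP; [left|right; lra].
apply: le_trans (measureU2 _ _ _) _; [exact: mset|exact: mset|].
rewrite mulr2n mulrDl mul1r EFinD; apply: leeD; apply: half => //.
- by rewrite sqrrN.
- by move=> x /=; rewrite in_itv/= andbT => x0; nra.
- by move=> x /=; rewrite in_itv/= => x0; nra.
Qed.

End normal_moments.

(** * Uniform variables and averages *)

Section uniform_variable.
Context {R : realType} {d : measure_display} {Omega : measurableType d}.
Local Notation mu := (@lebesgue_measure R).
Local Notation I01 := (`[0%R, 1%R]%classic : set R).
Variables (P : probability Omega R) (X : {RV P >-> R}).
Hypothesis X_uniform : forall A : set R, measurable A ->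
  distribution P X A = uniform_prob (@ltr01 R) A.

Lemma ge0_integral_uniform (f : R -> \bar R) :
  measurable_fun setT f -> (forall x, 0 <= f x)%E ->
  (\int[P]_o f (X o) = \int[mu]_(x in I01) f x)%E.
Proof.
move=> mf f0; rewrite (@ge0_integral_pdf R _ (measurableTypeR R) _ _ P X mu (uniform_pdf 0 1))//.
- rewrite [RHS]integral_mkcond; apply: eq_integral => x _.
  rewrite patchE mem_setE in_itv/= /uniform_pdf; case: ifP => _; last by rewrite mule0.
  by rewrite subr0 invr1 mule1.
- exact: (measurable_funP X).
- exact: measurable_uniform_pdf.
- by move=> x; exact: uniform_pdf_ge0.
Qed.

Lemma uniform_mean (g : R -> R) (M : R) : measurable_fun setT g ->
  (forall x, `|g x| <= M) ->
  P.-integrable setT (fun o => (g (X o))%:E) /\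
  \int[P]_o g (X o) = \int[mu]_(x in I01) g x.
Proof.
move=> mg gM; have M0 : 0 <= M by apply: le_trans (gM 0).
have ig : P.-integrable setT (fun o => (g (X o))%:E).
  apply: (le_integrable _ _ _ (finite_measure_integrable_cst P M measurableT)) => //.
    by apply/measurable_EFinP; exact: (measurableT_comp mg).
  by move=> o _; rewrite /= lee_fin [leRHS]ger0_norm.
split => //.
have ig' : mu.-integrable I01 (EFin \o g).
  by apply: (@bounded_integrable01 _ _ M) => //; exact: measurable_funTS.
have iM : mu.-integrable I01 (EFin \o (fun=> M)).
  by apply: (@bounded_integrable01 _ _ M) => // x _; rewrite ger0_norm.
have H : \int[P]_o (g (X o) + M) = \int[mu]_(x in I01) (g x + M).
  congr fine; rewrite (@ge0_integral_uniform (fun x => (g x + M)%:E))//.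
    by apply/measurable_EFinP; exact: measurable_funD.
  by move=> x; rewrite lee_fin; have := gM x; rewrite ler_norml; lra.
move: H; rewrite RintegralD//; last exact: finite_measure_integrable_cst.
by rewrite RintegralD// !Rintegral_cst//= probability_setT mu_I01; exact: addIr.
Qed.

Lemma uniform_ae : P [set o | X o \notin `[0, 1]] = 0%E.
Proof.
have mC : measurable (~` I01) by apply: measurableC; exact: measurable_itv.
have E0 : (\int[P]_o (\1_(~` I01) (X o) : R)%:E = 0)%E.
  rewrite (@ge0_integral_uniform (fun x => (\1_(~` I01) x)%:E))//.
    by rewrite integral0_eq// => x Ix; rewrite indicE memNset//=; exact.
  by apply/measurable_EFinP; exact: measurable_indic.
rewrite (_ : [set o | _] = X @^-1` (~` I01)); last first.
  by apply/seteqP; split => o /= /negP.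
by rewrite -E0 integral_indic_preimage.
Qed.

End uniform_variable.

Section averages.
Context {R : realType} {d : measure_display} {Omega : measurableType d}.
Variable P : probability Omega R.

(** Without the cross terms, a square of [n] terms leaves [n] terms out of [n ^ 2]. *)
Lemma mean_square_average n (s : 'I_n -> Omega -> R) (M : R) : (0 < n)%N ->
  (forall i, measurable_fun setT (s i)) ->
  (forall i, P.-integrable setT (fun o => (s i o ^+ 2)%:E)) ->
  (forall i, \int[P]_o (s i o ^+ 2) <= M) ->
  (forall i k, i != k -> \int[P]_o (s i o * s k o) = 0) ->
  (\int[P]_o ((n%:R^-1 * \sum_(i < n) s i o) ^+ 2)%:E <= (M / n%:R)%:E)%E.
Proof.
move=> n0 ms is2 sM s0.
have n0' : n%:R != 0 :> R by rewrite pnatr_eq0 -lt0n.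
have iss i k : P.-integrable setT (fun o => (s i o * s k o)%:E).
  have iD : P.-integrable setT (fun o => (s i o ^+ 2 + s k o ^+ 2)%:E).
    exact: eq_integrable (integrableD measurableT (is2 i) (is2 k)).
  apply: (le_integrable _ _ _ iD) => //.
    by apply/measurable_EFinP; exact: measurable_funM.
  move=> o _; rewrite /= lee_fin [leRHS]ger0_norm ?addr_ge0 ?sqr_ge0//.
  rewrite ler_norml; apply/andP; split.
    by have := sqr_ge0 (s i o + s k o); have := sqr_ge0 (s i o); have := sqr_ge0 (s k o); nra.
  by have := sqr_ge0 (s i o - s k o); have := sqr_ge0 (s i o); have := sqr_ge0 (s k o); nra.
have -> : (\int[P]_o ((n%:R^-1 * \sum_(i < n) s i o) ^+ 2)%:E =
    \int[P]_o ((n%:R ^- 2)%:E * \sum_(i < n) \sum_(k < n) (s i o * s k o)%:E))%E.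
  apply: eq_integral => o _; rewrite exprMn exprVn EFinM; congr (_ * _)%E.
  rewrite expr2 mulr_suml -sumEFin; apply: eq_bigr => i _.
  by rewrite mulr_sumr -sumEFin.
have isum i : P.-integrable setT (fun o => \sum_(k < n) (s i o * s k o)%:E)%E.
  by apply: integrable_sum => // k _; exact: iss.
rewrite integralZl//; last by apply: integrable_sum => // i _; exact: isum.
rewrite integral_sum//.
have -> : (\sum_(i < n) \int[P]_o \sum_(k < n) (s i o * s k o)%:E =
    (\sum_(i < n) \int[P]_o (s i o ^+ 2)%R)%R%:E)%E.
  rewrite -sumEFin; apply: eq_bigr => i _.
  rewrite integral_sum// (bigD1 i)//= big1 ?adde0; last first.
    move=> k ki; rewrite -(@fineK _ (\int[P]_o _)%E); last exact: (integrable_fin_num _ (iss i k)).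
    by rewrite -/(Rintegral _ _ _) s0// eq_sym.
  by rewrite /Rintegral fineK//; exact: (integrable_fin_num _ (is2 i)).
rewrite -EFinM lee_fin.
have H : \sum_(i < n) \int[P]_o (s i o ^+ 2) <= n%:R * M.
  apply: (@le_trans _ _ (\sum_(i < n) M)); first by apply: ler_sum => i _.
  by rewrite sumr_const card_ord mulr_natl.
apply: (@le_trans _ _ (n%:R ^- 2 * (n%:R * M))).
  by rewrite ler_wpM2l// invr_ge0 sqr_ge0.
by rewrite le_eqVlt; apply/orP; left; apply/eqP; field.
Qed.

Lemma product_uncorrelated (I : finType) (Z : I -> {RV P >-> R}) (x x' y y' : I)
    (p q : R -> R) : mutually_independent Z -> uniq [:: x; x'; y; y'] ->
  measurable_fun setT p -> measurable_fun setT q ->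
  (forall s, s \in [:: x; x'] -> P.-integrable setT (fun o => (p (Z s o))%:E)) ->
  (forall s, s \in [:: y; y'] -> P.-integrable setT (fun o => (q (Z s o))%:E)) ->
  (\int[P]_o p (Z x o)) * (\int[P]_o q (Z y o)) = 0 ->
  \int[P]_o (p (Z x o) * q (Z y o) * (p (Z x' o) * q (Z y' o))) = 0.
Proof.
move=> indZ un mp mq ip_ iq E0.
(* The first boolean selects the function [p] or [q], the second one the variable. *)
pose h (c : bool * bool) := if c.1 then (if c.2 then x else x') else (if c.2 then y else y').
have hI : injective h.
  move: un; rewrite /= !inE !negb_or => /and4P[/and3P[/eqP a /eqP b /eqP e] /andP[/eqP f /eqP g] /eqP k _].
  by case=> [[] []] [[] []]; rewrite /h/= => //; try (move=> H; exfalso; congruence); move=> /esym H; exfalso; congruence.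
have indh := mutually_independent_comp hI indZ.
pose g (c : bool * bool) := if c.1 then p else q.
have := expectation_prod indh (g := g).
have big4 (F : bool * bool -> R) : \prod_c F c = F (true, true) * F (true, false) * (F (false, true) * F (false, false)).
  by rewrite (eq_bigr (fun c => F (c.1, c.2))) -?(pair_bigA _ (fun a b => F (a, b)))/= ?big_bool//= ?big_bool// => -[].
rewrite (@eq_Rintegral _ _ _ P setT (fun o => p (Z x o) * q (Z y o) * (p (Z x' o) * q (Z y' o)))
  (fun o => \prod_c g c (Z (h c) o))); last by move=> o _; rewrite big4 /g /h/=; ring.
move=> ->.
- rewrite big4 /g /h/=; move: E0; set a := Rintegral _ _ _; set b := Rintegral _ _ _ => E0.
  by rewrite mulrACA E0 mul0r.
- by case=> -[].
- by move=> [[] []]; rewrite /g/h/=; [apply: ip_|apply: ip_|apply: iq|apply: iq]; rewrite !inE eqxx ?orbT.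
Qed.

End averages.

(** * The error on one coefficient *)

Section deterministic.
Context {R : realType}.

Lemma sobolev_L2 alpha (C : R) (f : R -> R) : sobolev_class alpha C f -> L2 f.
Proof.
move=> [D [dD HC _]]; have [LD _] := sobolev_sqr_le dD HC.
by apply: eq_L2 (derivs_L2 dD LD (leq0n _)); case: dD.
Qed.

Lemma coef_sqr_le (f : R -> R) (r : R) j : L2 f ->
  (forall x, x \in `[0, 1] -> `|f x| <= r) -> coef f j.+1 ^+ 2 <= r ^+ 2.
Proof.
move=> Lf fr.
apply: (@le_trans _ _ (ip f f)).
  apply: le_trans (Bessel j.+1 Lf); rewrite big_ord_recr/= lerDr.
  by apply: sumr_ge0 => i _; exact: sqr_ge0.
apply: (@le_trans _ _ (\int[lebesgue_measure]_(x in `[0%R, 1%R]%classic) (r ^+ 2))).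
  apply: le_Rintegral => //; first exact: L2M.
    by apply: L2_integrable; apply: continuous_L2; exact: cst_continuous.
  move=> x Ix; rewrite -expr2 -(real_normK (num_real (f x))).
  by rewrite lerXn2r ?nnegrE ?fr// (le_trans _ (fr x Ix)).
by rewrite Rintegral_cst//= mu_I01/= mulr1.
Qed.

Lemma sqr_average_le n (z : 'I_n -> R) (M : R) : (0 < n)%N ->
  (forall i, z i ^+ 2 <= M) -> (n%:R^-1 * \sum_(i < n) z i) ^+ 2 <= M.
Proof.
move=> n0 zM; set m := n%:R^-1 * _.
have n0' : 0 < n%:R :> R by rewrite ltr0n.
have : 0 <= \sum_(i < n) (z i - m) ^+ 2 by apply: sumr_ge0 => i _; exact: sqr_ge0.
have -> : \sum_(i < n) (z i - m) ^+ 2 = \sum_(i < n) z i ^+ 2 - n%:R * m ^+ 2.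
  under eq_bigr do rewrite sqrrB.
  rewrite !big_split/= sumr_const card_ord sumrN -mulr_natl.
  have -> : \sum_(i < n) z i * m *+ 2 = (\sum_(i < n) z i) * m * 2.
    by rewrite !mulr_suml; apply: eq_bigr => i _; rewrite mulr_natr.
  have -> : \sum_(i < n) z i = n%:R * m by rewrite /m mulVKf// lt0r_neq0.
  ring.
have : \sum_(i < n) z i ^+ 2 <= n%:R * M.
  apply: (@le_trans _ _ (\sum_(i < n) M)); first exact: ler_sum.
  by rewrite sumr_const card_ord mulr_natl.
move=> H1 H2; have : n%:R * m ^+ 2 <= n%:R * M by lra.
by rewrite ler_pM2l.
Qed.

Lemma sqrD_le (x y : R) : (x + y) ^+ 2 <= 2 * x ^+ 2 + 2 * y ^+ 2.
Proof. by have := sqr_ge0 (x - y); nra. Qed.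

(** On the event that no error exceeds [L] the truncation at [r + L] is inactive
   and the error splits into a design part and a noise part; otherwise it is
   bounded by the truncation level. *)
Lemma truncated_error_le n (r L T c : R) (x xi : 'I_n -> R) (f : R -> R) (j : nat) (w : R) :
  (0 < n)%N -> 0 <= r -> 0 <= L -> (forall i, `|f (x i)| <= r) -> c ^+ 2 <= r ^+ 2 ->
  T = r + L ->
  (w + empirical_coef T (fun i => (f (x i) + xi i, x i)) j - c) ^+ 2 <=
  4 * (n%:R^-1 * \sum_(i < n) (f (x i) * trig j.+1 (x i) - c)) ^+ 2 +
  4 * (n%:R^-1 * \sum_(i < n) (trig j.+1 (x i) * xi i)) ^+ 2 +
  2 * w ^+ 2 + 16 * T ^+ 2 * \sum_(i < n) (L < `|xi i|)%R%:R.
Proof.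
move=> n0 r0 L0 fr cr TE; set a := empirical_coef _ _ _.
set U := n%:R^-1 * \sum_(i < n) (f (x i) * trig j.+1 (x i) - c).
set V := n%:R^-1 * \sum_(i < n) (trig j.+1 (x i) * xi i).
set N := \sum_(i < n) _.
have N0 : 0 <= N by apply: sumr_ge0.
have n0' : n%:R != 0 :> R by rewrite pnatr_eq0 -lt0n.
suff H : (a - c) ^+ 2 <= 2 * U ^+ 2 + 2 * V ^+ 2 + 8 * T ^+ 2 * N.
  rewrite -addrA; apply: le_trans (sqrD_le _ _) _; rewrite -mulrA in H *; lra.
have T0 : 0 <= T by rewrite TE addr_ge0.
have rT : r ^+ 2 <= T ^+ 2 by rewrite lerXn2r ?nnegrE// TE lerDl.
have [small|] := pselect (forall i, `|xi i| <= L).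
  have -> : a - c = U + V.
    rewrite /U /V /a /empirical_coef sumrB sumr_const card_ord -[c *+ n]mulr_natl mulrBr mulKf//.
    rewrite (_ : \sum_(i < n) (f (x i) + xi i) * _ * _ =
      \sum_(i < n) f (x i) * trig j.+1 (x i) + \sum_(i < n) trig j.+1 (x i) * xi i); first by ring.
    rewrite -big_split/=; apply: eq_bigr => i _.
    have -> : `|f (x i) + xi i| <= T by rewrite TE; apply: le_trans (ler_normD _ _) (lerD (fr i) (small i)).
    by rewrite mulr1; ring.
  apply: le_trans (sqrD_le _ _) _; rewrite lerDl.
  by apply: mulr_ge0 => //; apply: mulr_ge0 => //; exact: sqr_ge0.
move=> /existsNP[k /negP]; rewrite -ltNge => xik.
have N1 : 1 <= N by rewrite /N (bigD1 k)//= xik lerDl; apply: sumr_ge0.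
have a2 : a ^+ 2 <= T ^+ 2 * 2.
  apply: sqr_average_le => // i /=; rewrite exprMn ler_pM ?sqr_ge0//.
    exact: truncated_sqr_le.
  exact: trig_sqr_le2.
apply: le_trans (sqrD_le _ _) _; rewrite sqrrN.
have U2 := sqr_ge0 U; have V2 := sqr_ge0 V; have T2 := sqr_ge0 T.
have TN : 8 * T ^+ 2 * 1 <= 8 * T ^+ 2 * N by rewrite ler_wpM2l// mulr_ge0.
lra.
Qed.
End deterministic.

(** * The risk *)

(** The terms bound the contributions of the random design, of the errors, of the
   privacy noise and of the event that some error exceeds [L]. *)
Definition coefficient_rate {R : realType} (n : nat) (r sigma tau L T : R) : R :=
  24 * r ^+ 2 / n%:R + 128 * sigma ^+ 2 / n%:R + 32 * tau ^+ 2 +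
  32 * T ^+ 2 * n%:R * expR (- (L ^+ 2 / (2 * sigma ^+ 2))).

Section risk.
Context {R : realType} {d : measure_display} {Omega : measurableType d}.
Local Notation mu := (@lebesgue_measure R).
Local Notation I01 := (`[0%R, 1%R]%classic : set R).
Variables (P : probability Omega R) (n K : nat) (sigma tau : R).
Variables (X xi : 'I_n -> {RV P >-> R}) (w : 'I_K -> {RV P >-> R}).
Hypotheses (n0 : (0 < n)%N) (sigma0 : 0 < sigma) (tau0 : 0 < tau).
Hypothesis model : regression_model sigma tau X xi w.

Let Z (s : 'I_n + 'I_n + 'I_K) : {RV P >-> R} :=
  match s with inl (inl i) => X i | inl (inr i) => xi i | inr j => w j end.

Let Z_ind : mutually_independent Z. Proof. by case: model. Qed.
Let X_uniform i (A : set R) : measurable A -> distribution P (X i) A = uniform_prob (@ltr01 R) A.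
Proof. by case: model => H _ _ _; exact: H. Qed.
Let xi_normal i (A : set R) : measurable A -> distribution P (xi i) A = normal_prob 0 sigma A.
Proof. by case: model => _ H _ _; exact: H. Qed.
Let w_normal j (A : set R) : measurable A -> distribution P (w j) A = normal_prob 0 tau A.
Proof. by case: model => _ _ H _; exact: H. Qed.

(** Covers the two averages that make up the error of a coefficient: [q] is 1 for the
   design part, and [p] is a basis function and [q] the identity for the part of the
   errors. *)
Lemma average_product (p q : R -> R) (B : R) (M : R) :
  measurable_fun setT p -> (forall x, `|p x| <= B) -> measurable_fun setT q ->
  (forall i, P.-integrable setT (fun o => (q (xi i o) ^+ 2)%:E)) ->
  (forall i, P.-integrable setT (fun o => (q (xi i o))%:E)) ->
  (forall i, \int[P]_o ((p (X i o) * q (xi i o)) ^+ 2) <= M) ->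
  (forall i, \int[P]_o p (X i o) * \int[P]_o q (xi i o) = 0) ->
  (\int[P]_o ((n%:R^-1 * \sum_(i < n) p (X i o) * q (xi i o)) ^+ 2)%:E <= (M / n%:R)%:E)%E.
Proof.
move=> mp pB mq iq2 iq sM E0.
have mpX i : measurable_fun setT (fun o => p (X i o)) by exact: (measurableT_comp mp).
have mqx i : measurable_fun setT (fun o => q (xi i o)) by exact: (measurableT_comp mq).
have B0 : 0 <= B by apply: le_trans (pB 0).
apply: (@mean_square_average _ _ _ P n (fun i o => p (X i o) * q (xi i o)) M n0) => //.
- by move=> i; exact: measurable_funM.
- move=> i.
  apply: (le_integrable _ _ _ (integrableZl measurableT (B ^+ 2) (iq2 i))) => //.
    by apply/measurable_EFinP; apply: measurable_funX; exact: measurable_funM.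
  have p2 x : p x ^+ 2 <= B ^+ 2.
    by rewrite -(real_normK (num_real (p x))) lerXn2r ?nnegrE.
  move=> o _; rewrite -EFinM /= lee_fin [leLHS]ger0_norm ?sqr_ge0//.
  have BQ : 0 <= B ^+ 2 * q (xi i o) ^+ 2 by apply: mulr_ge0; exact: sqr_ge0.
  by rewrite [leRHS]ger0_norm// exprMn ler_wpM2r ?sqr_ge0.
- move=> i k ik.
  have ne (a b : 'I_n + 'I_n + 'I_K) : a <> b -> (a == b) = false by move/eqP/negbTE.
  apply: (@product_uncorrelated _ _ _ P _ Z (inl (inl i)) (inl (inl k)) (inl (inr i)) (inl (inr k))) => //.
  + rewrite /= !inE !ne//; first by move=> [H]; rewrite H eqxx in ik.
    by move=> [H]; rewrite H eqxx in ik.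
  + move=> s; rewrite !inE => /orP[] /eqP ->/=; exact: (uniform_mean (@X_uniform _) mp pB).1.
  + by move=> s; rewrite !inE => /orP[] /eqP ->/=.
  + exact: E0.
Qed.

Section one_function.
Variables (f : R -> R) (r : R).
Hypotheses (Lf : L2 f) (fr : forall x, x \in `[0, 1] -> `|f x| <= r).

(* Outside the unit interval [f] may even fail to be measurable. *)
Let f0 := f \_ I01.

Let r0 : 0 <= r.
Proof. by apply: le_trans (fr (x := 0) _); rewrite // in_itv/= lexx ler01. Qed.

Let mf0 : measurable_fun setT f0.
Proof. by apply/(measurable_restrictT _ _).1; [exact: measurable_itv|case: Lf]. Qed.

Let f0r x : `|f0 x| <= r.
Proof. by rewrite /f0 patchE; case: ifP => [|_]; [rewrite inE; exact: fr|rewrite normr0]. Qed.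

Let f0f x : x \in `[0, 1] -> f0 x = f x.
Proof. by move=> xI; rewrite /f0 patchE mem_set. Qed.

Let mtrig j : measurable_fun setT (@trig R j).
Proof. by apply: continuous_measurable_fun; exact: continuous_trig. Qed.

Let trig2 j (x : R) : `|trig j x| <= 2.
Proof.
have := trig_sqr_le2 j x; rewrite -(real_normK (num_real (trig j x))) => H.
by have := normr_ge0 (trig j x); nra.
Qed.

Let design j x := f0 x * trig j.+1 x - coef f j.+1.

Lemma design_average j :
  (\int[P]_o ((n%:R^-1 * \sum_(i < n) design j (X i o)) ^+ 2)%:E <= (6 * r ^+ 2 / n%:R)%:E)%E.
Proof.
have md : measurable_fun setT (design j).
  by apply: measurable_funB => //; exact: measurable_funM.
have db x : `|design j x| <= r * 2 + `|coef f j.+1|.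
  by apply: le_trans (ler_normB _ _) _; rewrite lerD2r normrM ler_pM.
have d2 x : design j x ^+ 2 <= 6 * r ^+ 2.
  apply: le_trans (sqrD_le _ _) _; rewrite sqrrN exprMn.
  have := coef_sqr_le j Lf fr; have : f0 x ^+ 2 * trig j.+1 x ^+ 2 <= r ^+ 2 * 2.
    rewrite ler_pM ?sqr_ge0 ?trig_sqr_le2// -(real_normK (num_real (f0 x))).
    by rewrite lerXn2r ?nnegrE.
  lra.
have := @average_product (design j) (fun=> 1) _ (6 * r ^+ 2) md db.
under eq_integral do under eq_bigr do rewrite mulr1.
apply=> //.
- by move=> i; rewrite expr1n; exact: finite_measure_integrable_cst.
- by move=> i; exact: finite_measure_integrable_cst.
- move=> i; apply: (@le_trans _ _ (\int[P]_o (6 * r ^+ 2))).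
    apply: le_Rintegral => //.
    + apply: (le_integrable _ _ _ (finite_measure_integrable_cst P (6 * r ^+ 2) measurableT)) => //.
        apply/measurable_EFinP; apply: measurable_funX; apply: measurable_funM => //.
        exact: (measurableT_comp md).
      move=> o _; rewrite /= mulr1 lee_fin ger0_norm ?sqr_ge0//; apply: le_trans (ler_norm _); exact: d2.
    + exact: finite_measure_integrable_cst.
    + by move=> o _; rewrite mulr1.
  by rewrite Rintegral_cst//= probability_setT mulr1.
- move=> i; have [_ ->] := uniform_mean (@X_uniform i) md db.
  have Lt := @L2_trig R j.+1.
  have Lc : L2 (fun=> coef f j.+1) by apply: continuous_L2; exact: cst_continuous.
  rewrite (@eq_Rintegral _ _ _ mu I01 (fun x => f x * trig j.+1 x - coef f j.+1)); last first.
    by move=> x; rewrite inE => xI; rewrite /design f0f.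
  rewrite RintegralB//; [|exact: L2M|exact: L2_integrable].
  by rewrite Rintegral_cst//= mu_I01/= mulr1 subrr mul0r.
Qed.

Lemma noise_average j :
  (\int[P]_o ((n%:R^-1 * \sum_(i < n) trig j.+1 (X i o) * xi i o) ^+ 2)%:E <=
   (32 * sigma ^+ 2 / n%:R)%:E)%E.
Proof.
have ix i : P.-integrable setT (fun o => (xi i o ^+ 2)%:E) := normal_integrable_sqr sigma0 (@xi_normal i).
have ix1 i : P.-integrable setT (fun o => (xi i o)%:E) := normal_integrable sigma0 (@xi_normal i).
apply: (@average_product (trig j.+1) id 2 (32 * sigma ^+ 2)) => //.
- move=> i; apply: (@le_trans _ _ (2 * \int[P]_o (xi i o ^+ 2))).
    rewrite -RintegralZl//; last exact: ix.
    apply: le_Rintegral => //.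
    + apply: (le_integrable _ _ _ (integrableZl measurableT 2 (ix i))) => //.
        apply/measurable_EFinP; apply: measurable_funX; apply: measurable_funM => //.
        exact: (measurableT_comp (mtrig j.+1)).
      move=> o _; rewrite -EFinM /= lee_fin ger0_norm ?sqr_ge0//.
      by apply: le_trans (ler_norm _); rewrite exprMn ler_wpM2r ?sqr_ge0// trig_sqr_le2.
    + by apply: eq_integrable (integrableZl measurableT 2 (ix i)) => // o _; rewrite /= EFinM.
    + by move=> o _; rewrite exprMn ler_wpM2r ?sqr_ge0// trig_sqr_le2.
  have := normal_second_moment sigma0 (@xi_normal i).
  by rewrite -(fineK (integrable_fin_num measurableT (ix i))) lee_fin -/(Rintegral _ _ _); lra.
- by move=> i; rewrite (normal_mean0 sigma0 (@xi_normal i)) mulr0.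
Qed.

Let coefficient_bound (L T : R) (j : 'I_K) o : R :=
  4 * (n%:R^-1 * \sum_(i < n) design j (X i o)) ^+ 2 +
  4 * (n%:R^-1 * \sum_(i < n) (trig j.+1 (X i o) * xi i o)) ^+ 2 +
  2 * w j o ^+ 2 + 16 * T ^+ 2 * \sum_(i < n) (L < `|xi i o|)%R%:R.

Let msum (F : 'I_n -> Omega -> R) : (forall i, measurable_fun setT (F i)) ->
  measurable_fun setT (fun o => 4 * (n%:R^-1 * \sum_(i < n) F i o) ^+ 2).
Proof.
move=> mF; apply: measurable_funM => //; apply: measurable_funX; apply: measurable_funM => //.
exact: measurable_sum.
Qed.

Let mdesign j : measurable_fun setT (design j).
Proof. by apply: measurable_funB => //; exact: measurable_funM. Qed.

Let m1 (j : 'I_K) : measurable_fun setT (fun o => 4 * (n%:R^-1 * \sum_(i < n) design j (X i o)) ^+ 2).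
Proof. by apply: msum => i; apply: (measurableT_comp (mdesign j)). Qed.

Let m2 (j : 'I_K) : measurable_fun setT (fun o => 4 * (n%:R^-1 * \sum_(i < n) (trig j.+1 (X i o) * xi i o)) ^+ 2).
Proof. by apply: msum => i; apply: measurable_funM => //; apply: (measurableT_comp (mtrig j.+1)). Qed.

Let m3 (j : 'I_K) : measurable_fun setT (fun o => 2 * w j o ^+ 2).
Proof. by apply: measurable_funM => //; exact: measurable_funX. Qed.

Let mset (L : R) i : measurable [set o | L < `|xi i o|].
Proof.
rewrite (_ : [set _ | _] = (fun o => `|xi i o|) @^-1` `]L, +oo[%classic); last first.
  by apply/seteqP; split => o /=; rewrite in_itv/= andbT.
by rewrite -[X in measurable X]setTI; apply: measurableT_comp.
Qed.

Let indicE_gt (L : R) i o : (L < `|xi i o|)%R%:R = \1_[set o | L < `|xi i o|] o :> R.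
Proof. by rewrite indicE mem_setE. Qed.

Let mind (L : R) i : measurable_fun setT (fun o => (L < `|xi i o|)%R%:R : R).
Proof.
have -> : (fun o => (L < `|xi i o|)%R%:R : R) = \1_[set o | L < `|xi i o|].
  by apply/funext => o; exact: indicE_gt.
exact: measurable_indic.
Qed.

Let m4 (L T : R) : measurable_fun setT (fun o => 16 * T ^+ 2 * \sum_(i < n) (L < `|xi i o|)%R%:R).
Proof. by apply: measurable_funM => //; exact: measurable_sum. Qed.

Let tails_ge0 (L T : R) o : 0 <= 16 * T ^+ 2 * \sum_(i < n) (L < `|xi i o|)%R%:R.
Proof. by apply: mulr_ge0; [apply: mulr_ge0 => //; exact: sqr_ge0|exact: sumr_ge0]. Qed.

Let coefficient_bound_ge0 L T j o : 0 <= coefficient_bound L T j o.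
Proof.
have sq4 (x c : R) : 0 <= c -> 0 <= c * x ^+ 2 by move=> c0; rewrite mulr_ge0// sqr_ge0.
by rewrite addr_ge0// addr_ge0 ?sq4// addr_ge0 ?sq4.
Qed.

Let mcoefficient_bound L T j : measurable_fun setT (coefficient_bound L T j).
Proof.
by apply: measurable_funD => //; apply: measurable_funD => //; apply: measurable_funD.
Qed.

Lemma coefficient_risk (L T : R) j : 0 <= L ->
  (\int[P]_o (coefficient_bound L T j o)%:E <= (coefficient_rate n r sigma tau L T)%:E)%E.
Proof.
move=> L0; rewrite /coefficient_bound.
have sq4 (x c : R) : 0 <= c -> 0 <= c * x ^+ 2 by move=> c0; rewrite mulr_ge0// sqr_ge0.
under eq_integral do rewrite !EFinD.
have pull (F : Omega -> R) (c M : R) : 0 <= c -> measurable_fun setT (fun o => F o ^+ 2) ->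
    (\int[P]_o (F o ^+ 2)%:E <= M%:E)%E -> (\int[P]_o (c * F o ^+ 2)%:E <= (c * M)%:E)%E.
  move=> c0 mF FM; under eq_integral do rewrite EFinM.
  rewrite ge0_integralZl//; last 2 first.
  - exact/measurable_EFinP.
  - by move=> o _; rewrite lee_fin sqr_ge0.
  by rewrite EFinM lee_wpmul2l ?lee_fin.
have em (F : Omega -> R) : measurable_fun setT F -> measurable_fun setT (fun o => (F o)%:E).
  by move=> mF; exact/measurable_EFinP.
have m12 := emeasurable_funD (em _ (m1 j)) (em _ (m2 j)).
have m123 := emeasurable_funD m12 (em _ (m3 j)).
rewrite ge0_integralD//; last 3 first.
- by move=> o _; rewrite -!EFinD lee_fin !addr_ge0 ?sq4.
- by move=> o _; rewrite lee_fin.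
- exact: em.
rewrite ge0_integralD//; last 3 first.
- by move=> o _; rewrite -!EFinD lee_fin !addr_ge0 ?sq4.
- by move=> o _; rewrite lee_fin sq4.
- exact: em.
rewrite ge0_integralD//; last 4 first.
- by move=> o _; rewrite lee_fin sq4.
- exact: em.
- by move=> o _; rewrite lee_fin sq4.
- exact: em.
rewrite /coefficient_rate !EFinD; apply: leeD; [apply: leeD; [apply: leeD|]|].
- rewrite (_ : 24 * _ / _ = 4 * (6 * r ^+ 2 / n%:R)); last by rewrite !mulrA; congr (_ / _); lra.
  apply: pull (design_average j) => //.
  apply: measurable_funX; apply: measurable_funM => //; apply: measurable_sum => i.
  exact: (measurableT_comp (mdesign j)).
- rewrite (_ : 128 * _ / _ = 4 * (32 * sigma ^+ 2 / n%:R)); last by rewrite !mulrA; congr (_ / _); lra.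
  apply: pull (noise_average j) => //.
  apply: measurable_funX; apply: measurable_funM => //; apply: measurable_sum => i.
  by apply: measurable_funM => //; exact: (measurableT_comp (mtrig j.+1)).
- rewrite (_ : 32 * _ = 2 * (16 * tau ^+ 2)); last by lra.
  by apply: pull (normal_second_moment tau0 (@w_normal j)) => //; exact: measurable_funX.
under eq_integral do rewrite EFinM.
have T2 : 0 <= 16 * T ^+ 2 by rewrite mulr_ge0// sqr_ge0.
rewrite ge0_integralZl//; last 2 first.
- by apply: em; exact: measurable_sum.
- by move=> o _; rewrite lee_fin; exact: sumr_ge0.
set t := expR _.
rewrite (_ : 32 * _ * _ * _ = 16 * T ^+ 2 * (n%:R * (2 * t))); last by ring.
rewrite [leRHS]EFinM lee_wpmul2l ?lee_fin//.
under eq_integral do rewrite -sumEFin.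
rewrite ge0_integral_sum//; last by move=> i; exact: em.
apply: (@le_trans _ _ (\sum_(i < n) (2 * t)%:E)%E).
  apply: lee_sum => i _; under eq_integral do rewrite indicE_gt.
  rewrite integral_indic ?setIT//; exact: (normal_tail sigma0 (@xi_normal i)).
by rewrite sumEFin lee_fin sumr_const card_ord -[leLHS]mulr_natl.
Qed.

Lemma inner_risk (data : 'I_n -> R * R) (T : R) (v : 'I_K -> R) :
  (\int[mu]_(x in I01) ((f_tilde T data v x - f x) ^+ 2)%:E =
   (\sum_(j < K) (theta_tilde T data v j - coef f j.+1) ^+ 2 +
    ip (fun x => trig_proj K f x - f x) (fun x => trig_proj K f x - f x))%:E)%E.
Proof.
rewrite ip_proj_resid// -ip_trig_sumB//.
have Lh : L2 (fun x => trig_sum (theta_tilde T data v) x - f x).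
  by apply: L2B => //; exact: L2_trig_sum.
rewrite /ip /Rintegral fineK; last exact: integrable_fin_num (L2M Lh Lh).
by apply: eq_integral => x _; rewrite expr2.
Qed.

(** The bound on the error of a coefficient holds when the design points lie in the unit
   interval, which is almost sure. *)
Theorem risk_bound (L T bias : R) : 0 <= L -> T = r + L ->
  ip (fun x => trig_proj K f x - f x) (fun x => trig_proj K f x - f x) <= bias ->
  (\int[P]_o \int[mu]_(x in I01)
     ((f_tilde T (fun i => (f (X i o) + xi i o, X i o)) (fun j => w j o) x - f x) ^+ 2)%:E <=
   (K%:R * coefficient_rate n r sigma tau L T + bias)%:E)%E.
Proof.
move=> L0 TE biasP.
have b0 : 0 <= bias by apply: le_trans biasP; exact: ip_ge0.
under eq_integral do rewrite inner_risk.
pose outside i := [set o | X i o \notin `[0, 1]].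
have moutside i : measurable (outside i).
  rewrite (_ : outside i = X i @^-1` (~` I01)).
    by apply: measurable_funPTI; apply: measurableC; exact: measurable_itv.
  by apply/seteqP; split => o /= /negP.
(* The integrand is not known to be measurable, so the null event cannot be dropped
   from the integral. It is dominated everywhere by a measurable function instead,
   through a penalty that is infinite on the null event. *)
pose pen i : Omega -> \bar R := (cst +oo%E) \_ (outside i).
have pen0 i o : (0 <= pen i o)%E by rewrite /pen patchE; case: ifP => _ //=; exact: leey.
have mpen i : measurable_fun setT (pen i).
  by apply/(measurable_restrictT _ (moutside i)).1.
have int_pen i : (\int[P]_o pen i o = 0)%E.
  have Pz : P (outside i) = 0%E by exact: (uniform_ae (@X_uniform i)).
  by rewrite -integral_mkcond integral_cst//= Pz mule0.
pose B o := \sum_(j < K) coefficient_bound L T j o + bias.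
have mS : measurable_fun setT (fun o => (\sum_(j < K) (coefficient_bound L T j o)%:E)%E).
  by apply: emeasurable_sum => j; exact/measurable_EFinP.
have mB : measurable_fun setT (fun o => (B o)%:E).
  by apply/measurable_EFinP; apply: measurable_funD => //; exact: measurable_sum.
have B0 o : 0 <= B o by rewrite addr_ge0// sumr_ge0.
apply: (@le_trans _ _ (\int[P]_o ((B o)%:E + \sum_(i < n) pen i o))%E).
  apply: le_integral_nonmeasurable => o _.
    by rewrite lee_fin addr_ge0 ?ip_ge0// sumr_ge0// => j _; exact: sqr_ge0.
  have [good|] := pselect (forall i, X i o \in `[0, 1]).
    have -> : (\sum_(i < n) pen i o = 0)%E.
      apply: big1 => i _; have no : ~ outside i o by rewrite /outside/= good.
      by rewrite /pen patchE memNset.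
    rewrite adde0.
    rewrite lee_fin lerD//; apply: ler_sum => j _.
    have := @truncated_error_le R n r L T (coef f j.+1) (fun i => X i o) (fun i => xi i o) f0 j (w j o) n0 r0 L0 _ (coef_sqr_le j Lf fr) TE.
    rewrite -/(coefficient_bound _ _ _ _) => H; apply: le_trans (H _) => //.
    rewrite le_eqVlt; apply/orP; left; apply/eqP; congr ((_ - _) ^+ 2).
    rewrite /theta_tilde addrC; congr (_ + _ * _); apply: eq_bigr => i _ /=.
    by rewrite f0f.
  move=> /existsNP[i Xi]; rewrite (bigD1 i)//= {1}/pen patchE mem_set; last by apply/negP.
  have s0 : (0 <= \sum_(k < n | k != i) pen k o)%E by apply: sume_ge0.
  by rewrite /= addye ?gt_eqF ?(lt_le_trans _ s0)// addey// leey.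
rewrite ge0_integralD//; last 3 first.
- by move=> o _; rewrite lee_fin.
- by move=> o _; exact: sume_ge0.
- exact: emeasurable_sum.
rewrite ge0_integral_sum// big1 ?adde0//.
under eq_integral do rewrite EFinD -sumEFin.
rewrite ge0_integralD//; last by move=> o _; apply: sume_ge0 => j _; rewrite lee_fin.
rewrite ge0_integral_sum//; last 2 first.
- by move=> j; exact/measurable_EFinP.
- by move=> j o _; rewrite lee_fin.
rewrite integral_cst//= probability_setT mule1 EFinD leeD2r//.
apply: (@le_trans _ _ (\sum_(j < K) (coefficient_rate n r sigma tau L T)%:E)%E).
  by apply: lee_sum => j _; exact: coefficient_risk.
by rewrite sumEFin lee_fin sumr_const card_ord mulr_natl.
Qed.

End one_function.
End risk.

(** * Rates *)

Section rates.
Context {R : realType}.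

Lemma ln2_ge_half : 2^-1 <= ln 2 :> R.
Proof. by rewrite -ler_expR lnK ?posrE// expR_half_le2. Qed.

Lemma truncn_half_le (y : R) : y / 2 <= (maxn 1 (Num.truncn y))%:R.
Proof.
have [y1|y1] := leP 1 y.
  have t1 : (1 <= Num.truncn y)%N by rewrite -[1%N](@truncn1 R) le_truncn.
  have := truncnS_gt y; rewrite -natr1.
  have : 1 <= (Num.truncn y)%:R :> R by rewrite (ler_nat _ 1).
  by rewrite (maxn_idPr t1); lra.
apply: (@le_trans _ _ 1); first by lra.
by rewrite (ler_nat _ 1) leq_maxl.
Qed.

Section cutoff.
Variables (n alpha : nat) (c1 eps : R).
Hypotheses (n2 : (2 <= n)%N) (ne1 : 1 <= n%:R * eps) (c10 : 0 < c1) (c11 : c1 <= 1).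
Let K : R := (cutoff n alpha c1 eps)%:R.
Let N1 : R := n%:R `^ (1 / (2 * alpha%:R + 1)).
Let N2 : R := (n%:R * eps) `^ (1 / (alpha%:R + 1)).

Let n_ge1 : 1 <= n%:R :> R. Proof. by rewrite (ler_nat _ 1) ltnW. Qed.
Let n_gt0 : 0 < n%:R :> R. Proof. exact: lt_le_trans n_ge1. Qed.
Let ne_gt0 : 0 < n%:R * eps. Proof. exact: lt_le_trans ne1. Qed.
Let a2_neq0 : 2 * alpha%:R + 1 != 0 :> R.
Proof. by rewrite lt0r_neq0// ltr_pwDr// mulr_ge0. Qed.
Let a1_neq0 : alpha%:R + 1 != 0 :> R.
Proof. by rewrite lt0r_neq0// ltr_pwDr. Qed.

Let N1_ge1 : 1 <= N1.
Proof. by rewrite -(powRr0 n%:R) ler_powR// divr_ge0// addr_ge0// mulr_ge0. Qed.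

Let N2_ge1 : 1 <= N2.
Proof. by rewrite -(powRr0 (n%:R * eps)) ler_powR// divr_ge0// addr_ge0. Qed.

Lemma cutoff_ge1 : (0 < cutoff n alpha c1 eps)%N.
Proof. by rewrite /cutoff leq_maxl. Qed.

Let K_gt0 : 0 < K. Proof. by rewrite ltr0n cutoff_ge1. Qed.

Let minN_ge1 : 1 <= Num.min N1 N2. Proof. by rewrite le_min N1_ge1. Qed.

Let K_le : K <= Num.min N1 N2.
Proof.
rewrite /K /cutoff natr_max ge_max minN_ge1/=.
apply: (@le_trans _ _ (c1 * Num.min N1 N2)); last by rewrite ler_piMl// ltW// (lt_le_trans _ minN_ge1).
by rewrite truncn_le// mulr_ge0// ltW// (lt_le_trans _ minN_ge1).
Qed.

Let K_ge : c1 / 2 * Num.min N1 N2 <= K.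
Proof. by have := truncn_half_le (c1 * Num.min N1 N2); rewrite -/N1 -/N2 mulrAC. Qed.

Lemma cutoff_div_le : K / n%:R <= n%:R `^ (- (2 * alpha%:R / (2 * alpha%:R + 1))).
Proof.
have -> : - (2 * alpha%:R / (2 * alpha%:R + 1)) = 1 / (2 * alpha%:R + 1) + -1 :> R by field.
rewrite powRD; last by rewrite (lt0r_neq0 n_gt0) implybT.
rewrite powR_inv1 ?(ltW n_gt0)// ler_pM2r ?invr_gt0//.
by apply: le_trans K_le _; rewrite ge_min lexx.
Qed.

Lemma cutoff_sqr_div_le : K ^+ 2 / (n%:R * eps) ^+ 2 <=
  (n%:R * eps) `^ (- (2 * alpha%:R / (alpha%:R + 1))).
Proof.
have -> : - (2 * alpha%:R / (alpha%:R + 1)) = 1 / (alpha%:R + 1) * 2 + - 2 :> R by field.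
rewrite powRD; last by rewrite (lt0r_neq0 ne_gt0) implybT.
rewrite powRrM powRN !powR_mulrn ?powR_ge0 ?(ltW ne_gt0)//.
rewrite ler_pM2r ?invr_gt0 ?exprn_gt0// lerXn2r ?nnegrE ?powR_ge0 ?(ltW K_gt0)//.
by apply: le_trans K_le _; rewrite ge_min lexx orbT.
Qed.

(** Up to the constant [c1 / 2], whose 2 accounts for rounding, [K] is the minimum of two
   quantities, and a negative power of a minimum is at most the sum of the powers. *)
Lemma cutoff_bias_le : (K ^+ (2 * alpha))^-1 <= (2 / c1) ^+ (2 * alpha) *
  (n%:R `^ (- (2 * alpha%:R / (2 * alpha%:R + 1))) +
   (n%:R * eps) `^ (- (2 * alpha%:R / (alpha%:R + 1)))).
Proof.
have -> : - (2 * alpha%:R / (2 * alpha%:R + 1)) = 1 / (2 * alpha%:R + 1) * - (2 * alpha)%:R :> R.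
  by rewrite natrM; field.
have -> : - (2 * alpha%:R / (alpha%:R + 1)) = 1 / (alpha%:R + 1) * - (2 * alpha)%:R :> R.
  by rewrite natrM; field.
rewrite (powRrM _ (1 / (2 * alpha%:R + 1))) (powRrM _ (1 / (alpha%:R + 1))) -/N1 -/N2 !powRN !powR_mulrn ?powR_ge0//.
set m := (2 * alpha)%N.
have mN : 0 < Num.min N1 N2 by exact: lt_le_trans minN_ge1.
apply: (@le_trans _ _ ((c1 / 2 * Num.min N1 N2) ^+ m)^-1).
  rewrite lef_pV2 ?posrE ?exprn_gt0 ?mulr_gt0 ?divr_gt0// lerXn2r ?nnegrE ?mulr_ge0 ?divr_ge0 ?(ltW K_gt0) ?(ltW mN) ?(ltW c10)//.
rewrite exprMn invfM -exprVn invf_div ler_pM2l ?exprn_gt0 ?divr_gt0//.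
have N1p : 0 <= (N1 ^+ m)^-1 by rewrite invr_ge0 exprn_ge0// powR_ge0.
have N2p : 0 <= (N2 ^+ m)^-1 by rewrite invr_ge0 exprn_ge0// powR_ge0.
by rewrite /Num.min; case: ifP => _; rewrite ?lerDl ?lerDr.
Qed.

End cutoff.

End rates.

Section total_rate.
Context {R : realType}.
Variables (n alpha : nat) (c1 C r sigma sigma_hi eps delta : R).
Hypotheses (n2 : (2 <= n)%N) (c10 : 0 < c1) (c11 : c1 <= 1) (sigma0 : 0 < sigma)
  (sigma_le : sigma <= sigma_hi)
  (e0 : 0 < eps) (ne1 : 1 <= n%:R * eps) (d01 : 0 < delta < 2^-1).

Let T := truncation_level n r sigma.
Let L := 2 * sigma * Num.sqrt (2 * ln n%:R).
Let K := cutoff n alpha c1 eps.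
Let tau := noise_sd n K T eps delta.

(** The first two terms come from the design and the errors, and the third one from
   the privacy noise, with 1024, and the truncation, with 32, as [T ^ 2] is at most
   [(4 * r ^ 2 + 16 * sigma_hi ^ 2) * ln n]. The bias has no logarithmic factor, but
   [ln n * ln (1 / delta)] is at least [1 / 4], whence the 4 of the last term. *)
Definition rate_constant : R :=
  24 * r ^+ 2 + 128 * sigma_hi ^+ 2 + 1056 * (4 * r ^+ 2 + 16 * sigma_hi ^+ 2) +
  4 * C ^+ 2 * (2 / c1) ^+ (2 * alpha).

Let n_ge2 : 2 <= n%:R :> R. Proof. by rewrite ler_nat. Qed.
Let n_gt0 : 0 < n%:R :> R. Proof. exact: lt_le_trans n_ge2. Qed.
Let l := ln n%:R : R.
Let D := ln (1 / delta) : R.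

Let l_ge : 2^-1 <= l.
Proof. by apply: le_trans ln2_ge_half _; rewrite ler_ln ?posrE. Qed.

Let d0 : 0 < delta. Proof. by case/andP: d01. Qed.

Let inv_delta : 2 <= 1 / delta.
Proof. by rewrite ler_pdivlMr//; case/andP: d01 => _ ?; lra. Qed.

Let D_ge : 2^-1 <= D.
Proof. by apply: le_trans ln2_ge_half _; rewrite ler_ln ?posrE// divr_gt0. Qed.

Let l_le : l <= n%:R.
Proof. by rewrite -ler_expR lnK ?posrE//; have := expR_ge1Dx (n%:R : R); lra. Qed.

Let L_sqr : L ^+ 2 = 8 * sigma ^+ 2 * l.
Proof.
rewrite /L exprMn sqr_sqrtr; last by rewrite mulr_ge0//; exact: le_trans l_ge.
by rewrite /l; ring.
Qed.

Let log_le : ln (5 / 4 / delta) <= 2 * D.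
Proof.
have d1 : 0 < 1 / delta by rewrite divr_gt0.
rewrite (_ : 2 * D = D + D); last by ring.
rewrite /D -lnM ?posrE// ler_ln ?posrE ?mulr_gt0 ?invr_gt0//.
by move: inv_delta d1; rewrite div1r; set x := delta^-1; nra.
Qed.

Let cT := 4 * r ^+ 2 + 16 * sigma_hi ^+ 2.

Let cT_ge0 : 0 <= cT.
Proof. by rewrite addr_ge0// mulr_ge0// sqr_ge0. Qed.

Let s2 : sigma ^+ 2 <= sigma_hi ^+ 2.
Proof. by rewrite lerXn2r ?nnegrE// ltW// (lt_le_trans sigma0). Qed.

Let T_sqr : T ^+ 2 <= cT * l.
Proof.
have := sqrD_le r L; rewrite -[r + L]/T L_sqr /cT.
have := sqr_ge0 r; have : sigma ^+ 2 * l <= sigma_hi ^+ 2 * l by rewrite ler_wpM2r// (le_trans _ l_ge).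
by move: l_ge; move: (r ^+ 2) (T ^+ 2) => r2 t2; nra.
Qed.

(* The level [L] is chosen for this power to absorb [n] and [T ^ 2]. *)
Let exp_tail : expR (- (L ^+ 2 / (2 * sigma ^+ 2))) = (n%:R ^+ 4)^-1.
Proof.
have -> : L ^+ 2 / (2 * sigma ^+ 2) = l * 4%:R.
  by rewrite L_sqr; field; exact: lt0r_neq0.
by rewrite expRN expRM_natr lnK ?posrE.
Qed.

Lemma total_rate_le :
  K%:R * coefficient_rate n r sigma tau L T + C ^+ 2 / K%:R ^+ (2 * alpha) <=
  rate_constant * rate n alpha eps delta.
Proof.
rewrite /rate -/l -/D; set A := _ `^ _; set B := _ `^ _.
have A0 : 0 <= A by exact: powR_ge0.
have B0 : 0 <= B by exact: powR_ge0.
have KA : K%:R / n%:R <= A by exact: cutoff_div_le.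
have KB : K%:R ^+ 2 / (n%:R * eps) ^+ 2 <= B by exact: cutoff_sqr_div_le.
have K0 : 0 <= K%:R :> R by [].
have KA0 : 0 <= K%:R / n%:R :> R by exact: divr_ge0.
have lD4 : 1 <= 4 * (l * D) by move: l_ge D_ge; nra.
have lD0 : 0 <= l * D by lra.
have t1 : K%:R * (24 * r ^+ 2 / n%:R + 128 * sigma ^+ 2 / n%:R) <= (24 * r ^+ 2 + 128 * sigma_hi ^+ 2) * A.
  rewrite (_ : K%:R * _ = (24 * r ^+ 2 + 128 * sigma ^+ 2) * (K%:R / n%:R)); last by field; exact: lt0r_neq0.
  have := sqr_ge0 r; have := sqr_ge0 sigma; have := s2 => ? ? ?.
  by apply: ler_pM => //; lra.
have t2 : K%:R * (32 * tau ^+ 2) <= 1024 * cT * (l * D) * B.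
  rewrite /tau noise_sd_sqr//.
  rewrite (_ : K%:R * _ = 512 * (T ^+ 2 * (K%:R ^+ 2 / (n%:R * eps) ^+ 2 * ln (5 / 4 / delta)))); last first.
    by field; rewrite !lt0r_neq0.
  rewrite (_ : 1024 * _ * _ * _ = 512 * (cT * l * (B * (2 * D)))); last by ring.
  have L0 := ltW (ln_inv_delta_gt0 d01).
  have K20 : 0 <= K%:R ^+ 2 / (n%:R * eps) ^+ 2 by apply: divr_ge0; exact: sqr_ge0.
  have KL : K%:R ^+ 2 / (n%:R * eps) ^+ 2 * ln (5 / 4 / delta) <= B * (2 * D) by exact: ler_pM.
  apply: ler_wpM2l; first exact: ler0n.
  by apply: (ler_pM (sqr_ge0 T) _ T_sqr KL); exact: mulr_ge0.
have t3 : K%:R * (32 * T ^+ 2 * n%:R * expR (- (L ^+ 2 / (2 * sigma ^+ 2)))) <= 32 * cT * A.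
  rewrite exp_tail.
  rewrite (_ : K%:R * _ = 32 * (T ^+ 2 / n%:R ^+ 2) * (K%:R / n%:R)); last by field; exact: lt0r_neq0.
  have Tn : T ^+ 2 / n%:R ^+ 2 <= cT.
    rewrite ler_pdivrMr ?exprn_gt0//; apply: le_trans T_sqr _; rewrite ler_wpM2l//.
    by apply: le_trans l_le _; move: n_ge2; nra.
  apply: ler_pM => //; last by rewrite ler_pM2l.
    by apply: mulr_ge0 => //; apply: divr_ge0; exact: sqr_ge0.
set M := (2 / c1) ^+ (2 * alpha).
have M0 : 0 <= M by rewrite exprn_ge0// divr_ge0// ltW.
have t4 : C ^+ 2 / K%:R ^+ (2 * alpha) <= C ^+ 2 * (M * (A + B)).
  by rewrite ler_wpM2l ?sqr_ge0//; exact: cutoff_bias_le.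
have CM0 : 0 <= C ^+ 2 * M by rewrite mulr_ge0// sqr_ge0.
have r2 := sqr_ge0 r; have h2 := sqr_ge0 sigma_hi.
have BlD : B <= 4 * (B * (l * D)) by rewrite mulrCA; apply: ler_peMr.
have BlD0 : 0 <= B * (l * D) by exact: mulr_ge0.
rewrite /rate_constant /coefficient_rate -/cT -/M.
set Q := B * (l * D) in BlD BlD0.
set X := 24 * r ^+ 2 + 128 * sigma_hi ^+ 2 in t1 *.
have X0 : 0 <= X by rewrite /X; lra.
rewrite (_ : 1024 * cT * (l * D) * B = 1024 * (cT * Q)) in t2; last by rewrite /Q; ring.
rewrite (_ : A + B * l * D = A + Q); last by rewrite /Q mulrA.
rewrite (_ : K%:R * _ = K%:R * (24 * r ^+ 2 / n%:R + 128 * sigma ^+ 2 / n%:R) + K%:R * (32 * tau ^+ 2) +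
  K%:R * (32 * T ^+ 2 * n%:R * expR (- (L ^+ 2 / (2 * sigma ^+ 2))))); last by rewrite -!mulrDr.
have CMB : C ^+ 2 * M * B <= C ^+ 2 * M * (4 * Q) by exact: ler_wpM2l.
have XQ : 0 <= X * Q by exact: mulr_ge0.
have cA : 0 <= cT * A by exact: mulr_ge0.
have cQ : 0 <= cT * Q by exact: mulr_ge0.
have MA : 0 <= C ^+ 2 * M * A by exact: mulr_ge0.
apply: (@le_trans _ _ (X * A + 1024 * (cT * Q) + 32 * cT * A + C ^+ 2 * (M * (A + B)))).
  by rewrite !lerD.
have combine (x a q c m b : R) : m * b <= m * (4 * q) -> 0 <= x * q -> 0 <= c * a ->
    0 <= c * q -> 0 <= m * a ->
    x * a + 1024 * (c * q) + 32 * c * a + m * (a + b) <= (x + 1056 * c + 4 * m) * (a + q).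
  by lra.
by rewrite [C ^+ 2 * (M * _)]mulrA -(mulrA 4); exact: combine.
Qed.
End total_rate.

(** The zero function shows that a uniform bound on the class is nonnegative. *)
Lemma sobolev_class_zero {R : realType} alpha (C : R) : sobolev_class alpha C (fun=> 0).
Proof.
exists (fun _ _ => 0); split=> //.
  split=> // j _ x _; rewrite /Rintegral integral0_eq//= addr0//.
by rewrite integral0_eq ?lee_fin ?sqr_ge0// => x _; rewrite expr0n addr0.
Qed.

Theorem theorem6p2 (R : realType) :
  exists2 c0 : R, 0 < c0 <= 1 &
  forall c1 : R, 0 < c1 <= c0 ->
  forall (alpha : nat) (C sigma_lo sigma_hi r : R),
    (1 <= alpha)%N -> 0 < C -> 0 < sigma_lo -> sigma_lo <= sigma_hi ->
    (forall f : R -> R, sobolev_class alpha C f ->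
       forall x : R, x \in `[0, 1] -> `|f x| <= r) ->
  exists C' : R,
  forall (sigma : R) (n : nat) (eps delta : R),
    sigma_lo <= sigma <= sigma_hi ->
    (2 <= n)%N -> 0 < eps < 1 -> 1 <= n%:R * eps -> 0 < delta < 2^-1 ->
  let T := truncation_level n r sigma in
  let K := cutoff n alpha c1 eps in
  forall (d : measure_display) (Omega : measurableType d)
    (P : probability Omega R)
    (X xi : 'I_n -> {RV P >-> R}) (w : 'I_K -> {RV P >-> R}),
    regression_model sigma (noise_sd n K T eps delta) X xi w ->
    differentially_private P (fun z : R * R => z.2 \in `[0, 1])
      (fun (data : 'I_n -> R * R) omega =>
         f_tilde T data (fun j => w j omega) : function_space R)
      eps delta
    /\
    (ereal_sup
       [set (\int[P]_omega \int[lebesgue_measure]_(x in `[0%R, 1%R]%classic)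
               ((f_tilde T (fun i => (f (X i omega) + xi i omega, X i omega))
                         (fun j => w j omega) x - f x) ^+ 2)%:E)%E
        | f in sobolev_class alpha C]
     <= (C' * rate n alpha eps delta)%:E)%E.
Proof.
(* The size of [c1] matters only for the bias, through a power of [2 / c1]. *)
exists 1; first by rewrite ltr01 lexx.
move=> c1 /andP[c10 c11] alpha C sigma_lo sigma_hi r alpha1 C0 lo0 lohi rP.
exists (rate_constant alpha c1 C r sigma_hi).
move=> sigma n eps delta /andP[slo shi] n2 /andP[e0 e1] ne1 d01 T K d Omega P X xi w model.
have n0 : (0 < n)%N by exact: ltnW.
have s0 : 0 < sigma by exact: lt_le_trans slo.
have r0 : 0 <= r.
  by have := rP _ (sobolev_class_zero alpha C) 0; rewrite normr0; apply; rewrite in_itv/= lexx ler01.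
pose L := 2 * sigma * Num.sqrt (2 * ln n%:R).
have L0 : 0 < L.
  by rewrite mulr_gt0 ?mulr_gt0// sqrtr_gt0 mulr_gt0// ln_gt0// (ltr_nat _ 1).
have T0 : 0 < T by rewrite ltr_wpDl.
have K0 : (0 < K)%N by exact: cutoff_ge1.
have [_ _ w_normal indep] := model.
have w_ind : mutually_independent w.
  exact: (mutually_independent_comp (@inr_inj _ _) indep).
split.
  by apply: estimator_private => //; rewrite e0.
apply: ge_ereal_sup => _ [f Wf <-].
have bias := sobolev_proj Wf alpha1 K0.
apply: le_trans (risk_bound n0 s0 (noise_sd_gt0 n0 K0 T0 e0 d01) model
  (sobolev_L2 Wf) (rP f Wf) (ltW L0) erefl bias) _.
by rewrite lee_fin; exact: (total_rate_le alpha C r n2 c10 c11 s0 shi e0 ne1 d01).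
Qed.
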